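(* Let $n\ge1$ be an integer, $k\ge\frac{n-1}{2n}$, $a,b>0$ and $1\le p,q\le+\infty$ with $\min(p,q)<+\infty$. Let $f$ be a measurable function on $\mathbb{R}$ such that $$\big\|e^{na|x|^{2/n}}f\big\|_{L^p_{k,n}}<+\infty\quad\text{and}\quad \big\|e^{nb|x|^{2/n}}\mathcal{F}_{k,n}f\big\|_{L^q_{k,n}}<+\infty.$$ Then: 1. If $ab\ge\frac14$, then $f=0$ almost everywhere. 2. If $ab<\frac14$, there exist infinitely many linearly independent functions satisfying both conditions.
   Context: Notation: $\alpha=kn-\frac n2$; $j_\beta(z)=\Gamma(\beta+1)\sum_{m\ge0}\frac{(-1)^m}{m!\,\Gamma(\beta+m+1)}(z/2)^{2m}$ is the normalized Bessel function; $d\mu_{k,n}(x)=\frac{1}{2\Gamma(kn-\frac n2+1)}(\frac n2)^{kn-\frac n2}|x|^{2k+\frac2n-2}dx$, $L^p_{k,n}=L^p(\mathbb{R},d\mu_{k,n})$ with the usual norm (essential sup for $p=\infty$). The $(k,\frac2n)$-generalized Fourier transform is $\mathcal{F}_{k,n}f(\lambda)=\int_{\mathbb{R}}f(x)B_{k,n}(x,\lambda)\,d\mu_{k,n}(x)$ with kernel $B_{k,n}(x,\lambda)=j_\alpha(n|\lambda x|^{1/n})+(-i)^n(\frac n2)^n\frac{\Gamma(\alpha+1)}{\Gamma(\alpha+n+1)}\lambda x\,j_{\alpha+n}(n|\lambda x|^{1/n})$. *)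

(* Defs.v *)
From HB Require Import structures.
From mathcomp Require Import all_boot all_order all_algebra.
From mathcomp Require Import all_classical all_reals all_analysis.
From mathcomp Require Import measurable_realfun.
From mathcomp.real_closed Require Import complex.
Import Order.TTheory GRing.Theory Num.Theory numFieldNormedType.Exports.

Set Implicit Arguments.
Unset Strict Implicit.
Unset Printing Implicit Defensive.

Local Open Scope classical_set_scope.
Local Open Scope ring_scope.

Section Dunkl.
Context {R : realType}.

Definition Gamma (s : R) : R :=
  Rintegral (@lebesgue_measure R) `]0, +oo[ (fun t => t `^ (s - 1) * expR (- t)).

Definition jbessel (beta z : R) : R :=
  Gamma (beta + 1) *
  limn (series (fun m : nat =>
    (-1) ^+ m / (m`!%:R * Gamma (beta + m%:R + 1)) * (z / 2) ^+ (2 * m)%N)).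

Definition alpha_kn (n : nat) (k : R) : R := k * n%:R - n%:R / 2.

Definition w_kn (n : nat) (k : R) (x : R) : R :=
  (2 * Gamma (alpha_kn n k + 1))^-1 * (n%:R / 2) `^ (alpha_kn n k) *
  `|x| `^ (2 * k + 2 / n%:R - 2).

Definition mu_kn (n : nat) (k : R) (A : set R) : \bar R :=
  (\int[@lebesgue_measure R]_(x in A) (w_kn n k x)%:E)%E.

Lemma measurable_w_kn n k : measurable_fun [set: R] (w_kn n k).
Proof.
apply: measurable_realfun.measurable_funM => //.
apply: (@measurableT_comp _ _ _ _ _ _ (@powR R ^~ _)) => //.
Qed.

Lemma w_kn_ge0 n k x : 0 <= Gamma (alpha_kn n k + 1) -> 0 <= w_kn n k x.
Proof.
move=> hG; rewrite /w_kn mulr_ge0 ?powR_ge0 // mulr_ge0 ?powR_ge0 //.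
by rewrite invr_ge0 mulr_ge0.
Qed.

Lemma Gamma_ge0 s : 0 <= Gamma s.
Proof.
rewrite /Gamma /Rintegral fine_ge0 // integral_ge0 // => t _.
by rewrite lee_fin mulr_ge0 ?powR_ge0 // expR_ge0.
Qed.

Let mu_kn0 n k : mu_kn n k set0 = 0%E.
Proof. by rewrite /mu_kn integral_set0. Qed.

Let mu_kn_ge0 n k A : (0 <= mu_kn n k A)%E.
Proof.
rewrite /mu_kn integral_ge0 // => x _.
by rewrite lee_fin w_kn_ge0 // Gamma_ge0.
Qed.

Let mu_kn_sigma_additive n k : semi_sigma_additive (mu_kn n k).
Proof.
rewrite /mu_kn.
apply: (@semi_sigma_additive_nng_induced _ _ _ (@lebesgue_measure R)
  (fun x => (w_kn n k x)%:E)).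
- by apply/measurable_EFinP; exact: measurable_w_kn.
- by move=> x; rewrite lee_fin w_kn_ge0 // Gamma_ge0.
Qed.

HB.instance Definition _ n k := isMeasure.Build _ _ _ (mu_kn n k)
  (mu_kn0 n k) (mu_kn_ge0 n k) (@mu_kn_sigma_additive n k).

Definition cabs (z : R[i]) : R := Normc.normc z.

Definition cintegral (mu : {measure set R -> \bar R}) (g : R -> R[i]) : R[i] :=
  (Rintegral mu [set: R] (fun x => complex.Re (g x)) +i*
   Rintegral mu [set: R] (fun x => complex.Im (g x)))%C.

Definition B_kn (n : nat) (k : R) (x lam : R) : R[i] :=
  let a := alpha_kn n k in
  ((jbessel a (n%:R * `|lam * x| `^ (n%:R^-1)))%:C +
   (- 'i) ^+ n *
   ((n%:R / 2) ^+ n * (Gamma (a + 1) / Gamma (a + n%:R + 1)) * lam * x *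
     jbessel (a + n%:R) (n%:R * `|lam * x| `^ (n%:R^-1)))%:C)%C.

Definition F_kn (n : nat) (k : R) (f : R -> R[i]) (lam : R) : R[i] :=
  cintegral (mu_kn n k) (fun x => f x * B_kn n k x lam).

Definition weighted_norm (n : nat) (k c : R) (p : \bar R) (g : R -> R[i]) : \bar R :=
  Lnorm (mu_kn n k) p
    (fun x => (expR (n%:R * c * `|x| `^ (2 / n%:R)) * cabs (g x))%:E).

Definition cmeasurable (g : R -> R[i]) : Prop :=
  measurable_fun [set: R] (fun x => complex.Re (g x)) /\
  measurable_fun [set: R] (fun x => complex.Im (g x)).

End Dunkl.

(* Main.v *)
(** Put X = |x|^(2/n). On even functions, and on odd functions divided by x, the
transform is a Hankel transform, which maps gaussians e^(-zX) to gaussians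
e^(-(n/2)^2 X/z). Shrinking a we may take ab = 1/4; with A = na and B = nb Parseval's
identity then says that
   D(T) = (1-T)^(-beta) int phi e^(AX) e^(-2AX/(1-T)),
a Laplace transform of phi e^(AX), coincides for |T| < 1 with a similar
transform of psi e^(BX) at 1+T, where psi is the transform of phi. The first formula
makes sense for T < 1 and the second one for T > -1, so together they define D on the
whole line. The Taylor coefficients of D are moments of phi and psi against Laguerre
functions, and the bounds on the latter (an energy estimate for their differential
equation) show that D is entire of polynomial growth, hence a polynomial. Since p or q
is finite, D tends to 0 at one of the two ends, so D = 0, and the injectivity of the
Laplace transform gives phi = 0. When ab < 1/4 the gaussians e^(-zX) with
na < z < n/(4b) satisfy both conditions. *)

Require Import Defs.
From HB Require Import structures.
From mathcomp Require Import all_boot all_order all_algebra.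
From mathcomp Require Import all_classical all_reals all_analysis.
From mathcomp Require Import measurable_realfun ess_sup_inf.
From mathcomp Require Import cyclic separable cyclotomic.
From mathcomp.real_closed Require Import complex.
From mathcomp Require Import zify ring lra.
Import Order.TTheory GRing.Theory Num.Theory numFieldNormedType.Exports.
Set Implicit Arguments.
Unset Strict Implicit.
Unset Printing Implicit Defensive.
Local Open Scope classical_set_scope.
Local Open Scope ring_scope.

(** The kernel [u^(-b) exp(-X/u)] at [u = 1 - T] generates Laguerre polynomials, with
    [b = alpha + 1] on the even side and [b = alpha + n + 1] on the odd side. The assumption on [k]
    says that [alpha + 1 >= 1/2], the threshold of the energy estimate, which serves the Laguerre
    functions and the Bessel kernel alike. The bounds on [f] and its transform give integrability
    only up to a polynomial weight, so the Laguerre functions must also decay in [X], at a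
    polynomial cost in their index.

    The [k]-th Taylor coefficient of [D] at a real [T] is thus at most [C (k+1)^A (1+|T|)^(M-k)],
    and the expansion at [T] converges for [|z - T| < 1 + |T|]. These discs cover the complex plane:
    if [|T| = |a|^2] and [T] has the sign of [Re a], then [|a - T|^2 <= |T| + T^2 <= (|T| + 1/2)^2].
    A polynomial bound in [T] therefore becomes one in [a], of twice the degree. The complex
    analysis is carried out on partial sums of power series: continuation by steps of [1/8] away
    from [0], and Cauchy estimates by averages over roots of unity. *)

(** * Laguerre polynomials and bounds on Laguerre functions *)

Section Laguerre.
Context {R : realType}.
Implicit Types (b x : R) (m : nat).

(* The energy [x f'^2 + d f^2] is nonincreasing. *)
Lemma ode_energy_bound (f f1 f2 : R -> R) (b c d : R) :
  (forall x, is_derive x 1 f (f1 x)) -> (forall x, is_derive x 1 f1 (f2 x)) ->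
  (forall x, 0 <= x -> x * f2 x + (b + c * x) * f1 x + d * f x = 0) ->
  2^-1 <= b -> 0 <= c -> 0 < d ->
  forall x, 0 <= x -> `|f x| <= `|f 0|.
Proof.
move=> df df1 ode hb hc hd x x0.
pose E x := x * f1 x ^+ 2 + d * f x ^+ 2.
have dE (y : R) : is_derive y 1 E (f1 y ^+ 2 + y * (2 * f1 y * f2 y) + d * (2 * f y * f1 y)).
  have h1 := df y; have h2 := df1 y.
  rewrite /E; apply: is_derive_eq.
  by rewrite /GRing.scale /=; ring.
have [|z] := @MVT_segment R E _ 0 x x0 (fun y _ => dE y).
  apply: continuous_subspaceT => y.
  have := dE y => -[/derivable1_diffP/differentiable_continuous + _]; exact.
rewrite in_itv /= => /andP[z0 zx] EE.
have Ez : f1 z ^+ 2 + z * (2 * f1 z * f2 z) + d * (2 * f z * f1 z) <= 0.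
  (* The equation reduces the derivative of the energy to [f1 z ^+ 2 * (1 - 2 * (b + c * z))]; this
     is where the threshold [2^-1 <= b] comes from. *)
  have -> : f1 z ^+ 2 + z * (2 * f1 z * f2 z) + d * (2 * f z * f1 z) =
    f1 z ^+ 2 * (1 - 2 * (b + c * z)) +
    2 * f1 z * (z * f2 z + (b + c * z) * f1 z + d * f z) by ring.
  rewrite ode // mulr0 addr0 mulr_ge0_le0 ?sqr_ge0 //.
  have : 0 <= c * z by rewrite mulr_ge0.
  lra.
have : E x <= E 0.
  by rewrite -subr_le0 EE subr0 mulr_le0_ge0.
rewrite /E mul0r add0r => Ex.
rewrite -(@ler_pXn2r _ 2) ?nnegrE // !real_normK ?num_real //.
rewrite -(ler_pM2l hd); apply: le_trans Ex.
by rewrite lerDr mulr_ge0 ?sqr_ge0.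
Qed.

(** The Laguerre polynomial [L_m^(b-1)]. The recurrence through the derivative is the one that
    differentiating [u^(-b) exp(-x/u)] in [u] produces. *)
Fixpoint lagp b m : {poly R} :=
  if m is m'.+1 then
    m'.+1%:R^-1 *: ((b + m'%:R)%:P * lagp b m' - 'X * lagp b m' + 'X * (lagp b m')^`())
  else 1.

Lemma lagpS b m :
  m.+1%:R *: lagp b m.+1 =
  (b + m%:R)%:P * lagp b m - 'X * lagp b m + 'X * (lagp b m)^`().
Proof. by rewrite /= scalerA divff ?scale1r // pnatr_eq0. Qed.

Lemma lagp0 b : lagp b 0 = 1. Proof. by []. Qed.

#[local] Arguments lagp : simpl never.

Lemma scale_natS_inj m : injective (fun p : {poly R} => m.+1%:R *: p).
Proof. by apply: scalerI; rewrite pnatr_eq0. Qed.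

(** The two identities feed each other: differentiating the recurrence and eliminating the second
    derivative by the equation at [m] gives the derivative at [m.+1], which in turn gives the
    equation at [m.+1]. *)
Lemma lagp_ode b m :
  'X * (lagp b m)^`()^`() = - ((b%:P - 'X) * (lagp b m)^`()) - m%:R *: lagp b m
  /\ (lagp b m.+1)^`() = (lagp b m)^`() - lagp b m.
Proof.
have step k : 'X * (lagp b k)^`()^`() =
    - ((b%:P - 'X) * (lagp b k)^`()) - k%:R *: lagp b k ->
    (lagp b k.+1)^`() = (lagp b k)^`() - lagp b k.
  move=> ode; apply: (@scale_natS_inj k) => /=.
  rewrite -derivZ lagpS !(derivD, derivN, derivM, derivX, derivC) ode.
  rewrite -!mul_polyC !rmorphD /= !rmorph_nat -!(addn1 k) natrD.
  by rewrite ?derivC; ring.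
elim: m => [|m [ode dS]].
  have e : 'X * (lagp b 0)^`()^`() = - ((b%:P - 'X) * (lagp b 0)^`()) - 0%:R *: lagp b 0.
    by rewrite lagp0 -polyC1 !derivC ?mulr0 scale0r subr0 oppr0.
  by split; [exact: e|exact: step].
have e : 'X * (lagp b m.+1)^`()^`() =
    - ((b%:P - 'X) * (lagp b m.+1)^`()) - m.+1%:R *: lagp b m.+1.
  rewrite dS lagpS derivB.
  have -> : 'X * ((lagp b m)^`()^`() - (lagp b m)^`()) =
    'X * (lagp b m)^`()^`() - 'X * (lagp b m)^`() by ring.
  rewrite ode -!mul_polyC !rmorphD /= !rmorph_nat.
  by ring.
by split; [exact: e|exact: step].
Qed.

Lemma deriv_lagpS b m : (lagp b m.+1)^`() = (lagp b m)^`() - lagp b m.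
Proof. by have [] := lagp_ode b m. Qed.

Lemma lagp_rec b m :
  m.+2%:R *: lagp b m.+2 =
  (b + (2 * m.+1)%:R)%:P * lagp b m.+1 - 'X * lagp b m.+1 - (b + m%:R)%:P * lagp b m.
Proof.
rewrite lagpS deriv_lagpS.
have -> : 'X * ((lagp b m)^`() - lagp b m) =
   m.+1%:R *: lagp b m.+1 - (b + m%:R)%:P * lagp b m by rewrite lagpS; ring.
rewrite -!mul_polyC !rmorphD /= !rmorph_nat.
by ring.
Qed.

(** The factor is [exp(-x)], not the usual [exp(-x/2)]: it is the value at [u = 1] of the
    exponential in the kernel [u^(-b) exp(-x/u)]. *)
Definition lagf b m x := (lagp b m).[x] * expR (- x).

Lemma lagf0 b x : lagf b 0 x = expR (- x).
Proof. by rewrite /lagf lagp0 hornerC mul1r. Qed.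

Definition lagf' b m x := ((lagp b m)^`().[x] - (lagp b m).[x]) * expR (- x).

Lemma is_derive_lagf b m x : is_derive x 1 (lagf b m) (lagf' b m x).
Proof.
have h1 := is_derive_poly (lagp b m) x.
rewrite /lagf; apply: is_derive_eq.
by rewrite /lagf' /GRing.scale /=; ring.
Qed.

(* Rodrigues' step: it makes [kap b m.+1] the derivative of [kap b m] up to a constant. *)
Lemma lagf_step b m x :
  (b + m%:R) * lagf b m x + x * lagf' b m x = m.+1%:R * lagf b m.+1 x.
Proof.
rewrite /lagf /lagf'; have := lagpS b m; move: (lagp b m.+1) (lagp b m) => q p.
move=> /(congr1 (horner^~ x)) e; rewrite !hornerE in e.
by rewrite [RHS]mulrA e; ring.
Qed.

Lemma lagf_rec b m x :
  x * lagf b m.+1 x = (b + (2 * m.+1)%:R) * lagf b m.+1 x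
    - (b + m%:R) * lagf b m x - m.+2%:R * lagf b m.+2 x.
Proof.
have : m.+2%:R * lagf b m.+2 x =
  (b + (2 * m.+1)%:R) * lagf b m.+1 x - x * lagf b m.+1 x - (b + m%:R) * lagf b m x.
  rewrite /lagf; have := lagp_rec b m.
  move: (lagp b m.+2) (lagp b m.+1) (lagp b m) => q2 q1 q0.
  move=> /(congr1 (horner^~ x)) e; rewrite !hornerE in e.
  by rewrite mulrA e; ring.
lra.
Qed.

(** The function solves [x f'' + (b + x) f' + (b + m) f = 0], the energy estimate with [c = 1] and
    [d = b + m]. *)
Lemma lagf_le0 b m x : 2^-1 <= b -> 0 <= x -> `|lagf b m x| <= `|lagf b m 0|.
Proof.
move=> hb; set p := lagp b m.
pose f2 y := ((p^`() - p)^`() - (p^`() - p)).[y] * expR (- y).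
apply: (@ode_energy_bound _ (lagf' b m) f2 b 1 (b + m%:R)).
- exact: is_derive_lagf.
- move=> y; have h1 := is_derive_poly (p^`() - p) y.
  have -> : lagf' b m = (fun y => (p^`() - p).[y] * expR (- y)).
    by apply/funext => z; rewrite /lagf' hornerD hornerN.
  rewrite /f2; move: (p^`() - p) h1 => r h1; apply: is_derive_eq.
  by rewrite /GRing.scale /= hornerD hornerN; ring.
- move=> y _.
  have [ode _] := lagp_ode b m.
  have := congr1 (fun q : {poly R} => q.[y]) ode.
  rewrite -/p !hornerE /f2 /lagf' /lagf -/p derivB !hornerE => o.
  set e := expR _.
  transitivity (e * (y * p^`()^`().[y] + (b - y) * p^`().[y] + m%:R * p.[y])).
    by rewrite /=; ring.
  by rewrite o; ring.
- exact: hb.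
- exact: ler01.
- by rewrite ltr_wpDr //; lra.
Qed.

(** The value at [0] is the product of the [(b + i) / (i + 1)]. By Bernoulli's inequality each
    factor is at most [((i + 2) / (i + 1))^A], and these powers telescope. *)
Lemma lagf_at0 b m (A : nat) : 2^-1 <= b -> b <= A%:R ->
  0 <= lagf b m 0 <= m.+1%:R ^+ A.
Proof.
move=> hb hA; elim: m => [|m /andP[ih0 ih]].
  by rewrite lagf0 oppr0 expR0 ler01 expr1n lexx.
have E : lagf b m.+1 0 = (b + m%:R) / m.+1%:R * lagf b m 0.
  have := lagf_step b m 0; rewrite mul0r addr0 => e.
  by rewrite mulrAC e mulrAC divff ?mul1r // pnatr_eq0.
have c0 : 0 <= (b + m%:R) / m.+1%:R by rewrite divr_ge0 // addr_ge0 //; lra.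
rewrite E mulr_ge0 //=.
apply: (@le_trans _ _ ((m.+2%:R / m.+1%:R) ^+ A * m.+1%:R ^+ A)).
  apply: ler_pM => //.
  apply: (@le_trans _ _ (1 + A%:R / m.+1%:R)).
    rewrite ler_pdivrMr // mulrDl mul1r divfK ?pnatr_eq0 //.
    by rewrite -natr1; lra.
  have -> : m.+2%:R / m.+1%:R = 1 + m.+1%:R^-1 :> R.
    by rewrite -natr1 mulrDl divff ?pnatr_eq0 // mul1r.
  have i0 : 0 <= m.+1%:R^-1 :> R by rewrite invr_ge0.
  move: (m.+1%:R^-1) i0 => i i0; clear -i0; elim: A => [|A IH].
    by rewrite mul0r addr0 expr0.
  rewrite exprS -natr1.
  apply: (@le_trans _ _ ((1 + i) * (1 + A%:R * i))); last by rewrite ler_pM2l //; lra.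
  have : 0 <= A%:R * i * i by rewrite !mulr_ge0.
  lra.
by rewrite -exprMn divfK // pnatr_eq0.
Qed.

(** By the three-term recurrence, multiplication by [1 + x] turns a Laguerre function into a
    combination of its neighbours with coefficients of order [m]. Each power of [1 + x] thus costs
    one power of [m.+1]. *)
Lemma lagf_decay b (N : nat) : 2^-1 <= b ->
  exists C : R, exists A : nat, 0 <= C /\ forall m x, 0 <= x ->
    (1 + x) ^+ N * `|lagf b m x| <= C * m.+1%:R ^+ A.
Proof.
move=> hb; elim: N => [|N [C [A [C0 IH]]]].
  exists 1, (Num.bound b); split => // m x x0.
  rewrite expr0 !mul1r; apply: (le_trans (lagf_le0 m hb x0)).
  have bA : b <= (Num.bound b)%:R by apply/ltW/archi_boundP; lra.
  by have /andP[p0 +] := lagf_at0 m hb bA; rewrite ger0_norm.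
have Ab : b <= (Num.bound b)%:R by apply/ltW/archi_boundP; lra.
set B : R := (Num.bound b)%:R in Ab *.
have B0 : 0 <= B by [].
exists (C * (2 * B + 6) * 3 ^+ A), A.+1; split.
  by rewrite !mulr_ge0 // ?exprn_ge0 //; lra.
move=> m x x0.
pose v : R := m.+1%:R.
have v1 : 1 <= v by rewrite ler1n.
have IH' k : (k <= m.+1)%N -> (1 + x) ^+ N * `|lagf b k x| <= C * 3 ^+ A * v ^+ A.
  move=> km; apply: le_trans (IH k x x0) _.
  rewrite -mulrA ler_wpM2l // -exprMn lerXn2r ?nnegrE // ?mulr_ge0 //.
  by rewrite -natrM ler_nat; lia.
have key : exists c0 c1 c2 : R, exists k0 k1 k2 : nat,
   [/\ (1 + x) * lagf b m x = c0 * lagf b k0 x + c1 * lagf b k1 x + c2 * lagf b k2 x,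
    (k0 <= m.+1)%N, (k1 <= m.+1)%N, (k2 <= m.+1)%N &
    `|c0| + `|c1| + `|c2| <= (2 * B + 6) * v].
  case: m @v v1 {IH'} => [|m] v v1.
    (* Index [0] has no predecessor: the identity has two terms, and the third is filled with
       coefficient [0]. *)
    exists (1 + b), (-1), 0, 0%N, 1%N, 0%N; split => //.
      have := lagf_step b 0 x.
      have -> : lagf' b 0 x = - lagf b 0 x.
        by rewrite /lagf' /lagf lagp0 -polyC1 derivC !hornerE; ring.
      by lra.
    rewrite normrN normr1 normr0 ger0_norm; first by rewrite /v; lra.
    by lra.
  exists (1 + b + (2 * m.+1)%:R), (- (b + m%:R)), (- m.+2%:R), m.+1, m, m.+2; split => //.
  - by rewrite mulrDl mul1r lagf_rec; ring.
  - by rewrite -addn2 leq_addr.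
  - have m0 : 0 <= m%:R :> R by [].
    rewrite !normrN !ger0_norm //; [|by lra|by rewrite natrM -(natr1 m); lra].
    rewrite /v natrM -!natr1.
    have : 0 <= B * m%:R by rewrite mulr_ge0.
    nra.
have [c0 [c1 [c2 [k0 [k1 [k2 [E h0 h1 h2 hc]]]]]]] := key.
have x10 : 0 <= (1 + x) ^+ N by rewrite exprn_ge0 // addr_ge0.
have -> : (1 + x) ^+ N.+1 * `|lagf b m x| = (1 + x) ^+ N * `|(1 + x) * lagf b m x|.
  by rewrite [in RHS]normrM [`|1 + x|]ger0_norm ?addr_ge0 // exprSr mulrA.
rewrite E.
set W := C * 3 ^+ A * v ^+ A in IH'.
have W0 : 0 <= W by rewrite !mulr_ge0 // exprn_ge0.
apply: (@le_trans _ _ ((`|c0| + `|c1| + `|c2|) * W)).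
  apply: (@le_trans _ _ ((1 + x) ^+ N * (`|c0 * lagf b k0 x| + `|c1 * lagf b k1 x| + `|c2 * lagf b k2 x|))).
    by rewrite ler_wpM2l // (le_trans (ler_normD _ _)) // lerD2r ler_normD.
  rewrite (normrM c0) (normrM c1) (normrM c2) !mulrDr !mulrDl ![(1 + x) ^+ N * (_ * _)]mulrCA.
  by rewrite !lerD // ler_wpM2l // IH'.
apply: le_trans (ler_wpM2r W0 hc) _.
by rewrite /W exprS -/v le_eqVlt; apply/orP; left; apply/eqP; ring.
Qed.

End Laguerre.

(** * Series with polynomial times geometric terms *)

Section PolynomialGeometric.
Context {R : realType}.
Implicit Types (x : R) (A k m n N : nat).

Lemma leq_expn2r e m n : (m <= n)%N -> (m ^ e <= n ^ e)%N.
Proof. by case: e => // e mn; rewrite leq_exp2r. Qed.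

Lemma ffact_le_expn n m : (n ^_ m <= n ^ m)%N.
Proof.
elim: m n => [//|m IH] n; rewrite ffactnS expnS leq_mul2l; apply/orP; right.
by apply: leq_trans (IH _) _; rewrite leq_expn2r // leq_pred.
Qed.

Lemma bin_le_expn n m : ('C(n, m) <= n ^ m)%N.
Proof.
apply: leq_trans (ffact_le_expn n m); rewrite -bin_ffact.
by rewrite leq_pmulr // fact_gt0.
Qed.

Lemma addS_le_mulS m n : ((n.+1 + m).+1 <= m.+2 * n.+1)%N.
Proof. by rewrite -addSn addnC -!addSnnS mulSn mulSn; nia. Qed.

Lemma expn_le_bin k A : (k.+1 ^ A <= A`! * 'C(k + A, A))%N.
Proof.
elim: A => [|A IH]; first by rewrite expn0 bin0 fact0.
rewrite factS expnS addnS -mulnA mulnCA -mul_bin_diag mulnCA.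
by rewrite leq_mul // -addSn leq_addr.
Qed.

(** Negative binomial series: by Pascal's rule, [1 - x] times the sum for [A.+1] is at most the sum
    for [A]. *)
Lemma sum_bin_geometric_le A N x : 0 <= x < 1 ->
  \sum_(k < N) 'C(k + A, A)%:R * x ^+ k <= (1 - x) ^- A.+1.
Proof.
move=> /andP[x0 x1]; have y0 : 0 < 1 - x by rewrite subr_gt0.
elim: A N => [|A IH] N.
  have : (1 - x) * \sum_(k < N) 'C(k + 0, 0)%:R * x ^+ k = 1 - x ^+ N.
    elim: N => [|N IH]; first by rewrite big_ord0 mulr0 expr0 subrr.
    by rewrite big_ord_recr /= mulrDr IH bin0 exprS; ring.
  rewrite expr1 => e; rewrite -(ler_pM2l y0) e divff ?gt_eqF //.
  by rewrite lerBlDr lerDl exprn_ge0.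
have S0 B M : 0 <= \sum_(k < M) 'C(k + B, B)%:R * x ^+ k.
  by apply: sumr_ge0 => k _; rewrite mulr_ge0 // exprn_ge0.
set S := \sum_(k < N) _.
have : S <= x * S + \sum_(k < N) 'C(k + A, A)%:R * x ^+ k.
  rewrite /S; case: N {S} => [|N]; first by rewrite !big_ord0 mulr0 addr0.
  rewrite [X in _ <= x * X + _]big_ord_recr /= mulrDr mulr_sumr.
  rewrite [X in X <= _]big_ord_recl [X in _ <= _ + X]big_ord_recl /=.
  rewrite !add0n !binn !expr0 !mulr1.
  have -> : \sum_(i < N) 'C(bump 0 i + A.+1, A.+1)%:R * x ^+ bump 0 i =
     \sum_(i < N) x * ('C(i + A.+1, A.+1)%:R * x ^+ i) +
     \sum_(i < N) 'C(bump 0 i + A, A)%:R * x ^+ bump 0 i.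
    rewrite -big_split /=; apply: eq_bigr => i _.
    by rewrite /bump /= !add1n addSn binS natrD addnS addSn exprS; ring.
  have : 0 <= x * ('C(N + A.+1, A.+1)%:R * x ^+ N).
    by rewrite !mulr_ge0 // exprn_ge0.
  lra.
move=> h; have : (1 - x) * S <= (1 - x) ^- A.+1.
  by apply: le_trans (IH N); lra.
by move=> h'; rewrite exprS invfM -(ler_pM2l y0) mulrA divff ?gt_eqF // mul1r.
Qed.

Lemma sum_pow_geometric_le A N x : 0 <= x < 1 ->
  \sum_(k < N) k.+1%:R ^+ A * x ^+ k <= A`!%:R * (1 - x) ^- A.+1.
Proof.
move=> x01; have /andP[x0 _] := x01.
apply: le_trans (ler_wpM2l _ (sum_bin_geometric_le A N x01)); last by [].
rewrite mulr_sumr; apply: ler_sum => k _.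
by rewrite mulrA -natrX -natrM ler_wpM2r ?exprn_ge0 // ler_nat expn_le_bin.
Qed.

Lemma pow_geometric_le A k x : 0 <= x < 1 ->
  k.+1%:R ^+ A * x ^+ k <= A`!%:R * (1 - x) ^- A.+1.
Proof.
move=> x01; have /andP[x0 _] := x01.
apply: le_trans (sum_pow_geometric_le A k.+1 x01).
rewrite big_ord_recr /= lerDr sumr_ge0 // => i _.
by rewrite mulr_ge0 // exprn_ge0.
Qed.

Lemma sqrt_gt_between x : 0 <= x < 1 -> exists y, x < y < 1.
Proof. by move=> /andP[x0 x1]; exists ((x + 1) / 2); lra. Qed.

(** For [x < y < 1] the sequence [(k+1)^A (x/y)^k] is bounded and [y^k] tends to [0]. *)
Lemma cvg_pow_geometric A x : 0 <= x < 1 ->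
  (fun k : nat => k.+1%:R ^+ A * x ^+ k) @ \oo --> (0 : R).
Proof.
move=> x01; have [y /andP[xy y1]] := sqrt_gt_between x01.
have /andP[x0 _] := x01.
have y0 : 0 < y by lra.
have z01 : 0 <= x / y < 1.
  by rewrite divr_ge0 ?(ltW y0) //= ltr_pdivrMr // mul1r.
set K := A`!%:R * (1 - x / y) ^- A.+1.
have h : (fun k : nat => K * y ^+ k) @ \oo --> (0 : R).
  rewrite -(mulr0 K); apply: cvgM; first exact: cvg_cst.
  by apply: cvg_expr; rewrite ger0_norm // ltW.
apply: (@squeeze_cvgr _ _ _ _ (cst 0) (fun k => K * y ^+ k)) => //; last exact: cvg_cst.
near=> k; apply/andP; split; first by rewrite mulr_ge0 // exprn_ge0.
have -> : k.+1%:R ^+ A * x ^+ k = k.+1%:R ^+ A * (x / y) ^+ k * y ^+ k.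
  by rewrite -mulrA -exprMn divfK ?gt_eqF.
by rewrite ler_wpM2r ?exprn_ge0 ?(ltW y0) // pow_geometric_le.
Unshelve. all: by end_near. Qed.

End PolynomialGeometric.

(** * The kernel [u^(-b) exp(-x/u)] and its Taylor expansion in [u] *)

Section LaguerreKernel.
Context {R : realType}.
Implicit Types (b u v x c : R) (m N : nat).

(* [(-1) ^ m * kap b m u x] is the [m]-th Taylor coefficient at [u] of
   [u |-> u^-b * exp (- x / u)]. *)
Definition kap b m u x := u `^ (- (b + m%:R)) * lagf b m (x / u).

Lemma kap0E b u x : kap b 0 u x = u `^ (- b) * expR (- (x / u)).
Proof. by rewrite /kap lagf0 addr0. Qed.

Lemma is_derive_kap b m u x : 0 < u ->
  is_derive u 1 (kap b m ^~ x) (- (m.+1%:R * kap b m.+1 u x)).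
Proof.
move=> u0.
have h1 : is_derive u 1 (fun u => u `^ (- (b + m%:R))) (- (b + m%:R) * u `^ (- (b + m%:R) - 1)).
  exact: is_derive1_powR.
have u1 : u != 0 by rewrite gt_eqF.
have h2 : is_derive u 1 (fun u => x / u) (- (x / u ^+ 2)).
  have hV := @is_deriveV _ id u 1 1 u1 (is_derive_id _ _).
  apply: is_derive_eq.
  by rewrite /GRing.scale /=; ring.
have h3 := is_derive_lagf b m (x / u).
have h4 : is_derive u 1 (fun u => lagf b m (x / u)) (lagf' b m (x / u) * - (x / u ^+ 2)).
  exact: (@is_derive1_comp _ (lagf b m) (fun u => x / u)).
rewrite /kap; apply: is_derive_eq.
rewrite /GRing.scale /=.
have e1 : u `^ (- (b + m.+1%:R)) = u `^ (- (b + m%:R)) * u^-1.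
  rewrite -natr1 addrA opprD powRD; last by rewrite u1 implybT.
  by rewrite powR_inv1 // ltW.
have e2 : u `^ (- (b + m%:R) - 1) = u `^ (- (b + m%:R)) * u^-1.
  by rewrite -e1 -natr1; congr (_ `^ _); ring.
rewrite e1 e2.
have -> : - (m.+1%:R * (u `^ (- (b + m%:R)) / u * lagf b m.+1 (x / u))) =
  - (u `^ (- (b + m%:R)) / u * (m.+1%:R * lagf b m.+1 (x / u))) by ring.
by rewrite -lagf_step; field.
Qed.

(** For [u >= 1] one has [1 + x <= u * (1 + x / u)], so the decay of [lagf] at [x / u] is
    transferred to [x] at the cost of [u ^+ N]. *)
Lemma kap_decay b N : 2^-1 <= b -> exists C : R, exists A : nat, 0 <= C /\
  forall m u x, 1 <= u -> 0 <= x ->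
  (1 + x) ^+ N * `|kap b m u x| <= C * m.+1%:R ^+ A * u ^+ N * u ^- m.
Proof.
move=> hb; have [C [A [C0 h]]] := lagf_decay N hb.
exists C, A; split => // m u x u1 x0.
have u0 : 0 < u by lra.
have {}h := h m (x / u) (divr_ge0 x0 (ltW u0)).
have xN : (1 + x) ^+ N <= u ^+ N * (1 + x / u) ^+ N.
  rewrite -exprMn lerXn2r ?nnegrE ?mulr_ge0 ?addr_ge0 ?divr_ge0 ?(ltW u0) //.
  by rewrite mulrDr mulr1 mulrC divfK ?gt_eqF // lerD2r.
have um : u `^ (- (b + m%:R)) <= u ^- m.
  rewrite -powR_invn ?(ltW u0) // ler_powR // lerN2 lerDr; lra.
rewrite /kap normrM ger0_norm ?powR_ge0 //.
have uN0 : 0 <= u ^+ N by rewrite exprn_ge0 // ltW.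
apply: (@le_trans _ _ ((u ^+ N * (1 + x / u) ^+ N) * (u ^- m * `|lagf b m (x / u)|))).
  apply: ler_pM => //; first by rewrite exprn_ge0 // addr_ge0.
    by rewrite mulr_ge0 ?powR_ge0.
  by rewrite ler_wpM2r.
have -> : u ^+ N * (1 + x / u) ^+ N * (u ^- m * `|lagf b m (x / u)|) =
  (1 + x / u) ^+ N * `|lagf b m (x / u)| * (u ^+ N * u ^- m) by ring.
by rewrite -[X in _ <= X]mulrA ler_wpM2r // mulr_ge0 // invr_ge0 exprn_ge0 // ltW.
Qed.

(** The point [v] is kept fixed and the centre [c] varies. The derivative of the Taylor sum in [c]
    telescopes to its last term, which is [O(N^E r^N)] for every [c] between [u] and [v], because
    [|c - v| <= r c] persists there. At [c = v] the sum is exactly the target, and the mean value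
    theorem bounds the error at [c = u]. The signs of the Taylor coefficients are absorbed by
    writing [u - v] for [v - u]. *)
Lemma kap_taylor b m u v x (r : R) : 2^-1 <= b -> 0 < u -> 0 < v -> 0 <= x ->
  `|u - v| <= r * u -> 0 <= r < 1 ->
  (fun N => \sum_(i < N) 'C(i + m, m)%:R * kap b (i + m) u x * (u - v) ^+ i)
    @ \oo --> kap b m v x.
Proof.
move=> hb u0 v0 x0 uv r01; have /andP[r0 r1] := r01.
pose S N c := \sum_(i < N) 'C(i + m, m)%:R * kap b (i + m) c x * (c - v) ^+ i.
pose S' N c := - (N%:R * 'C(N + m, m)%:R * kap b (N + m) c x * (c - v) ^+ N.-1).
have dS N c : 0 < c -> is_derive c 1 (S N) (S' N c).
  move=> c0; elim: N => [|N IH].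
    rewrite /S' /S !mul0r oppr0; under eq_fun do rewrite big_ord0.
    exact: is_derive_cst.
  have -> : S N.+1 = S N + (fun c => 'C(N + m, m)%:R * kap b (N + m) c x * (c - v) ^+ N).
    by apply/funext => z; rewrite /S big_ord_recr.
  have h1 := is_derive_kap b (N + m) x c0.
  have h2 : is_derive c 1 (fun c => (c - v) ^+ N) (N%:R * (c - v) ^+ N.-1).
    have h0 : is_derive c 1 (fun c => c - v) 1.
      by apply: is_derive_eq; rewrite subr0.
    have := is_deriveX N h0.
    have -> : (fun c => c - v) ^+ N = (fun c => (c - v) ^+ N).
      by apply/funext => z; rewrite exprfctE.
    by move=> /is_derive_eq; apply; rewrite /GRing.scale /=; ring.
  apply: is_derive_eq.
  rewrite /S' /GRing.scale /= -addSn.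
  have -> : N.+1%:R * 'C(N.+1 + m, m)%:R = (N + m).+1%:R * 'C(N + m, m)%:R :> R.
    rewrite -!natrM; congr (_%:R); rewrite addSn.
    by have := mul_bin_down (N + m).+1 m; rewrite subSn ?leq_addl // addnK /= => ->.
  by rewrite !addSn; move: ((c - v) ^+ N.-1) ((c - v) ^+ N) (kap _ _.+1 _ _) => p1 p2 p3; ring.
have Sv N : S N.+1 v = kap b m v x.
  rewrite /S big_ord_recl /= add0n binn expr0 mulr1 mul1r big1 ?addr0 // => i _.
  by rewrite subrr expr0n mulr0.
have [C [A [C0 hC]]] := lagf_decay 0 hb.
(* The power of [c] left after [|c - v| ^+ N] is compared with [r ^+ N] has a negative exponent, so
   it is largest at the smaller endpoint. *)
set mu := Num.min u v.
have mu0 : 0 < mu by rewrite lt_min u0.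
pose E := (m + A).+1.
set K := C * mu `^ (- (b + m.+1%:R)) * m.+2%:R ^+ E.
have K0 : 0 <= K by rewrite !mulr_ge0 ?powR_ge0 // exprn_ge0.
have bnd N : `|S N.+1 u - kap b m v x| <= K * `|u - v| * (N.+1%:R ^+ E * r ^+ N).
  have S'b c : mu <= c -> `|c - v| <= r * c -> `|S' N.+1 c| <= K * (N.+1%:R ^+ E * r ^+ N).
    move=> muc cv; have c0 : 0 < c by exact: lt_le_trans muc.
    have hL : `|lagf b (N.+1 + m) (x / c)| <= C * (N.+1 + m).+1%:R ^+ A.
      by have := hC (N.+1 + m)%N (x / c) (divr_ge0 x0 (ltW c0)); rewrite expr0 mul1r.
    rewrite /S' normrN /= /kap; move: (lagf b (N.+1 + m) (x / c)) hL => L hL.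
    rewrite !normrM !normr_nat normrX (ger0_norm (powR_ge0 _ _)).
    have hc : c `^ (- (b + (N.+1 + m)%:R)) * `|c - v| ^+ N <=
        mu `^ (- (b + m.+1%:R)) * r ^+ N.
      have -> : c `^ (- (b + (N.+1 + m)%:R)) = c `^ (- (b + m.+1%:R)) * c ^- N.
        rewrite -powR_invn ?(ltW c0) // -powRD; last by rewrite (gt_eqF c0) implybT.
        by congr (_ `^ _); rewrite natrD -!natr1; ring.
      rewrite -mulrA; apply: ler_pM; rewrite ?powR_ge0 //.
      - by rewrite mulr_ge0 ?invr_ge0 ?exprn_ge0 ?(ltW c0).
      - rewrite !powRN lef_pV2 ?posrE ?powR_gt0 //.
        by rewrite ge0_ler_powR ?nnegrE ?(ltW c0) ?(ltW mu0) // addr_ge0 //; lra.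
      - by rewrite mulrC ler_pdivrMr ?exprn_gt0 // -exprMn lerXn2r ?nnegrE ?mulr_ge0 ?(ltW c0).
    have hp : N.+1%:R * 'C(N.+1 + m, m)%:R * (N.+1 + m).+1%:R ^+ A <=
        m.+2%:R ^+ E * N.+1%:R ^+ E :> R.
      rewrite -exprMn -!natrM -!natrX -natrM ler_nat.
      apply: (@leq_trans ((N.+1 + m).+1 ^ E)); last exact/leq_expn2r/addS_le_mulS.
      rewrite /E expnS expnD mulnA leq_mul // leq_mul //; first by rewrite ltnS ltnW // leq_addr.
      by apply: leq_trans (bin_le_expn _ _) _; rewrite leq_expn2r.
    set p := N.+1%:R * 'C(N.+1 + m, m)%:R in hp *.
    set cc := c `^ _ in hc *; set vv := `|c - v| ^+ N in hc *.
    apply: (@le_trans _ _ (p * (C * (N.+1 + m).+1%:R ^+ A) * (cc * vv))).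
      have -> : p * (cc * `|L|) * vv = p * `|L| * (cc * vv) by ring.
      rewrite ler_wpM2r ?mulr_ge0 ?powR_ge0 ?exprn_ge0 // ler_wpM2l // mulr_ge0 //.
    have -> : p * (C * (N.+1 + m).+1%:R ^+ A) * (cc * vv) =
      C * (p * (N.+1 + m).+1%:R ^+ A) * (cc * vv) by ring.
    have -> : K * (N.+1%:R ^+ E * r ^+ N) =
      C * (m.+2%:R ^+ E * N.+1%:R ^+ E) * (mu `^ (- (b + m.+1%:R)) * r ^+ N).
      by rewrite /K; ring.
    apply: ler_pM => //.
    - by rewrite !mulr_ge0 // exprn_ge0.
    - by rewrite mulr_ge0 ?powR_ge0 // exprn_ge0.
    - by rewrite ler_wpM2l.
  rewrite -(Sv N) mulrAC.
  have cont y z : 0 < y -> {within `[y, z], continuous (S N.+1)}.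
    move=> y0; apply: derivable_within_continuous => c /[!in_itv] /= /andP[yc _].
    by have [] := dS N.+1 c (lt_le_trans y0 yc).
  have der y z : 0 < y -> forall c, c \in `]y, z[ -> is_derive c 1 (S N.+1) (S' N.+1 c).
    by move=> y0 c /[!in_itv] /= /andP[yc _]; exact: dS (lt_trans y0 yc).
  have [uv'|vu] := leP u v.
    have [c] := MVT_segment uv' (der u v u0) (cont u v u0).
    rewrite in_itv /= => /andP[uc cv] e; rewrite distrC e normrM (distrC u v).
    rewrite ler_wpM2r //; apply: S'b; first by rewrite /mu min_l.
    move: uv; rewrite ler_distlC ler_distl => /andP[_ h].
    by apply/andP; split; nra.
  have [c] := MVT_segment (ltW vu) (der v u v0) (cont v u v0).
  rewrite in_itv /= => /andP[vc cu] e; rewrite e normrM.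
  rewrite ler_wpM2r //; apply: S'b; first by rewrite /mu min_r // ltW.
  move: uv; rewrite ler_distl ler_distl => /andP[_ h].
  have : 0 <= (1 - r) * (u - c) by rewrite mulr_ge0; lra.
  have : 0 <= r * c by rewrite mulr_ge0; lra.
  by move=> ? ?; apply/andP; split; lra.
rewrite -(cvg_shiftS (S ^~ u)) /=.
apply/cvgrPdist_le => e e0.
have K1 : 0 < K * `|u - v| + 1 by rewrite ltr_wpDl // mulr_ge0.
have := @cvg_pow_geometric R E r r01 => /cvgrPdist_le /(_ (e / (K * `|u - v| + 1))).
move=> /(_ (divr_gt0 e0 K1)) h; near=> N.
rewrite distrC; apply: (le_trans (bnd N)).
have : `|0 - N.+1%:R ^+ E * r ^+ N| <= e / (K * `|u - v| + 1) by near: N.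
rewrite sub0r normrN ler_pdivlMr // => h1.
have := ler_norm (N.+1%:R ^+ E * r ^+ N) => h2.
have : 0 <= N.+1%:R ^+ E * r ^+ N by rewrite mulr_ge0 // exprn_ge0.
move: h1 h2; set q := N.+1%:R ^+ E * r ^+ N; set w := K * _ => h1 h2 q0.
rewrite ger0_norm // in h1.
have : q * (w + 1) = w * q + q by ring.
lra.
Unshelve. all: by end_near. Qed.

End LaguerreKernel.

(** * Tannery's theorem for sums of growing length *)

Section Tannery.
Context {R : realType}.

(** Beyond [I], [x^i] is at most [(x/y)^I y^i] for some [y] with [x < y < 1]; the sums with ratio
    [y] are bounded and [(x/y)^I] is small. *)
Lemma geometric_tail (A : nat) (x : R) : 0 <= x < 1 -> forall e, 0 < e ->
  exists I, forall N, \sum_(I <= i < N) i.+1%:R ^+ A * x ^+ i <= e.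
Proof.
move=> x01 e e0; have /andP[x0 x1] := x01.
have [y /andP[xy y1]] := sqrt_gt_between x01.
have y0 : 0 < y by lra.
have z01 : 0 <= x / y < 1 by rewrite divr_ge0 ?(ltW y0) //= ltr_pdivrMr // mul1r.
have /andP[z0 z1] := z01.
pose K : R := A`!%:R * (1 - y) ^- A.+1.
have K0 : 0 <= K by rewrite mulr_ge0 // invr_ge0 exprn_ge0 // subr_ge0 ltW.
have := cvg_pow_geometric 0 z01 => /cvgrPdist_lt /(_ (e / (K + 1))).
have K1 : 0 < K + 1 by rewrite ltr_wpDl.
move=> /(_ (divr_gt0 e0 K1)) [I _ /(_ I (leqnn I))].
rewrite /= expr0 mul1r sub0r normrN ger0_norm ?exprn_ge0 // ltr_pdivlMr // => hI.
exists I => N; apply: (@le_trans _ _ (\sum_(I <= i < N) (x / y) ^+ I * (i.+1%:R ^+ A * y ^+ i))).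
  apply: ler_sum_nat => i /andP[Ii _]; rewrite [leRHS]mulrCA ler_wpM2l ?exprn_ge0 //.
  rewrite -[in leLHS](subnK Ii) -[in leRHS](subnK Ii) !exprD [leLHS]mulrC.
  rewrite [leRHS]mulrCA -exprMn divfK ?gt_eqF // [leRHS]mulrC.
  by rewrite ler_wpM2l ?exprn_ge0 // lerXn2r ?nnegrE // ltW.
rewrite -mulr_sumr; apply: (@le_trans _ _ ((x / y) ^+ I * (K + 1))); last exact: ltW.
rewrite ler_wpM2l ?exprn_ge0 // ler_wpDr //.
have y01 : 0 <= y < 1 by rewrite (ltW y0).
have [IN|NI] := leqP I N; last by rewrite big_geq // ltnW.
apply: le_trans (sum_pow_geometric_le A N y01).
rewrite -(big_mkord xpredT (fun k => k.+1%:R ^+ A * y ^+ k)) [leRHS](@big_cat_nat _ _ _ I) //=.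
by rewrite lerDr sumr_ge0 // => i _; rewrite mulr_ge0 // exprn_ge0 // ltW.
Qed.

Lemma tannery (u : nat -> nat -> R) (K x : R) (A : nat) : 0 <= K -> 0 <= x < 1 ->
  (forall N i, 0 <= u N i <= K * (i.+1%:R ^+ A * x ^+ i)) ->
  (forall i, u ^~ i @ \oo --> (0 : R)) ->
  (fun N : nat => \sum_(i < N) u N i) @ \oo --> (0 : R).
Proof.
move=> K0 x01 hu u0; apply/cvgrPdist_le => e e0.
have K1 : 0 < K + 1 by rewrite ltr_wpDl.
have e2 : 0 < e / 2 by rewrite divr_gt0.
have [I hI] := geometric_tail A x01 (divr_gt0 e2 K1).
have : (fun N : nat => \sum_(i < I) u N i) @ \oo --> (\sum_(i < I) 0 : R).
  by apply: cvg_big => [|i _]; [exact: add_continuous|exact: u0].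
rewrite big1 // => /cvgrPdist_le /(_ _ e2) h.
near=> N.
have IN : (I <= N)%N by near: N; exact: nbhs_infty_ge.
have S0 M J : 0 <= \sum_(J <= i < M) u N i.
  by apply: sumr_ge0 => i _; have /andP[] := hu N i.
rewrite sub0r normrN -(big_mkord xpredT (u N)) ger0_norm ?S0 //.
rewrite (@big_cat_nat _ _ _ I) //=.
have h1 : \sum_(0 <= i < I) u N i <= e / 2.
  have : `|0 - \sum_(i < I) u N i| <= e / 2 by near: N.
  by rewrite sub0r normrN -(big_mkord xpredT (u N)) ger0_norm ?S0.
have h2 : \sum_(I <= i < N) u N i <= e / 2.
  apply: (@le_trans _ _ (K * \sum_(I <= i < N) i.+1%:R ^+ A * x ^+ i)).
    by rewrite mulr_sumr; apply: ler_sum_nat => i _; have /andP[] := hu N i.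
  apply: (@le_trans _ _ ((K + 1) * (e / 2 / (K + 1)))); last first.
    by rewrite mulrC divfK ?gt_eqF.
  apply: ler_pM => //; last by rewrite lerDl.
  apply: sumr_ge0 => i _; rewrite mulr_ge0 ?exprn_ge0 //.
  by case/andP: x01.
by rewrite [e]splitr lerD.
Unshelve. all: by end_near. Qed.

End Tannery.

(** * Modulus, Taylor coefficients of polynomials and roots of unity in [R[i]] *)

Section ComplexTaylor.
Context {R : realType}.
Implicit Types (z h a : R[i]) (f : nat -> R).

Lemma cabs_ge0 z : 0 <= cabs z.
Proof. by case: z => x y; rewrite /cabs /= sqrtr_ge0. Qed.

Lemma cabs0 : cabs (0 : R[i]) = 0. Proof. exact: Normc.normc0. Qed.

Lemma cabs1 : cabs (1 : R[i]) = 1. Proof. exact: Normc.normc1. Qed.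

Lemma cabs0_eq0 z : cabs z = 0 -> z = 0.
Proof. exact: Normc.eq0_normc. Qed.

Lemma cabsM z h : cabs (z * h) = cabs z * cabs h.
Proof. exact: Normc.normcM. Qed.

Lemma cabsV z : cabs z^-1 = (cabs z)^-1.
Proof. exact: Normc.normcV. Qed.

Lemma cabsD z h : cabs (z + h) <= cabs z + cabs h.
Proof. exact: (@le_normcD R z h). Qed.

Lemma cabsN z : cabs (- z) = cabs z.
Proof. exact: (@normcN R z). Qed.

Lemma cabsX z n : cabs (z ^+ n) = cabs z ^+ n.
Proof. by elim: n => [|n IH]; rewrite ?expr0 ?cabs1 // !exprS cabsM IH. Qed.

Lemma cabs_real (x : R) : cabs x%:C%C = `|x|.
Proof. by rewrite /cabs /= expr0n addr0 sqrtr_sqr. Qed.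

Lemma cabs_nat n : cabs (n%:R : R[i]) = n%:R.
Proof. by rewrite -(rmorph_nat (real_complex R)) cabs_real normr_nat. Qed.

Lemma cabs_sum (I : Type) (r : seq I) (P : pred I) (F : I -> R[i]) :
  cabs (\sum_(i <- r | P i) F i) <= \sum_(i <- r | P i) cabs (F i).
Proof.
elim/big_ind2: _ => [|z x h y hx hy|//]; first by rewrite cabs0.
by apply: le_trans (cabsD _ _) _; exact: lerD.
Qed.

Lemma sqr_cabs (x y : R) : cabs (x +i* y)%C ^+ 2 = x ^+ 2 + y ^+ 2.
Proof. by rewrite /cabs /= sqr_sqrtr // addr_ge0 ?sqr_ge0. Qed.

(* The [j]-th Taylor coefficient, at distance [z] from the centre, of
   the polynomial [\sum_(k < N) f k * z ^ k]. *)
Definition tay f N j z : R[i] :=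
  \sum_(k < N) (f k)%:C%C * (z ^+ (k - j) * 'C(k, j)%:R).

(** An exact identity between polynomials, so re-expansion raises no question of convergence. The
    terms with [i + j > k] vanish, which allows the same range [N] for the new sum. *)
Lemma tay_shift f N j z h :
  tay f N j (z + h) = \sum_(i < N) 'C(i + j, j)%:R * tay f N (i + j) z * h ^+ i.
Proof.
rewrite /tay; under [RHS]eq_bigr do rewrite mulr_sumr mulr_suml.
rewrite exchange_big /=; apply: eq_bigr => k _.
have [kj|jk] := ltnP k j.
  rewrite bin_small // mulr0 mulr0 big1 // => i _.
  by rewrite (@bin_small k (i + j)) ?mulr0 ?mul0r //; lia.
rewrite exprDn mulr_suml mulr_sumr.
have kN : (k - j < N)%N by rewrite (leq_ltn_trans _ (ltn_ord k)) // leq_subr.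
rewrite (big_ord_widen _ (fun i => (f k)%:C%C * (z ^+ (k - j - i) * h ^+ i *+ 'C(k - j, i) * 'C(k, j)%:R)) kN).
rewrite big_mkcond /=; apply: eq_bigr => i _; case: ifPn => ik.
  have ikj : (i + j <= k)%N by lia.
  have e : ('C(k - j, i) * 'C(k, j) = 'C(i + j, j) * 'C(k, i + j))%N.
    have e2 : ('C(k - j, i) * (i`! * (k - j - i)`!) = (k - j)`!)%N.
      by apply: bin_fact; lia.
    have e3 := bin_fact ikj; have e4 := bin_fact (leq_addl i j); rewrite addnK in e4.
    rewrite addnC subnDA addnC in e3; have e1 := bin_fact jk.
    apply/eqP; rewrite -(@eqn_pmul2r (j`! * (i`! * (k - j - i)`!))) ?muln_gt0 ?fact_gt0 //.
    apply/eqP; transitivity k`!.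
      by rewrite -e1 -e2; move: 'C(k, j) 'C(k - j, i) j`! i`! (k - j - i)`! => *; lia.
    by rewrite -e3 -e4; move: 'C(k, i + j) 'C(i + j, j) j`! i`! (k - j - i)`! => *; lia.
  rewrite -mulr_natr -[_ * 'C(_, _)%:R * _]mulrA -natrM e natrM.
  by rewrite addnC subnDA; ring.
by rewrite (@bin_small k (i + j)) ?mulr0 ?mul0r //; lia.
Qed.

(** A Cauchy estimate obtained without integration: ['C(k, j) |z|^(k-j) d^j] is one term of the
    binomial expansion of [(|z| + d)^k]. *)
Lemma tay_bound f N j z (d : R) : 0 < d ->
  cabs (tay f N j z) * d ^+ j <= \sum_(k < N) `|f k| * (cabs z + d) ^+ k.
Proof.
move=> d0; rewrite mulrC.
apply: le_trans (ler_wpM2l (exprn_ge0 _ (ltW d0)) (cabs_sum _ _ _)) _.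
rewrite mulr_sumr; apply: ler_sum => k _.
rewrite !cabsM cabs_real cabsX cabs_nat mulrCA ler_wpM2l //.
have z0 := cabs_ge0 z.
have [kj|jk] := ltnP k j.
  by rewrite bin_small // !mulr0 exprn_ge0 // addr_ge0 // ltW.
rewrite exprDn (bigD1 (Ordinal (jk : (j < k.+1)%N))) //=.
rewrite mulrA [d ^+ j * _]mulrC mulr_natr lerDl sumr_ge0 // => i _.
by rewrite mulrn_wge0 // mulr_ge0 ?exprn_ge0 // ltW.
Qed.

Lemma tay_real f N j (x : R) :
  tay f N j x%:C%C = (\sum_(k < N) f k * (x ^+ (k - j) * 'C(k, j)%:R))%:C%C.
Proof.
rewrite /tay rmorph_sum; apply: eq_bigr => k _.
by rewrite !rmorphM rmorphXn rmorph_nat.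
Qed.

Lemma tay0 f N j : (j < N)%N -> tay f N j 0 = (f j)%:C%C.
Proof.
move=> jN; rewrite /tay (bigD1 (Ordinal jN)) //= subnn expr0 binn mulr1 mulr1.
rewrite big1 ?addr0 // => k kj.
have [h|h|h] := ltngtP k j.
- by rewrite bin_small // !mulr0.
- by rewrite expr0n subn_eq0 leqNgt h /= mul0r mulr0.
- by rewrite -val_eqE /= h eqxx in kj.
Qed.

(** Since [R[i]] is algebraically closed and [X^n - 1] is separable, the latter has [n] distinct
    roots, and one of them is primitive. *)
Lemma root_of_unity_exists n : (0 < n)%N -> exists w : R[i], n.-primitive_root w.
Proof.
move=> n0; have [r Dr] := closed_field_poly_normal ('X^n - 1 : {poly R[i]}).
rewrite (monicP _) ?monicXnsubC // scale1r in Dr.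
have rn1 : all n.-unity_root r.
  by apply/allP => z; rewrite -root_prod_XsubC -Dr.
have sr : (n < (size r).+1)%N by rewrite -(size_prod_XsubC r id) -Dr size_XnsubC.
have ur : uniq r.
  by rewrite -separable_prod_XsubC -Dr separable_Xn_sub_1 // pnatr_eq0 -lt0n.
by have /hasP[w _ hw] := has_prim_root n0 rn1 ur sr; exists w.
Qed.

Lemma prim_root_cabs n (w : R[i]) : n.-primitive_root w -> cabs w = 1.
Proof.
move=> hw; have n0 := prim_order_gt0 hw.
have := congr1 cabs (prim_expr_order hw); rewrite cabsX cabs1 => /eqP.
by rewrite pexpr_eq1 ?cabs_ge0 // => /eqP.
Qed.

Lemma sum_prim_root n (w : R[i]) k m : n.-primitive_root w ->
  \sum_(l < n) w ^+ (l * k) / w ^+ (l * m) = if k == m %[mod n] then n%:R else 0.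
Proof.
move=> hw; have w0 : w != 0.
  by apply: contra_eq_neq (prim_root_cabs hw) => /= ->; rewrite cabs0 eq_sym oner_neq0.
have E l : w ^+ (l * k) / w ^+ (l * m) = (w ^+ k / w ^+ m) ^+ l.
  by rewrite expr_div_n -!exprM mulnC [(l * m)%N]mulnC.
under eq_bigr do rewrite E.
have wm : w ^+ m != 0 by rewrite expf_neq0.
case: ifPn => km.
  have -> : w ^+ k / w ^+ m = 1.
    have /eqP -> : w ^+ k == w ^+ m by rewrite (eq_prim_root_expr hw).
    exact: divff.
  by under eq_bigr do rewrite expr1n; rewrite sumr_const card_ord.
have g1 : w ^+ k / w ^+ m - 1 != 0.
  rewrite subr_eq0; apply: contra km => /eqP e.
  rewrite -(eq_prim_root_expr hw); apply/eqP/(mulIf (invr_neq0 wm)).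
  by rewrite e divff.
apply: (mulfI g1); rewrite mulr0 -subrX1 expr_div_n -!exprM.
by rewrite ![(_ * n)%N]mulnC !exprM (prim_expr_order hw) !expr1n divff ?subrr ?oner_neq0.
Qed.

End ComplexTaylor.

(** * Continuation of power series and Cauchy estimates *)

Section TaylorFamily.
Context {R : realType}.
Implicit Types (f g c : nat -> R) (z h a : R[i]).

(** Here [z1] and [z2] stand for one point seen from two centres. After re-expansion, the difference
    of coefficients at the shifted point is a sum over the differences at the old one. Each of these
    tends to [0], and [tay_bound] dominates the [i]-th term by a polynomial in [i] times [x^i], so
    Tannery's theorem applies. *)
Lemma tay_continuation f g z1 z2 h (B d x : R) : 0 < d -> 0 <= x < 1 ->
  (forall N, \sum_(k < N) `|f k| * (cabs z1 + d) ^+ k <= B) ->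
  (forall N, \sum_(k < N) `|g k| * (cabs z2 + d) ^+ k <= B) ->
  (forall j, (fun N => cabs (tay f N j z1 - tay g N j z2)) @ \oo --> (0 : R)) ->
  cabs h <= x * d ->
  forall j, (fun N => cabs (tay f N j (z1 + h) - tay g N j (z2 + h))) @ \oo --> (0 : R).
Proof.
move=> d0 x01 hf hg hW hh j; have /andP[x0 _] := x01.
pose u N i := 'C(i + j, j)%:R * cabs (tay f N (i + j) z1 - tay g N (i + j) z2) * cabs h ^+ i.
have B0 : 0 <= B by have := hf 0%N; rewrite big_ord0.
have W N i : cabs (tay f N i z1 - tay g N i z2) <= 2 * B * d ^- i.
  rewrite ler_pdivlMr ?exprn_gt0 //; apply: le_trans (ler_wpM2r _ (cabsD _ _)) _.
    by rewrite exprn_ge0 // ltW.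
  rewrite cabsN mulrDl; have := tay_bound f N i z1 d0; have := tay_bound g N i z2 d0.
  by have := hf N; have := hg N; lra.
have U : (fun N : nat => \sum_(i < N) u N i) @ \oo --> (0 : R).
  apply: (@tannery _ u (2 * B * d ^- j * j.+1%:R ^+ j) x j) => //.
  - by rewrite !mulr_ge0 ?exprn_ge0 ?invr_ge0 ?exprn_ge0 // ltW.
  - move=> N i; have c0 := cabs_ge0; apply/andP; split.
      by rewrite !mulr_ge0 ?exprn_ge0 ?c0.
    have h1 : 'C(i + j, j)%:R <= j.+1%:R ^+ j * i.+1%:R ^+ j :> R.
      rewrite -exprMn -natrM -natrX ler_nat (leq_trans (bin_le_expn _ _)) //.
      by apply: leq_expn2r; nia.
    have h2 : cabs (tay f N (i + j) z1 - tay g N (i + j) z2) * cabs h ^+ i <=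
        2 * B * d ^- j * x ^+ i.
      apply: (@le_trans _ _ (2 * B * d ^- (i + j) * (x * d) ^+ i)).
        apply: ler_pM; rewrite ?exprn_ge0 ?c0 ?W // lerXn2r ?nnegrE ?c0 //.
        by rewrite mulr_ge0 // ltW.
      rewrite le_eqVlt; apply/orP; left; apply/eqP.
      rewrite exprD invfM exprMn; field.
      by rewrite !expf_neq0 ?gt_eqF.
    rewrite /u -mulrA; apply: le_trans (ler_pM _ _ h1 h2) _ => //.
      by rewrite mulr_ge0 ?exprn_ge0 ?c0.
    by rewrite le_eqVlt; apply/orP; left; apply/eqP; ring.
  - move=> i; rewrite /u -[X in _ --> X](mul0r (cabs h ^+ i)); apply: cvgMl.
    by rewrite -[X in _ --> X](mulr0 ('C(i + j, j)%:R)); apply: cvgMr; exact: hW.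
apply: (@squeeze_cvgr _ _ _ _ (cst 0) (fun N : nat => \sum_(i < N) u N i)) => //; last exact: cvg_cst.
near=> N; rewrite /cst cabs_ge0 /= !tay_shift -sumrB.
apply: le_trans (cabs_sum _ _ _) _; apply: ler_sum => i _.
by rewrite -mulrBl -mulrBr !cabsM cabs_nat cabsX.
Unshelve. all: by end_near. Qed.

Lemma bin_expr_le (r d : R) k j : 0 <= r -> 0 < d ->
  'C(k, j)%:R * r ^+ (k - j) <= d ^- j * (r + d) ^+ k.
Proof.
move=> r0 d0; rewrite mulrC ler_pdivlMl ?exprn_gt0 // mulrCA mulrA.
have [kj|jk] := ltnP k j.
  by rewrite bin_small // mulr0 exprn_ge0 // addr_ge0 // ltW.
rewrite exprDn (bigD1 (Ordinal (jk : (j < k.+1)%N))) //=.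
rewrite mulr_natr lerDl sumr_ge0 // => i _.
by rewrite mulrn_wge0 // mulr_ge0 ?exprn_ge0 // ltW.
Qed.

(* Averaging over roots of unity of a large order replaces Cauchy's integral formula. *)
Lemma tay_cauchy c (r rho B M : R) j m : 0 <= r < rho ->
  (forall k, `|c k| * rho ^+ k <= B * k.+1%:R) ->
  (forall a e, cabs a = r -> 0 < e -> \forall N \near \oo, cabs (tay c N j a) <= M + e) ->
  (j <= m)%N -> 'C(m, j)%:R * `|c m| * r ^+ (m - j) <= M.
Proof.
move=> /andP[r0 rrho] hc hM jm.
pose d := (rho - r) / 2; have d0 : 0 < d by rewrite /d; lra.
have rho0 : 0 < rho by lra.
pose x := (r + d) / rho.
have x01 : 0 <= x < 1.
  by rewrite /x divr_ge0 ?addr_ge0 ?(ltW d0) ?(ltW rho0) //= ltr_pdivrMr // /d; lra.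
have B0 : 0 <= B.
  by have := hc 0%N; rewrite expr0 !mulr1; apply: le_trans.
pose g k := c k * ('C(k, j)%:R * r ^+ (k - j)).
have gb k : `|g k| <= B * d ^- j * (k.+1%:R ^+ 1 * x ^+ k).
  rewrite /g normrM [X in _ * X]ger0_norm ?mulr_ge0 ?exprn_ge0 //.
  have h1 : `|c k| <= B * k.+1%:R / rho ^+ k by rewrite ler_pdivlMr ?exprn_gt0.
  apply: le_trans (ler_pM _ _ h1 (bin_expr_le k j r0 d0)) _ => //.
    by rewrite mulr_ge0 ?exprn_ge0.
  rewrite /x (expr_div_n (r + d)) expr1 le_eqVlt; apply/orP; left; apply/eqP.
  by ring.
apply/ler_addgt0Pr => e e0.
have e2 : 0 < e / 2 by rewrite divr_gt0.
set K := B * d ^- j in gb.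
have K0 : 0 <= K by rewrite mulr_ge0 // invr_ge0 exprn_ge0 // ltW.
have K1 : 0 < K + 1 by rewrite ltr_wpDl.
have [I hI] := geometric_tail 1 x01 (divr_gt0 e2 K1).
(* The average over [n]-th roots of unity also keeps the indices congruent to [m] modulo [n]. With
   [n > m] those other than [m] are at least [n], hence at least [I], and lie in the negligible
   tail. *)
pose n := maxn I m.+1.
have mn : (m < n)%N by rewrite leq_max leqnn orbT.
have n0 : (0 < n)%N by rewrite (leq_ltn_trans _ mn).
have [w hw] := @root_of_unity_exists R n n0.
have hwl l : cabs (r%:C%C * w ^+ l) = r.
  by rewrite cabsM cabsX (prim_root_cabs hw) expr1n mulr1 cabs_real ger0_norm.
have : \forall N \near \oo, forall l : 'I_n, cabs (tay c N j (r%:C%C * w ^+ l)) <= M + e / 2.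
  by apply: filter_forall => l; exact: hM.
move=> hN; have [N [mN hNl]] : exists N, (m < N)%N /\
    forall l : 'I_n, cabs (tay c N j (r%:C%C * w ^+ l)) <= M + e / 2.
  move: hN => [N0 _ hN]; exists (maxn N0 m.+1); split; first by rewrite leq_max leqnn orbT.
  by apply: hN; rewrite /= leq_max leqnn.
have avg : \sum_(l < n) tay c N j (r%:C%C * w ^+ l) / w ^+ (l * (m - j)) =
    \sum_(k < N) (g k)%:C%C * (if (k - j == m - j %[mod n])%N then n%:R else 0).
  rewrite /tay; under eq_bigr do rewrite mulr_suml.
  rewrite exchange_big /=; apply: eq_bigr => k _.
  rewrite -(sum_prim_root (k - j) (m - j) hw) mulr_sumr; apply: eq_bigr => l _.
  by rewrite exprMn -exprM -rmorphXn /= /g !rmorphM rmorph_nat /=; ring.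
have sm : cabs (\sum_(l < n) tay c N j (r%:C%C * w ^+ l) / w ^+ (l * (m - j))) <= n%:R * (M + e / 2).
  apply: le_trans (cabs_sum _ _ _) _.
  have -> : n%:R * (M + e / 2) = \sum_(l < n) (M + e / 2).
    by rewrite sumr_const card_ord mulr_natl.
  apply: ler_sum => l _.
  by rewrite cabsM cabsV cabsX (prim_root_cabs hw) expr1n invr1 mulr1.
rewrite avg (bigD1 (Ordinal mN)) //= eqxx in sm.
set rest := \sum_(k < N | _) _ in sm.
have hrest : cabs rest <= n%:R * (e / 2).
  apply: le_trans (cabs_sum _ _ _) _.
  apply: (@le_trans _ _ (\sum_(k < N) n%:R * (if (n <= k)%N then `|g k| else 0))).
    rewrite big_mkcond /=; apply: ler_sum => k _; case: ifPn => km; last first.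
      by rewrite mulr_ge0 //; case: ifP.
    rewrite cabsM cabs_real mulrC.
    have [nk|kn] := leqP n k.
      by rewrite ler_wpM2r //; case: ifP => _; rewrite ?cabs0 // cabs_nat.
    have [kj|jk] := ltnP k j.
      by rewrite /g bin_small // mul0r mulr0 normr0 !mulr0.
    rewrite !modn_small ?(leq_ltn_trans (leq_subr _ _)) //.
    rewrite eqn_sub2rE // [(_ == _)%N]negbTE ?cabs0 ?mul0r ?mulr0 //.
  rewrite -mulr_sumr ler_wpM2l // -big_mkcond /=.
  rewrite -(big_mkord (fun k => (n <= k)%N) (fun k => `|g k|)).
  have -> : \sum_(0 <= i < N | (n <= i)%N) `|g i| = \sum_(n <= i < N) `|g i|.
    by rewrite [RHS](@big_nat_widenl _ _ _ n 0).
  apply: (@le_trans _ _ (\sum_(I <= i < N) `|g i|)).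
    rewrite [leLHS](@big_nat_widenl _ _ _ n I) ?leq_maxl // big_mkcond /=.
    by apply: ler_sum => i _; case: ifP.
  apply: (@le_trans _ _ (K * \sum_(I <= i < N) i.+1%:R ^+ 1 * x ^+ i)).
    by rewrite mulr_sumr; apply: ler_sum => i _; exact: gb.
  apply: (@le_trans _ _ ((K + 1) * (e / 2 / (K + 1)))); last first.
    by rewrite mulrC divfK ?gt_eqF.
  apply: ler_pM => //; last by rewrite lerDl.
  apply: sumr_ge0 => i _; rewrite mulr_ge0 ?exprn_ge0 //.
  by case/andP: x01.
have nR : 0 < n%:R :> R by rewrite ltr0n.
rewrite -(ler_pM2l nR).
have -> : n%:R * ('C(m, j)%:R * `|c m| * r ^+ (m - j)) = cabs ((g m)%:C%C * n%:R).
  rewrite cabsM cabs_nat cabs_real /g normrM.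
  by rewrite [X in _ = _ * X * _]ger0_norm ?mulr_ge0 ?exprn_ge0 //; ring.
have -> : (g m)%:C%C * n%:R = (g m)%:C%C * n%:R + rest - rest by rewrite addrK.
apply: le_trans (cabsD _ _) _; rewrite cabsN.
apply: le_trans (lerD sm hrest) _.
by rewrite -mulrDr ler_wpM2l // -addrA -splitr.
Qed.


(** * A Liouville theorem for Taylor coefficients given along the real line *)

Section TaylorFamilyPolynomial.
(** [D k T] stands for the [k]-th Taylor coefficient at the real point [T] of a single function. The
    point [0] lies inside every disc [|z - T| < 1 + |T|], and [D_taylor] says that re-expanding from
    [T] to [0] gives the coefficients at [0]. *)
Variables (D : nat -> R -> R) (C : R) (A M : nat).
Hypothesis C0 : 0 <= C.
Hypothesis D_bound : forall k T,
  `|D k T| <= C * k.+1%:R ^+ A * (1 + `|T|) ^+ M * (1 + `|T|) ^- k.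
Hypothesis D_taylor : forall T m,
  (fun N => \sum_(k < N) D k T * ((- T) ^+ (k - m) * 'C(k, m)%:R)) @ \oo --> D m 0.

Let c k := D k 0.
Let K : R := C * (A`!%:R * 4 ^+ A.+1).
Let Bd (r : R) := K * (1 + r ^+ 2) ^+ (M + A.+1).

(** With [u = 1 + |T|] the radius is [u - 1/4], so the ratio is [1 - 1/(4u)] and the geometric bound
    costs [(4u)^(A+1)]. This is the origin of [K] and of the exponent [M + A.+1]. *)
Let D_sum N T (x : R) : 0 <= x <= `|T| + 3 / 4 ->
  \sum_(k < N) `|D k T| * x ^+ k <= K * (1 + `|T|) ^+ (M + A.+1).
Proof.
move=> /andP[x0 xT]; pose u := 1 + `|T|.
have u1 : 1 <= u by rewrite lerDl.
have u0 : 0 < u by lra.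
pose y := (u - 4^-1) / u.
have y01 : 0 <= y < 1 by rewrite /y divr_ge0 ?(ltW u0) //= ?ltr_pdivrMr //; lra.
have /andP[y0 _] := y01.
apply: (@le_trans _ _ (\sum_(k < N) C * u ^+ M * (k.+1%:R ^+ A * y ^+ k))).
  apply: ler_sum => k _.
  apply: le_trans (ler_wpM2r (exprn_ge0 _ x0) (D_bound k T)) _.
  rewrite -/u /y (expr_div_n (u - _)).
  have : x ^+ k <= (u - 4^-1) ^+ k by rewrite lerXn2r ?nnegrE // /u; lra.
  move=> h; have -> : C * u ^+ M * (k.+1%:R ^+ A * ((u - 4^-1) ^+ k / u ^+ k)) =
    C * k.+1%:R ^+ A * u ^+ M * u ^- k * (u - 4^-1) ^+ k by ring.
  rewrite ler_wpM2l // !mulr_ge0 ?invr_ge0 ?exprn_ge0 // ltW //.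
rewrite -mulr_sumr.
apply: le_trans (ler_wpM2l _ (sum_pow_geometric_le A N y01)) _.
  by rewrite mulr_ge0 // exprn_ge0 // ltW.
have -> : 1 - y = (4 * u)^-1.
  by rewrite /y; field; rewrite gt_eqF.
rewrite -exprVn invrK exprMn exprD /K -/u.
by rewrite le_eqVlt; apply/orP; left; apply/eqP; ring.
Qed.

Let K0 : 0 <= K.
Proof. by rewrite !mulr_ge0. Qed.

(** Take [T] of modulus [|a|^2] with the sign of [Re a], so that the cross term in [|a - T|^2] is
    not positive. The margin of [1/2] inside the disc of convergence is used for the
    continuation. *)
Let near_cover a : exists T, cabs a ^+ 2 = `|T| /\ cabs (a - T%:C%C) <= `|T| + 2^-1.
Proof.
case: a => x y.
have key (T : R) : `|T| = x ^+ 2 + y ^+ 2 -> 0 <= x * T ->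
    cabs ((x +i* y)%C - T%:C%C) <= `|T| + 2^-1.
  move=> hT xT; rewrite -(@ler_pXn2r _ 2) ?nnegrE ?cabs_ge0 ?addr_ge0 ?invr_ge0 //.
  have -> : ((x +i* y)%C - T%:C%C) = ((x - T) +i* y)%C by congr (_ +i* _)%C; rewrite /= ?subr0.
  rewrite sqr_cabs.
  have : T ^+ 2 = `|T| ^+ 2 by rewrite real_normK ?num_real.
  move: (`|T|) hT => t ->; nra.
have s0 : 0 <= x ^+ 2 + y ^+ 2 by rewrite addr_ge0 ?sqr_ge0.
rewrite sqr_cabs; have [x0|x0] := leP 0 x.
  exists (x ^+ 2 + y ^+ 2); rewrite ger0_norm //; split => //.
  by have := @key (x ^+ 2 + y ^+ 2); rewrite ger0_norm //; apply; rewrite ?mulr_ge0.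
exists (- (x ^+ 2 + y ^+ 2)); rewrite normrN ger0_norm //; split => //.
have := @key (- (x ^+ 2 + y ^+ 2)); rewrite normrN ger0_norm //; apply => //.
by rewrite mulrN -mulNr mulr_ge0 // oppr_ge0 ltW.
Qed.

Let W T a j := fun N : nat => cabs (tay c N j a - tay (D ^~ T) N j (a - T%:C%C)).

Let W0 T j : W T 0 j @ \oo --> (0 : R).
Proof.
have h : (fun N : nat => `|\sum_(k < N) D k T * ((- T) ^+ (k - j) * 'C(k, j)%:R) - D j 0|)
    @ \oo --> (0 : R).
  rewrite -[X in _ --> X](@normr0 R R); apply: cvg_norm.
  rewrite -[X in _ --> X](subrr (D j 0)).
  by apply: cvgB; [exact: D_taylor|exact: cvg_cst].
apply: cvg_trans h; apply: near_eq_cvg.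
near=> N; rewrite /W tay0; last by near: N; exact: nbhs_infty_gt.
have -> : 0 - T%:C%C = (- T)%:C%C by rewrite sub0r rmorphN.
by rewrite tay_real -(rmorphB (real_complex R)) (cabs_real (_ - _)) distrC.
Unshelve. all: by end_near. Qed.

(** Induction invariant at radius [i / 8]: the expansions at [0] and at [T] have the same
    coefficients at each point of both discs, and the coefficients at [0] allow a radius [1/4]
    larger. For [i > 0] the constant must be the explicit [Bd], whose growth in the radius is used
    at the end; at [i = 0] a crude constant starts the induction. *)
Let state (i : nat) :=
  (forall T a, cabs a <= i%:R / 8 -> cabs (a - T%:C%C) <= `|T| + 2^-1 ->
     forall j, W T a j @ \oo --> (0 : R)) /\
  exists B, ((0 < i)%N /\ B = Bd (i%:R / 8) \/ i = 0%N) /\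
    forall m, `|c m| * (i%:R / 8 + 4^-1) ^+ m <= B * m.+1%:R.

Let state0 : state 0.
Proof.
split.
  move=> T a; rewrite mul0r => a0 _ j.
  have -> : a = 0 by apply: cabs0_eq0; apply/eqP; rewrite eq_le a0 cabs_ge0.
  exact: W0.
have x01 : 0 <= (4^-1 : R) < 1 by apply/andP; split; lra.
exists (C * (A`!%:R * (1 - 4^-1) ^- A.+1)); split; first by right.
move=> m; rewrite mul0r add0r.
have := D_bound m 0; rewrite normr0 addr0 !expr1n invr1 !mulr1 => h.
apply: le_trans (ler_wpM2r (exprn_ge0 _ _) h) _; first by lra.
apply: (@le_trans _ _ (C * (A`!%:R * (1 - 4^-1) ^- A.+1))).
  by rewrite -[leLHS]mulrA ler_wpM2l // pow_geometric_le.
rewrite ler_peMr ?ler1n // !mulr_ge0 // invr_ge0 exprn_ge0 //; lra.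
Qed.

Let state_sum i : state i -> exists B, forall N x, 0 <= x <= i%:R / 8 + 3 / 16 ->
  \sum_(k < N) `|c k| * x ^+ k <= B.
Proof.
move=> [_ [B [_ hB]]].
pose rho : R := i%:R / 8 + 4^-1.
have i0 : 0 <= i%:R / 8 :> R by rewrite divr_ge0.
have rho0 : 0 < rho by rewrite /rho; lra.
pose y := (i%:R / 8 + 3 / 16) / rho.
have y01 : 0 <= y < 1.
  by rewrite /y divr_ge0 ?(ltW rho0) //= ?ltr_pdivrMr // /rho; lra.
have /andP[y0 _] := y01.
have B0 : 0 <= B.
  by have := hB 0%N; rewrite expr0 !mulr1; apply: le_trans.
exists (B * (1`!%:R * (1 - y) ^- 2)) => N x /andP[x0 hx].
apply: le_trans (ler_wpM2l B0 (sum_pow_geometric_le 1 N y01)).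
rewrite mulr_sumr; apply: ler_sum => k _.
rewrite expr1 mulrA; apply: le_trans (ler_wpM2r (exprn_ge0 k y0) (hB k)).
have ry : rho * y = i%:R / 8 + 3 / 16 by rewrite /y mulrC divfK ?gt_eqF.
by rewrite -mulrA ler_wpM2l // -exprMn ry lerXn2r ?nnegrE // (le_trans x0).
Qed.

Let stateS i : state i -> state i.+1.
Proof.
move=> st; have [hW [B [_ hB]]] := st.
have i0 : 0 <= i%:R / 8 :> R by rewrite divr_ge0.
have iS : i.+1%:R / 8 = i%:R / 8 + 8^-1 :> R by rewrite -natr1 mulrDl mul1r.
have hWS T a : cabs a <= i.+1%:R / 8 -> cabs (a - T%:C%C) <= `|T| + 2^-1 ->
    forall j, W T a j @ \oo --> (0 : R).
  move=> ha haT j.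
  pose t : R := i%:R / i.+1%:R.
  have n0 : 0 < i.+1%:R :> R by rewrite ltr0n.
  have t0 : 0 <= t by rewrite divr_ge0.
  have t1 : t <= 1 by rewrite ler_pdivrMr // mul1r ler_nat.
  (* The point [a] is reached along its ray from [0]. By convexity [b] stays within [|T| + 2^-1] of
     [T], since [a] and [0] both do. *)
  pose b := t%:C%C * a; pose h := (1 - t)%:C%C * a.
  have abh : a = b + h by rewrite -mulrDl -rmorphD addrC subrK mul1r.
  have hb : cabs b <= i%:R / 8.
    rewrite cabsM cabs_real ger0_norm //.
    apply: le_trans (ler_wpM2l t0 ha) _.
    by rewrite mulrA /t divfK ?gt_eqF.
  have hh : cabs h <= 2 / 3 * (3 / 16).
    rewrite cabsM cabs_real ger0_norm ?subr_ge0 //.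
    apply: (@le_trans _ _ ((1 - t) * (i.+1%:R / 8))); first by rewrite ler_wpM2l // subr_ge0.
    have : (1 - t) * i.+1%:R = 1.
      by rewrite mulrBl mul1r /t divfK ?gt_eqF // -natr1 addrC addKr.
    by lra.
  have hbT : cabs (b - T%:C%C) <= `|T| + 2^-1.
    have -> : b - T%:C%C = t%:C%C * (a - T%:C%C) + (1 - t)%:C%C * (- T%:C%C).
      by rewrite /b !rmorphB /= rmorph1; ring.
    apply: le_trans (cabsD _ _) _; rewrite !cabsM cabsN !cabs_real.
    rewrite (ger0_norm t0) [`|1 - t|]ger0_norm ?subr_ge0 //.
    have := ler_wpM2l t0 haT; have : 0 <= `|T| by [].
    by move: (cabs _) (`|T|) => X Y; lra.
  have [B1 hB1] := state_sum st.
  pose B2 := K * (1 + `|T|) ^+ (M + A.+1).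
  have x01 : 0 <= (2 / 3 : R) < 1 by apply/andP; split; lra.
  rewrite /W abh; under eq_fun do rewrite -addrA [h - _]addrC addrA.
  (* The increment is at most [1/8 = 2/3 * (3/16)]. The radius [i / 8 + 3 / 16] is covered by
     [state_sum], and [2^-1 + 3 / 16] stays below the [3 / 4] of [D_sum]. *)
  apply: (@tay_continuation _ _ b (b - T%:C%C) h (Num.max B1 B2) (3 / 16) (2 / 3)) => //.
  - move=> N; rewrite le_max hB1 //.
    by apply/andP; split; have := cabs_ge0 b; lra.
  - move=> N; rewrite le_max; apply/orP; right; apply: D_sum.
    by apply/andP; split; have := cabs_ge0 (b - T%:C%C); lra.
  - exact: hW.
split => //; exists (Bd (i.+1%:R / 8)); split; first by left.
move=> m; pose r : R := i.+1%:R / 8.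
have r0 : 0 <= r by rewrite /r iS; lra.
(* Cauchy's estimate for the [j]-th derivative on the circle of radius [r]. Dividing by [4^j] and
   summing over [j] builds the binomial expansion of [(r + 1/4)^m]: this enlarges the radius by
   [1/4] and produces the factor [m.+1]. *)
have step j : (j <= m)%N -> 'C(m, j)%:R * `|c m| * r ^+ (m - j) <= Bd r * 4 ^+ j.
  apply: (@tay_cauchy c r (i%:R / 8 + 4^-1) B _ j m) => //.
    by rewrite r0 /r iS; lra.
  move=> a e ha e0; have [T [hT haT]] := near_cover a.
  have : W T a j @ \oo --> (0 : R) by apply: hWS => //; rewrite ha.
  move=> /cvgrPdist_le /(_ e e0); apply: filterS => N.
  rewrite sub0r normrN ger0_norm ?cabs_ge0 // => hN.
  have -> : tay c N j a = tay (D ^~ T) N j (a - T%:C%C) +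
     (tay c N j a - tay (D ^~ T) N j (a - T%:C%C)) by rewrite addrC subrK.
  apply: le_trans (cabsD _ _) _; apply: lerD => //.
  have q0 : 0 < (4^-1 : R) by lra.
  have := tay_bound (D ^~ T) N j (a - T%:C%C) q0.
  rewrite exprVn ler_pdivrMr ?exprn_gt0 // => h; apply: le_trans h _.
  rewrite ler_wpM2r ?exprn_ge0 //.
  have -> : Bd r = K * (1 + `|T|) ^+ (M + A.+1) by rewrite /Bd -hT ha.
  apply: D_sum; apply/andP; split; have := cabs_ge0 (a - T%:C%C); lra.
rewrite -/r exprDn mulr_sumr.
apply: (@le_trans _ _ (\sum_(j < m.+1) Bd r)); last first.
  by rewrite sumr_const card_ord mulr_natr.
apply: ler_sum => j _; have := step j (ltnSE (ltn_ord j)).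
rewrite -ler_pdivrMr ?exprn_gt0 // => h; apply: le_trans h.
rewrite exprVn -mulr_natr le_eqVlt; apply/orP; left; apply/eqP; ring.
Qed.

(** The invariant bounds [|D m 0| r^m] by a constant times [r^(2 (M + A.+1))] for arbitrarily large
    [r]. *)
Lemma taylor_family_eq0 m : (2 * (M + A.+1) < m)%N -> D m 0 = 0.
Proof.
move=> hm; have st i : state i by elim: i => [|i IH]; [exact: state0|exact: stateS].
apply/eqP; rewrite -normr_eq0 eq_le normr_ge0 andbT.
pose E := (M + A.+1)%N; pose K' : R := K * 2 ^+ E * m.+1%:R.
have K'0 : 0 <= K' by rewrite !mulr_ge0 // exprn_ge0.
have main (i : nat) : (8 <= i)%N -> `|D m 0| * (i%:R / 8) <= K'.
  move=> i8; pose r : R := i%:R / 8.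
  have r1 : 1 <= r by rewrite /r ler_pdivlMr // mul1r ler_nat.
  have [_ [B [hB' hB]]] := st i.
  have {hB'} EB : B = Bd r by case: hB' => [[] //|i0]; rewrite i0 in i8.
  have r0 : 0 < r by lra.
  have h : `|D m 0| * r ^+ m <= K' * r ^+ (2 * E).
    apply: (@le_trans _ _ (Bd r * m.+1%:R)).
      rewrite -EB; apply: le_trans (hB m); rewrite ler_wpM2l // lerXn2r ?nnegrE ?(ltW r0) //.
      by rewrite -/r; lra.
    have -> : K' * r ^+ (2 * E) = K * (2 * r ^+ 2) ^+ E * m.+1%:R.
      by rewrite /K' [(2 * r ^+ 2) ^+ E]exprMn -exprM; ring.
    rewrite ler_wpM2r // /Bd -/E ler_wpM2l // lerXn2r ?nnegrE //; nra.
  have -> : `|D m 0| * r = `|D m 0| * r ^+ m / r ^+ m.-1.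
    have m0 : (0 < m)%N by lia.
    have -> : r ^+ m = r * r ^+ m.-1 by rewrite -exprS prednK.
    by rewrite -[RHS]mulrA mulfK // expf_neq0 // gt_eqF.
  rewrite ler_pdivrMr ?exprn_gt0 //; apply: le_trans h _.
  by rewrite ler_wpM2l // ler_weXn2l //; rewrite /E; lia.
rewrite leNgt; apply/negP => D0.
pose i := maxn 8 (Num.bound (8 * K' / `|D m 0|)).
have := main i (leq_maxl _ _).
have : 8 * K' / `|D m 0| < i%:R.
  apply: lt_le_trans (archi_boundP _) _; first by rewrite divr_ge0 // mulr_ge0.
  by rewrite ler_nat leq_maxr.
rewrite ltr_pdivrMr // => h1 h2; lra.
Qed.

(** The invariant is read at the point [T] itself, where the expansion centred at [T] reduces to its
    constant term. *)
Lemma taylor_family_polynomial T :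
  D 0 T = \sum_(k < (2 * (M + A.+1)).+1) D k 0 * T ^+ k.
Proof.
have st i : state i by elim: i => [|i IH]; [exact: state0|exact: stateS].
have hT : `|T| <= (Num.bound (8 * `|T|))%:R / 8.
  rewrite ler_pdivlMr // mulrC; apply/ltW/archi_boundP.
  by rewrite mulr_ge0.
have : W T T%:C%C 0 @ \oo --> (0 : R).
  have [h _] := st (Num.bound (8 * `|T|)); apply: h; first by rewrite cabs_real.
  by rewrite subrr cabs0 addr_ge0 // invr_ge0.
move=> hW; apply/eqP; rewrite eq_sym -subr_eq0 -normr_eq0; apply/eqP.
apply: (@cvg_unique _ (@Rhausdorff R) (W T T%:C%C 0 @ \oo)) => //.
apply: cvg_near_cst; near=> N.
have N0 : (0 < N)%N by near: N; exact: nbhs_infty_gt.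
have NK : ((2 * (M + A.+1)).+1 <= N)%N by near: N; exact: nbhs_infty_ge.
rewrite /W subrr tay0 // tay_real -(rmorphB (real_complex R)) (cabs_real (_ - _)).
have <- // : \sum_(k < N) c k * (T ^+ (k - 0) * 'C(k, 0)%:R) =
  \sum_(k < (2 * (M + A.+1)).+1) D k 0 * T ^+ k.
rewrite -(subnKC NK) big_split_ord /= [X in _ + X]big1 ?addr0.
  by apply: eq_bigr => k _; rewrite bin0 mulr1 subn0.
by move=> k _; rewrite /c taylor_family_eq0 ?mul0r //; lia.
Unshelve. all: by end_near. Qed.

End TaylorFamilyPolynomial.

End TaylorFamily.

(** * Integrable real functions and their integrals *)

Section L1.
Context d (T : measurableType d) {R : realType} (mu : {measure set T -> \bar R}).
Implicit Types (f g h : T -> R) (k : R).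

Definition L1 f := mu.-integrable [set: T] (EFin \o f).

Definition rint f : R := Rintegral mu [set: T] f.

Lemma L1_measurable f : L1 f -> measurable_fun [set: T] f.
Proof. by move=> /measurable_int/measurable_EFinP. Qed.

Lemma L1_le f g : measurable_fun [set: T] f -> (forall x, `|f x| <= g x) -> L1 g -> L1 f.
Proof.
move=> mf fg; apply: le_integrable => //; first exact/measurable_EFinP.
by move=> x _ /=; rewrite lee_fin; exact: le_trans (fg x) (ler_norm _).
Qed.

Lemma L1_ext f g : f =1 g -> L1 f -> L1 g.
Proof. by move=> fg; have -> : f = g by apply/funext. Qed.

Lemma L1D f g : L1 f -> L1 g -> L1 (fun x => f x + g x).
Proof.
by move=> hf hg; apply: (eq_integrable measurableT _ _ _ (integrableD measurableT hf hg)).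
Qed.

Lemma L1Z k f : L1 f -> L1 (fun x => k * f x).
Proof.
by move=> hf; apply: (eq_integrable measurableT _ _ _ (integrableZl measurableT k hf)).
Qed.

Lemma L1M_bounded f g k : L1 f -> measurable_fun [set: T] g -> (forall x, `|g x| <= k) ->
  L1 (fun x => f x * g x).
Proof.
move=> hf mg gk; apply: (@L1_le _ (fun x => k * `|f x|)).
- by apply: measurable_funM => //; exact: L1_measurable.
- by move=> x; rewrite normrM mulrC ler_wpM2r.
- by apply: L1Z; exact: integrable_norm.
Qed.

Lemma measurable_mem (A : set T) : measurable A ->
  measurable_fun [set: T] (fun x => (x \in A)%:R : R).
Proof.
move=> mA; have := @measurable_indic _ T R [set: T] A mA.
by congr (measurable_fun _); apply/funext => x; rewrite indicE.
Qed.

Lemma L1_norm f : L1 f -> L1 (fun x => `|f x|).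
Proof. by move=> hf; exact: integrable_norm. Qed.

Lemma L1_0 : L1 (fun=> 0).
Proof. exact: integrable0. Qed.

Lemma L1_sum n (F : nat -> T -> R) : (forall i, L1 (F i)) ->
  L1 (fun x => \sum_(i < n) F i x).
Proof.
move=> hF; elim: n => [|n IH].
  by apply: L1_ext L1_0 => x; rewrite big_ord0.
by apply: L1_ext (L1D IH (hF n)) => x; rewrite big_ord_recr.
Qed.

Lemma rint_ext f g : f =1 g -> rint f = rint g.
Proof. by move=> fg; have -> : f = g by apply/funext. Qed.

Lemma rintD f g : L1 f -> L1 g -> rint (fun x => f x + g x) = rint f + rint g.
Proof. by move=> hf hg; exact: RintegralD. Qed.

Lemma rintZ k f : L1 f -> rint (fun x => k * f x) = k * rint f.
Proof. by move=> hf; exact: RintegralZl. Qed.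

Lemma rint0 : rint (fun=> 0) = 0.
Proof. by rewrite /rint Rintegral_cst // mul0r. Qed.

Lemma rint_sum n (F : nat -> T -> R) : (forall i, L1 (F i)) ->
  rint (fun x => \sum_(i < n) F i x) = \sum_(i < n) rint (F i).
Proof.
move=> hF; elim: n => [|n IH].
  by rewrite [RHS]big_ord0 -[RHS]rint0; apply: rint_ext => x; rewrite big_ord0.
rewrite big_ord_recr /= -IH -rintD //; last exact: L1_sum.
by apply: rint_ext => x; rewrite big_ord_recr.
Qed.

Lemma rint_ge0 f : (forall x, 0 <= f x) -> 0 <= rint f.
Proof. by move=> f0; exact: Rintegral_ge0. Qed.

Lemma rint_le f g : L1 f -> L1 g -> (forall x, f x <= g x) -> rint f <= rint g.
Proof. by move=> hf hg fg; apply: le_Rintegral. Qed.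

Lemma rint_norm_le f g : L1 f -> L1 g -> (forall x, `|f x| <= g x) -> `|rint f| <= rint g.
Proof.
move=> hf hg fg; apply: (le_trans (le_normr_Rintegral measurableT hf)).
by apply: rint_le => //; exact: L1_norm.
Qed.

Lemma rint_dct (F : nat -> T -> R) f g :
  (forall n, measurable_fun [set: T] (F n)) ->
  (forall x, F ^~ x @ \oo --> f x) ->
  (forall n x, `|F n x| <= g x) -> L1 g ->
  L1 f /\ (fun n => rint (F n)) @ \oo --> rint f.
Proof.
move=> mF Ff Fg hg.
have mf : measurable_fun [set: T] f.
  by apply: (measurable_fun_cvg mF) => x _; exact: Ff.
have Ff' x : [set: T] x -> (fun n => (F n x)%:E) @ \oo --> (f x)%:E.
  by move=> _; apply: cvg_EFin; [exact: nearW|exact: Ff].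
have Fg' x n : [set: T] x -> (`|(F n x)%:E| <= (g x)%:E)%E.
  by move=> _; rewrite /= lee_fin.
have mF' n : measurable_fun [set: T] (EFin \o F n) by exact/measurable_EFinP.
have mf' : measurable_fun [set: T] (EFin \o f) by exact/measurable_EFinP.
have [fi _ hlim] := dominated_convergence measurableT mF' mf'
  (aeW _ Ff')
  hg (aeW _ Fg').
split => //; apply: fine_cvg; rewrite fineK //; exact: integrable_fin_num.
Qed.

End L1.

(** * Moments against the Laguerre kernel *)

Section LaguerreMoments.
Context d (T : measurableType d) {R : realType} (mu : {measure set T -> \bar R}).
Variables (b : R) (Phi X : T -> R) (N : nat).
Hypotheses (hb : 2^-1 <= b) (X0 : forall x, 0 <= X x).
Hypotheses (mX : measurable_fun [set: T] X) (mPhi : measurable_fun [set: T] Phi).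
Hypothesis iPhi : L1 mu (fun x => `|Phi x| * (1 + X x) ^- N).

(** Up to the sign [(-1)^m], the [m]-th Taylor coefficient at [u] of the Laplace-type integral of
    [Phi] against [u^(-b) exp(-X/u)]. *)
Definition lmom (m : nat) (u : R) : R := rint mu (fun x => Phi x * kap b m u (X x)).

Lemma continuous_lagf m : continuous (@lagf R b m).
Proof.
move=> x; apply: differentiable_continuous; apply/derivable1_diffP.
by have [] := is_derive_lagf b m x.
Qed.

Lemma measurable_kap m u : measurable_fun [set: T] (fun x => kap b m u (X x)).
Proof.
apply: measurable_funM => //.
apply: (@measurableT_comp _ _ _ _ _ _ (lagf b m)).
  by apply: continuous_measurable_fun; exact: continuous_lagf.
exact: measurable_funM.
Qed.

Let mom := rint mu (fun x => `|Phi x| * (1 + X x) ^- N).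

Let X1 x n : 0 < (1 + X x) ^+ n.
Proof. by rewrite exprn_gt0 // ltr_pwDl. Qed.

Lemma lmom_bound : exists C : R, exists A : nat, 0 <= C /\ forall m u, 1 <= u ->
  L1 mu (fun x => Phi x * kap b m u (X x)) /\
  `|lmom m u| <= C * m.+1%:R ^+ A * u ^+ N * u ^- m.
Proof.
have [C [A [C0 hC]]] := kap_decay N hb.
have mom0 : 0 <= mom.
  by apply: rint_ge0 => x; rewrite mulr_ge0 // invr_ge0 ltW.
exists (C * mom), A; split; first by rewrite mulr_ge0.
move=> m u u1; set K := C * m.+1%:R ^+ A * u ^+ N * u ^- m.
have bnd x : `|Phi x * kap b m u (X x)| <= K * (`|Phi x| * (1 + X x) ^- N).
  rewrite normrM mulrCA ler_wpM2l //.
  rewrite ler_pdivlMr // mulrC; exact: hC.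
have i1 : L1 mu (fun x => Phi x * kap b m u (X x)).
  apply: L1_le bnd _; last exact: L1Z.
  by apply: measurable_funM => //; exact: measurable_kap.
split => //; apply: le_trans (rint_norm_le i1 (L1Z K iPhi) bnd) _.
rewrite rintZ // -/mom /K le_eqVlt; apply/orP; left; apply/eqP; ring.
Qed.

(** Dominated convergence applied to [kap_taylor]. By [kap_decay] the [i]-th term is at most a
    polynomial in [i] times [r^i] times the integrable weight, uniformly in the length of the
    sum. *)
Lemma lmom_taylor m u v (r : R) : 1 <= u -> 0 < v -> `|u - v| <= r * u -> 0 <= r < 1 ->
  (fun n => \sum_(i < n) 'C(i + m, m)%:R * lmom (i + m) u * (u - v) ^+ i)
    @ \oo --> lmom m v.
Proof.
move=> u1 v0 uv r01; have /andP[r0 r1] := r01.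
have u0 : 0 < u by lra.
have uN0 : 0 <= u ^+ N by rewrite exprn_ge0 // ltW.
have um0 : 0 <= u ^- m by rewrite invr_ge0 exprn_ge0 // ltW.
have XN0 x : 0 <= (1 + X x) ^- N by rewrite invr_ge0 ltW.
have [C' [A' [_ iK]]] := lmom_bound.
have [C [A [C0 hC]]] := kap_decay N hb.
pose t i x := Phi x * kap b (i + m) u (X x).
have it i : L1 mu (t i) by have [] := iK (i + m)%N u u1.
pose F n x := \sum_(i < n) ('C(i + m, m)%:R * (u - v) ^+ i) * t i x.
(* The binomial coefficient accounts for the power [m] and [kap_decay] for the power [A] of
   [i + m + 1], itself at most [(m + 1) (i + 1)]. *)
pose K : R := C * m.+1%:R ^+ (m + A) * u ^+ N * u ^- m * ((m + A)`!%:R * (1 - r) ^- (m + A).+1).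
have Fb n x : `|F n x| <= K * (`|Phi x| * (1 + X x) ^- N).
  apply: le_trans (ler_norm_sum _ _ _) _.
  apply: (@le_trans _ _ (\sum_(i < n) C * m.+1%:R ^+ (m + A) * u ^+ N * u ^- m *
      (`|Phi x| * (1 + X x) ^- N) * (i.+1%:R ^+ (m + A) * r ^+ i))).
    apply: ler_sum => i _; rewrite /t.
    have h1 : `|kap b (i + m) u (X x)| <=
        C * (i + m).+1%:R ^+ A * u ^+ N * u ^- (i + m) / (1 + X x) ^+ N.
      by rewrite ler_pdivlMr // mulrC hC.
    have h2 : `|u - v| ^+ i <= r ^+ i * u ^+ i.
      by rewrite -exprMn lerXn2r ?nnegrE // mulr_ge0 // ltW.
    have h3 : 'C(i + m, m)%:R * (i + m).+1%:R ^+ A <= m.+1%:R ^+ (m + A) * i.+1%:R ^+ (m + A) :> R.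
      have im : ((i + m).+1 <= m.+1 * i.+1)%N by rewrite mulSn mulnS addSn ltnS addnA leq_addr.
      rewrite -exprMn !exprD -natrM -!natrX -!natrM ler_nat leq_mul //; last exact: leq_expn2r.
      apply: leq_trans (bin_le_expn _ _) _; apply: leq_expn2r.
      by apply: leq_trans im.
    rewrite (normrM (_ * _)) (normrM _ ((u - v) ^+ i)) normrX normr_nat (normrM (Phi x)).
    apply: (@le_trans _ _ ('C(i + m, m)%:R * (r ^+ i * u ^+ i) * (`|Phi x| *
        (C * (i + m).+1%:R ^+ A * u ^+ N * u ^- (i + m) / (1 + X x) ^+ N)))).
      apply: ler_pM; rewrite ?mulr_ge0 ?exprn_ge0 //.
        by rewrite ler_wpM2l.
      by rewrite ler_wpM2l.
    rewrite exprD.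
    have -> : 'C(i + m, m)%:R * (r ^+ i * u ^+ i) * (`|Phi x| *
        (C * (i + m).+1%:R ^+ A * u ^+ N / (u ^+ i * u ^+ m) / (1 + X x) ^+ N)) =
      (C * u ^+ N * u ^- m * (`|Phi x| * (1 + X x) ^- N) * r ^+ i) *
      ('C(i + m, m)%:R * (i + m).+1%:R ^+ A).
      by field; rewrite !expf_neq0 ?gt_eqF // ltr_pwDl.
    have -> : C * m.+1%:R ^+ (m + A) * u ^+ N / u ^+ m * (`|Phi x| / (1 + X x) ^+ N) *
        (i.+1%:R ^+ (m + A) * r ^+ i) =
      (C * u ^+ N * u ^- m * (`|Phi x| * (1 + X x) ^- N) * r ^+ i) *
      (m.+1%:R ^+ (m + A) * i.+1%:R ^+ (m + A)) by ring.
    by rewrite ler_wpM2l // !mulr_ge0 // exprn_ge0.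
  rewrite -mulr_sumr.
  apply: le_trans (ler_wpM2l _ (sum_pow_geometric_le (m + A) n r01)) _.
    by rewrite !mulr_ge0 // exprn_ge0.
  by rewrite le_eqVlt; apply/orP; left; apply/eqP; rewrite /K; ring.
have FL x : F ^~ x @ \oo --> Phi x * kap b m v (X x).
  have h : (fun n => Phi x * \sum_(i < n) 'C(i + m, m)%:R * kap b (i + m) u (X x) * (u - v) ^+ i)
    @ \oo --> Phi x * kap b m v (X x).
    by apply: cvgMr; exact: kap_taylor r01.
  apply: cvg_trans h; apply: near_eq_cvg; near=> n.
  by rewrite /F mulr_sumr; apply: eq_bigr => i _; rewrite /t; ring.
have mF n : measurable_fun [set: T] (F n).
  apply: (@L1_measurable _ _ _ mu).
  apply: (@L1_sum _ _ _ _ n (fun i x => 'C(i + m, m)%:R * (u - v) ^+ i * t i x)) => i.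
  exact: L1Z.
have [_] := rint_dct mF FL Fb (L1Z K iPhi).
apply: cvg_trans; apply: near_eq_cvg; near=> n.
rewrite (@rint_sum _ _ _ mu n (fun i x => 'C(i + m, m)%:R * (u - v) ^+ i * t i x)); last first.
  by move=> i; exact: L1Z.
by apply: eq_bigr => i _; rewrite rintZ // /lmom; ring.
Unshelve. all: by end_near. Qed.

End LaguerreMoments.

(** * Uniqueness for power series and for polynomials *)

Section PowerSeries.
Context {R : realType}.
Implicit Types (a : nat -> R).

Lemma cvgB_seq (u v : nat -> R) (l m : R) : u @ \oo --> l -> v @ \oo --> m ->
  (fun n => u n - v n) @ \oo --> l - m.
Proof. by move=> hu hv; apply: cvgB. Qed.

(** Once the coefficients before [m] are known to vanish, dividing by [s^m] leaves [|a m| <= K s]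
    for all small [s]. *)
Lemma power_series_eq0 a (C : R) (A : nat) : 0 <= C ->
  (forall i, `|a i| <= C * i.+1%:R ^+ A) ->
  (forall s, 0 < s <= 2^-1 -> (fun n => \sum_(i < n) a i * s ^+ i) @ \oo --> (0 : R)) ->
  forall i, a i = 0.
Proof.
move=> C0 ha hs m; have [n] := ubnP m; elim: n m => // n IH m /ltnSE mn.
pose K : R := C * (A`!%:R * (1 - 2^-1) ^- A.+1) * 2 ^+ m.+1.
have x01 : 0 <= (2^-1 : R) < 1 by apply/andP; split; lra.
have K0 : 0 <= K.
  by rewrite !mulr_ge0 // ?exprn_ge0 // invr_ge0 exprn_ge0 //; lra.
have bnd s : 0 < s <= 2^-1 -> `|a m| <= K * s.
  move=> s01; have /andP[s0 s2] := s01.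
  have := hs s s01 => h.
  have {}h : (fun n => \sum_(i < n + m.+1) a i * s ^+ i) @ \oo --> (0 : R).
    by rewrite (cvg_shiftn m.+1 (fun n => \sum_(i < n) a i * s ^+ i)).
  have E k : `|\sum_(i < k + m.+1) a i * s ^+ i - a m * s ^+ m| <= K * s * s ^+ m.
    rewrite addnC big_split_ord /= big_ord_recr /= big1 ?add0r; last first.
      by move=> i _; rewrite IH ?mul0r // (leq_trans (ltn_ord i)).
    rewrite addrAC subrr add0r; apply: le_trans (ler_norm_sum _ _ _) _.
    apply: (@le_trans _ _ (\sum_(i < k) C * 2 ^+ m.+1 * s ^+ m.+1 * ((m.+1 + i).+1%:R ^+ A * 2^-1 ^+ (m.+1 + i)))).
      apply: ler_sum => i _; rewrite normrM normrX (ger0_norm (ltW s0)).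
      have -> : C * 2 ^+ m.+1 * s ^+ m.+1 * ((m.+1 + i).+1%:R ^+ A * 2^-1 ^+ (m.+1 + i)) =
        C * (m.+1 + i).+1%:R ^+ A * (s ^+ m.+1 * 2^-1 ^+ i).
        rewrite exprD [2^-1 ^+ m.+1]exprVn.
        by field; rewrite expf_neq0.
      apply: ler_pM => //; first by rewrite exprn_ge0 // ltW.
      rewrite exprD ler_wpM2l ?exprn_ge0 ?(ltW s0) // lerXn2r ?nnegrE ?invr_ge0 ?(ltW s0) //.
    rewrite -mulr_sumr.
    have hsum : \sum_(i < k) (m.+1 + i).+1%:R ^+ A * 2^-1 ^+ (m.+1 + i) <= A`!%:R * (1 - 2^-1) ^- A.+1 :> R.
      apply: le_trans (sum_pow_geometric_le A (m.+1 + k) x01).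
      by rewrite big_split_ord /= lerDr sumr_ge0.
    apply: le_trans (ler_wpM2l _ hsum) _.
      by rewrite !mulr_ge0 ?exprn_ge0 // ltW.
    by rewrite /K [s ^+ m.+1]exprS le_eqVlt; apply/orP; left; apply/eqP; ring.
  have sm : 0 < s ^+ m by rewrite exprn_gt0.
  rewrite -(ler_pM2r sm).
  have -> : `|a m| * s ^+ m = `|a m * s ^+ m|.
    by rewrite normrM normrX (ger0_norm (ltW s0)).
  apply/ler_addgt0Pr => e e0; move/cvgrPdist_le : h => /(_ e e0) [k _ /(_ k (leqnn k))] /=.
  rewrite sub0r normrN => h.
  have -> : a m * s ^+ m = \sum_(i < k + m.+1) a i * s ^+ i -
     (\sum_(i < k + m.+1) a i * s ^+ i - a m * s ^+ m) by rewrite subKr.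
  by apply: le_trans (ler_normB _ _) _; rewrite addrC; exact: lerD.
apply/eqP; rewrite -normr_eq0 eq_le normr_ge0 andbT leNgt; apply/negP => am.
have K1 : 0 < 2 * (K + 1) by rewrite mulr_gt0 // ltr_wpDl.
pose s := Num.min 2^-1 (`|a m| / (2 * (K + 1))).
have s0 : 0 < s by rewrite lt_min invr_gt0 ltr0n /= divr_gt0.
have /bnd h : 0 < s <= 2^-1 by rewrite s0 ge_min lexx.
have : s * (2 * (K + 1)) <= `|a m| by rewrite -ler_pdivlMr // ge_min lexx orbT.
have : 0 <= K * s by rewrite mulr_ge0 // ltW.
by move: h am s0; clearbody s; lra.
Qed.

(* [e] is a sign: the hypothesis is the decay of the polynomial at [+oo] or at [-oo]. *)
Lemma polynomial_cvg0_eq0 a K (e : R) : e != 0 ->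
  (fun n : nat => \sum_(k < K) a k * (e * n%:R) ^+ k) @ \oo --> (0 : R) ->
  forall k, (k < K)%N -> a k = 0.
Proof.
move=> e0; elim: K => // K IH h.
have inv0 : (fun n : nat => n.+1%:R^-1 : R) @ \oo --> (0 : R) by exact: cvg_harmonic.
have pw j : (fun n : nat => n.+1%:R^-1 ^+ j : R) @ \oo --> (0 ^+ j : R).
  by apply: (cvg_comp _ (fun z : R => z ^+ j) inv0); exact: exprn_continuous.
have hK : a K = 0.
  have h1 : (fun n : nat => \sum_(k < K.+1) a k * (e * n.+1%:R) ^+ k) @ \oo --> (0 : R).
    by rewrite (cvg_shiftS (fun n : nat => \sum_(k < K.+1) a k * (e * n%:R) ^+ k)).
  have h2 : (fun n : nat => (\sum_(k < K.+1) a k * (e * n.+1%:R) ^+ k) * (n.+1%:R^-1) ^+ K)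
      @ \oo --> (0 * 0 ^+ K : R).
    by apply: cvgM => //; exact: pw.
  have h3 : (fun n : nat => \sum_(k < K.+1) a k * e ^+ k * (n.+1%:R^-1) ^+ (K - k))
      @ \oo --> (\sum_(k < K.+1) a k * e ^+ k * 0 ^+ (K - k) : R).
    apply: cvg_big => [|k _]; first exact: add_continuous.
    by apply: cvgMr; exact: pw.
  have : 0 * 0 ^+ K = \sum_(k < K.+1) a k * e ^+ k * 0 ^+ (K - k).
    apply: (@cvg_unique _ (@Rhausdorff R) _ _ _ _ h2); apply: cvg_trans h3; apply: near_eq_cvg; near=> n.
    rewrite mulr_suml; apply: eq_bigr => k _.
    have kK : (k <= K)%N by rewrite -ltnS.
    have -> : n.+1%:R^-1 ^+ K = n.+1%:R^-1 ^+ (K - k) * n.+1%:R^-1 ^+ k :> R.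
      by rewrite -exprD subnK.
    have -> : (e * n.+1%:R) ^+ k = e ^+ k * n.+1%:R ^+ k by rewrite exprMn.
    have : n.+1%:R ^+ k * n.+1%:R^-1 ^+ k = 1 :> R.
      by rewrite -exprMn divff ?expr1n // pnatr_eq0.
    move: (n.+1%:R ^+ k) (n.+1%:R^-1 ^+ k) (n.+1%:R^-1 ^+ (K - k)) => x y z xy.
    by transitivity (a k * e ^+ k * z * (x * y)); [rewrite xy mulr1|ring].
  rewrite mul0r big_ord_recr /= subnn expr0 mulr1 big1 ?add0r.
    by move=> /esym/eqP; rewrite mulf_eq0 expf_eq0 (negbTE e0) andbF orbF => /eqP.
  by move=> k _; rewrite expr0n subn_eq0 leqNgt ltn_ord mulr0.
move=> k; rewrite ltnS leq_eqVlt => /predU1P[->//|]; apply: IH.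
apply: cvg_trans h; apply: near_eq_cvg; near=> n.
by rewrite big_ord_recr /= hK mul0r addr0.
Unshelve. all: by end_near. Qed.

End PowerSeries.

(** * Gluing two Laplace-type integrals into one polynomial *)

Section TwoSidedLaplace.
Context d1 (T1 : measurableType d1) d2 (T2 : measurableType d2) {R : realType}.
Variables (mu1 : {measure set T1 -> \bar R}) (mu2 : {measure set T2 -> \bar R}).
Variables (b g : R) (Phi X : T1 -> R) (Psi Y : T2 -> R) (N1 N2 : nat).
Hypotheses (hb : 2^-1 <= b) (X0 : forall x, 0 <= X x) (Y0 : forall x, 0 <= Y x).
Hypotheses (mX : measurable_fun [set: T1] X) (mPhi : measurable_fun [set: T1] Phi).
Hypotheses (mY : measurable_fun [set: T2] Y) (mPsi : measurable_fun [set: T2] Psi).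
Hypothesis iPhi : L1 mu1 (fun x => `|Phi x| * (1 + X x) ^- N1).
Hypothesis iPsi : L1 mu2 (fun x => `|Psi x| * (1 + Y x) ^- N2).

Let JPhi := lmom mu1 b Phi X.
Let JPsi := lmom mu2 b Psi Y.

Hypothesis rel : forall T, `|T| < 1 -> JPhi 0 (1 - T) = g * JPsi 0 (1 + T).

Let sgn (m : nat) : R := (-1) ^+ m.

(** Both sides of [rel] are expanded at [T = 0], and the difference is a power series vanishing on
    an interval. The sign appears because [1 - T] and [1 + T] move in opposite directions. *)
Let matching m : JPhi m 1 = g * sgn m * JPsi m 1.
Proof.
have [C1 [A1 [C10 h1]]] := lmom_bound hb X0 mX mPhi iPhi.
have [C2 [A2 [C20 h2]]] := lmom_bound hb Y0 mY mPsi iPsi.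
have cA A A' i : (A <= A')%N -> i.+1%:R ^+ A <= i.+1%:R ^+ A' :> R.
  by move=> h; rewrite ler_weXn2l // ler1n.
pose a i := JPhi i 1 - g * sgn i * JPsi i 1.
suff /(_ m)/eqP : forall i, a i = 0 by rewrite subr_eq0 => /eqP.
apply: (@power_series_eq0 _ a (C1 + `|g| * C2) (A1 + A2)).
- by rewrite addr_ge0 // mulr_ge0.
- move=> i; have [_] := h1 i 1 (lexx _); have [_] := h2 i 1 (lexx _).
  rewrite !expr1n invr1 !mulr1 => k2 k1.
  apply: le_trans (ler_normB _ _) _; rewrite mulrDl lerD //.
    by apply: le_trans k1 _; rewrite ler_wpM2l // cA // leq_addr.
  rewrite !normrM normrX normrN1 expr1n mulr1 -mulrA ler_wpM2l //.
  by apply: le_trans k2 _; rewrite ler_wpM2l // cA // leq_addl.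
- move=> s /andP[s0 s2].
  have r01 : 0 <= s < 1 by apply/andP; split; lra.
  have v1 : 0 < 1 - s by lra.
  have v2 : 0 < 1 + s by lra.
  have d1' : `|1 - (1 - s)| <= s * 1 by rewrite mulr1 subKr ger0_norm // ltW.
  have d2' : `|1 - (1 + s)| <= s * 1.
    by rewrite mulr1 opprD addNKr normrN ger0_norm // ltW.
  have l1 := lmom_taylor (m := 0%N) hb X0 mX mPhi iPhi (lexx 1) v1 d1' r01.
  have l2 := lmom_taylor (m := 0%N) hb Y0 mY mPsi iPsi (lexx 1) v2 d2' r01.
  have l3 : (fun n : nat => g * \sum_(i < n) 'C(i + 0, 0)%:R * lmom mu2 b Psi Y (i + 0) 1 * (1 - (1 + s)) ^+ i)
     @ \oo --> g * lmom mu2 b Psi Y 0 (1 + s).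
    by apply: cvgMr.
  have := cvgB_seq l1 l3; rewrite -/(JPhi _ _) -/(JPsi _ _).
  rewrite rel; last by rewrite ger0_norm; lra.
  rewrite subrr; apply: cvg_trans; apply: near_eq_cvg; near=> n.
  rewrite mulr_sumr /= -sumrB; apply: eq_bigr => i _.
  rewrite /a !bin0 !addn0 subKr opprD addNKr exprNn /sgn /JPhi /JPsi.
  by ring.
Unshelve. all: by end_near. Qed.

(** On either side of [0] the moments are evaluated at [1 + |T|], in the range [u >= 1] where they
    are bounded. *)
Let D (k : nat) (T : R) := if T <= 0 then JPhi k (1 - T) else g * sgn k * JPsi k (1 + T).

Let D_bound : exists C A M, 0 <= C /\ forall k T,
  `|D k T| <= C * k.+1%:R ^+ A * (1 + `|T|) ^+ M * (1 + `|T|) ^- k.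
Proof.
have [C1 [A1 [C10 h1]]] := lmom_bound hb X0 mX mPhi iPhi.
have [C2 [A2 [C20 h2]]] := lmom_bound hb Y0 mY mPsi iPsi.
exists (C1 + `|g| * C2), (A1 + A2)%N, (N1 + N2)%N; split.
  by rewrite addr_ge0 // mulr_ge0.
move=> k T; have u1 : 1 <= 1 + `|T| by rewrite lerDl.
have ui : 0 <= (1 + `|T|) ^- k by rewrite invr_ge0 exprn_ge0 // addr_ge0.
have key (C B : R) A M : 0 <= C -> C <= B -> (A <= A1 + A2)%N -> (M <= N1 + N2)%N ->
    C * k.+1%:R ^+ A * (1 + `|T|) ^+ M * (1 + `|T|) ^- k <=
    B * k.+1%:R ^+ (A1 + A2) * (1 + `|T|) ^+ (N1 + N2) * (1 + `|T|) ^- k.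
  move=> C0 CB hA hM; rewrite ler_wpM2r //.
  apply: ler_pM; rewrite ?mulr_ge0 ?exprn_ge0 ?addr_ge0 //; last by rewrite ler_weXn2l.
  by apply: ler_pM; rewrite ?exprn_ge0 // ler_weXn2l // ler1n.
rewrite /D; case: ifPn => T0.
  have e : 1 - T = 1 + `|T| by rewrite ler0_norm.
  rewrite e; have [_ h] := h1 k _ u1; apply: (le_trans h).
  by apply: key; rewrite ?leq_addr // lerDl mulr_ge0.
rewrite -ltNge in T0; have e : 1 + T = 1 + `|T| by rewrite gtr0_norm.
rewrite e; have [_ h] := h2 k _ u1.
rewrite normrM (normrM g) normrX normrN1 expr1n mulr1.
apply: (@le_trans _ _ (`|g| * (C2 * k.+1%:R ^+ A2 * (1 + `|T|) ^+ N2 * (1 + `|T|) ^- k))).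
  by rewrite ler_wpM2l.
rewrite !mulrA; apply: key; rewrite ?leq_addl ?mulr_ge0 // lerDr //.
Qed.

(** Re-expansion from [1 + |T|] to [1] has ratio [|T| / (1 + |T|) < 1]. For [T > 0] it yields a
    moment of [Psi], which [matching] turns into the one of [Phi]. *)
Let D_taylor T m :
  (fun N => \sum_(k < N) D k T * ((- T) ^+ (k - m) * 'C(k, m)%:R)) @ \oo --> D m 0.
Proof.
rewrite -(cvg_shiftn m) /=.
have E N : \sum_(k < N + m) D k T * ((- T) ^+ (k - m) * 'C(k, m)%:R) =
    \sum_(i < N) D (i + m)%N T * ((- T) ^+ i * 'C(i + m, m)%:R).
  rewrite addnC big_split_ord /= big1 ?add0r; last first.
    by move=> i _; rewrite bin_small // !mulr0.
  by apply: eq_bigr => i _; rewrite addnC addnK.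
have r01 : 0 <= `|T| / (1 + `|T|) < 1.
  rewrite divr_ge0 ?addr_ge0 //= ltr_pdivrMr ?ltr_pwDl // mul1r.
  by rewrite ltrDr.
have u1 : 1 <= 1 + `|T| by rewrite lerDl.
have rK : `|T| / (1 + `|T|) * (1 + `|T|) = `|T|.
  by rewrite divfK // gt_eqF // ltr_pwDl.
have D0 : D m 0 = JPhi m 1 by rewrite /D lexx subr0.
rewrite D0; have [T0|T0] := leP T 0.
  have e : 1 - T = 1 + `|T| by rewrite ler0_norm.
  have hu : `|(1 + `|T|) - 1| <= `|T| / (1 + `|T|) * (1 + `|T|).
    by rewrite addrAC subrr add0r rK normr_id.
  have := lmom_taylor (m := m) hb X0 mX mPhi iPhi u1 ltr01 hu r01.
  apply: cvg_trans; apply: near_eq_cvg; near=> n.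
  rewrite E; apply: eq_bigr => i _.
  by rewrite /D T0 e addrAC subrr add0r ler0_norm //; rewrite /JPhi; ring.
have e : 1 + T = 1 + `|T| by rewrite gtr0_norm.
have hu : `|(1 + `|T|) - 1| <= `|T| / (1 + `|T|) * (1 + `|T|).
  by rewrite addrAC subrr add0r rK normr_id.
rewrite matching.
have : (fun n : nat => g * sgn m * \sum_(i < n) 'C(i + m, m)%:R * JPsi (i + m) (1 + `|T|) * (1 + `|T| - 1) ^+ i)
    @ \oo --> g * sgn m * JPsi m 1.
  by apply: cvgMr; exact: (lmom_taylor (m := m) hb Y0 mY mPsi iPsi u1 ltr01 hu r01).
apply: cvg_trans; apply: near_eq_cvg; near=> n.
rewrite E mulr_sumr; apply: eq_bigr => i _.
rewrite /D leNgt T0 /= e addrAC subrr add0r gtr0_norm // /sgn exprD (exprNn T).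
have : (-1) ^+ i * (-1) ^+ i = 1 :> R by rewrite -exprMn mulrNN mulr1 expr1n.
move: ((-1) ^+ i) => z zz.
transitivity (g * (-1) ^+ m * ('C(i + m, m)%:R * JPsi (i + m) (1 + T) * T ^+ i) * (z * z)).
  by rewrite zz mulr1.
by ring.
Unshelve. all: by end_near. Qed.

Theorem two_sided_laplace_eq0 :
  (fun n : nat => JPhi 0 (1 + n%:R)) @ \oo --> (0 : R) \/
  (fun n : nat => JPsi 0 (1 + n%:R)) @ \oo --> (0 : R) ->
  forall u, 0 < u -> JPhi 0 u = 0.
Proof.
move=> decay; have [C [A [M [C0 hD]]]] := D_bound.
have poly := taylor_family_polynomial C0 hD D_taylor.
set K := (2 * (M + A.+1)).+1 in poly.
have D0 k : (k < K)%N -> D k 0 = 0.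
  case: decay => h.
    apply: (@polynomial_cvg0_eq0 _ (D ^~ 0) K (-1)); first by rewrite oppr_eq0 oner_neq0.
    apply: cvg_trans h; apply: near_eq_cvg; near=> n.
    by rewrite -poly /D mulN1r oppr_le0 ler0n opprK.
  apply: (@polynomial_cvg0_eq0 _ (D ^~ 0) K 1); first exact: oner_neq0.
  have : (fun n : nat => g * JPsi 0 (1 + n%:R)) @ \oo --> g * 0 by apply: cvgMr.
  rewrite mulr0; apply: cvg_trans; apply: near_eq_cvg; near=> n.
  rewrite -poly /D mul1r leNgt ltr0n /=.
  have -> : (0 < n)%N by near: n; exact: nbhs_infty_gt.
  by rewrite /sgn expr0 mulr1.
have Dz T : D 0 T = 0.
  by rewrite poly big1 // => k _; rewrite D0 ?mul0r.
move=> u u0; have [u1|u1] := leP 1 u.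
  by have := Dz (1 - u); rewrite /D subr_le0 u1 subKr.
(* For [u < 1] the value of [D] at [1 - u] is taken on the [Psi] side, and [rel] carries it back to
   [Phi]. *)
have := Dz (1 - u); rewrite /D subr_le0 leNgt u1 /= /sgn expr0 mulr1 => h.
have := @rel (1 - u); rewrite subKr h; apply.
by rewrite ger0_norm ?subr_ge0 ?(ltW u1) // ltrBlDr ltrDl.
Unshelve. all: by end_near. Qed.

End TwoSidedLaplace.

(** * Injectivity of the Laplace transform *)

Section LaplaceUniqueness.
Context {R : realType}.

Lemma bernoulli (t : R) n : -1 <= t -> 1 + n%:R * t <= (1 + t) ^+ n.
Proof.
move=> t1; elim: n => [|n IH]; first by rewrite mul0r addr0 expr0.
have t0 : 0 <= 1 + t by lra.
rewrite exprS; apply: le_trans (ler_wpM2l t0 IH).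
have : 0 <= n%:R * t ^+ 2 by rewrite mulr_ge0 ?sqr_ge0.
by rewrite -natr1; nra.
Qed.

(** Polynomials tending pointwise on [[0, 1]] to the indicator of [y < 1/2]: the product of the two
    exponents' contributions is [n (2y)^n], which tends to [0] or to infinity. The extra factor [n]
    settles the point [y = 1/2]. *)
Definition step_approx (n : nat) (y : R) : R := (1 - y ^+ n) ^+ (n * 2 ^ n).

Lemma step_approx01 n (y : R) : 0 <= y <= 1 -> 0 <= step_approx n y <= 1.
Proof.
move=> /andP[y0 y1]; have h : 0 <= y ^+ n <= 1 by rewrite exprn_ge0 //= exprn_ile1.
by rewrite /step_approx exprn_ge0 ?exprn_ile1 //; lra.
Qed.

Lemma step_approx_cvg (y : R) : 0 <= y <= 1 ->
  (fun n => step_approx n y) @ \oo --> ((y < 2^-1)%R%:R : R).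
Proof.
move=> y01; have /andP[y0 y1] := y01.
have expE n : (n * 2 ^ n)%:R * y ^+ n = n%:R * (2 * y) ^+ n :> R.
  by rewrite natrM natrX exprMn mulrA.
have yn n : 0 <= y ^+ n <= 1 by rewrite exprn_ge0 //= exprn_ile1.
have [y2|y2] := ltP y 2^-1.
  have y201 : 0 <= 2 * y < 1 by apply/andP; split; lra.
  have h : (fun n : nat => 1 - n.+1%:R ^+ 1 * (2 * y) ^+ n) @ \oo --> (1 - 0 : R).
    by apply: cvgB_seq; [exact: cvg_cst|exact: cvg_pow_geometric].
  rewrite subr0 in h.
  apply: (@squeeze_cvgr _ _ _ _ (fun n : nat => 1 - n.+1%:R ^+ 1 * (2 * y) ^+ n) (cst 1)) => //;
    last exact: cvg_cst.
  near=> n; have /andP[_ b1] := step_approx01 n y01; rewrite /= b1 andbT.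
  apply: (@le_trans _ _ (1 + (n * 2 ^ n)%:R * (- y ^+ n))).
    rewrite mulrN expE expr1 lerD2l lerN2 ler_wpM2r ?ler_nat //.
    by rewrite exprn_ge0 //; lra.
  by apply: bernoulli; have := yn n; lra.
have h : (fun n : nat => n.+1%:R^-1 : R) @ \oo --> (0 : R) by exact: cvg_harmonic.
apply: (@squeeze_cvgr _ _ _ _ (cst 0) (fun n : nat => n.+1%:R^-1)) => //;
  last exact: cvg_cst.
near=> n; have /andP[b0 _] := step_approx01 n y01; rewrite b0 /=.
set K := (n * 2 ^ n)%N.
have h1 : n.+1%:R <= (1 + y ^+ n) ^+ K.
  apply: le_trans (bernoulli K _); last by have := yn n; lra.
  rewrite expE -natr1 addrC lerD2l ler_peMr //.
  by rewrite exprn_ege1 //; lra.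
have h2 : (1 - y ^+ n) ^+ K * (1 + y ^+ n) ^+ K <= 1.
  rewrite -exprMn exprn_ile1 //; have := yn n => ?; nra.
have n1 : 0 < n.+1%:R :> R by rewrite ltr0n.
rewrite -div1r ler_pdivlMr //; apply: le_trans h2.
by rewrite ler_wpM2l.
Unshelve. all: by end_near. Qed.

Context d (T : measurableType d) (mu : {measure set T -> \bar R}).
Variables (G X : T -> R).
Hypotheses (iG : L1 mu G) (X0 : forall x, 0 <= X x) (mX : measurable_fun [set: T] X).
Hypothesis G0 : forall l, 0 <= l -> rint mu (fun x => G x * expR (- (l * X x))) = 0.

Let mE l : measurable_fun [set: T] (fun x => expR (- (l * X x))).
Proof.
apply: (@measurableT_comp _ _ _ _ _ _ (@expR R)) => //.
by apply: measurableT_comp => //; exact: measurable_funM.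
Qed.

(** With [y = exp(-dl X)] and [dl = ln 2 / c], the condition [X > c] becomes [y < 1/2]. A polynomial
    in [y] is a combination of exponentials, against which [G] integrates to [0], and [step_approx]
    tends boundedly to the indicator. *)
Lemma laplace_eq0_superlevel c : 0 < c -> rint mu (fun x => G x * (c < X x)%R%:R) = 0.
Proof.
move=> c0; pose dl := ln 2 / c.
have l2 : 0 < ln 2 :> R by rewrite ln_gt0 // ltr1n.
have dl0 : 0 < dl by rewrite divr_gt0.
pose y x := expR (- (dl * X x)).
have y01 x : 0 <= y x <= 1.
  by rewrite expR_ge0 /= -expR0 ler_expR oppr_le0 mulr_ge0 // ltW.
have yc x : (y x < 2^-1) = (c < X x).
  have -> : 2^-1 = expR (- ln 2) :> R by rewrite expRN lnK // posrE.
  by rewrite ltr_expR ltrN2 /dl mulrAC ltr_pdivlMr // ltr_pM2l.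
have iE l : 0 <= l -> L1 mu (fun x => G x * expR (- (l * X x))).
  move=> l0; apply: (L1_le _ _ (L1_norm iG)).
    by apply: measurable_funM => //; exact: (L1_measurable iG).
  move=> x; rewrite normrM ler_piMr // ger0_norm ?expR_ge0 // -expR0 ler_expR.
  by rewrite oppr_le0 mulr_ge0.
pose p n : {poly R} := (1 - 'X^n) ^+ (n * 2 ^ n).
have pE n z : (p n).[z] = step_approx n z.
  by rewrite /p /step_approx horner_exp !hornerE.
pose F n x := G x * step_approx n (y x).
have FE n : F n = fun x => \sum_(i < size (p n)) (p n)`_i * (G x * expR (- (i%:R * dl * X x))).
  apply/funext => x; rewrite /F -pE horner_coef mulr_sumr; apply: eq_bigr => i _.
  have -> : expR (- (i%:R * dl * X x)) = y x ^+ i.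
    by rewrite /y -expRM_natl; congr expR; ring.
  by ring.
have iF i n : L1 mu (fun x => (p n)`_i * (G x * expR (- (i%:R * dl * X x)))).
  by apply: L1Z; apply: iE; rewrite mulr_ge0 // ltW.
have F0 n : rint mu (F n) = 0.
  rewrite FE (@rint_sum _ _ _ mu _ (fun i x => (p n)`_i * (G x * expR (- (i%:R * dl * X x))))) //.
  rewrite big1 // => i _; rewrite rintZ; last by apply: iE; rewrite mulr_ge0 // ltW.
  by rewrite G0 ?mulr0 // mulr_ge0 // ltW.
have mF n : measurable_fun [set: T] (F n).
  rewrite FE; apply: (@L1_measurable _ _ _ mu).
  exact: (@L1_sum _ _ _ mu _ (fun i x => (p n)`_i * (G x * expR (- (i%:R * dl * X x))))).
have FL x : F ^~ x @ \oo --> G x * (c < X x)%R%:R.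
  by rewrite -yc; apply: cvgMr; exact: step_approx_cvg.
have Fb n x : `|F n x| <= `|G x|.
  have /andP[s0 s1] := step_approx01 n (y01 x).
  by rewrite /F normrM ler_piMr // ger0_norm.
have [_ h] := rint_dct mF FL Fb (L1_norm iG).
apply: (@cvg_unique _ (@Rhausdorff R) _ _ _ _ h).
have -> : (fun n => rint mu (F n)) = cst 0 by apply/funext => n; exact: F0.
exact: cvg_cst.
Qed.

End LaplaceUniqueness.

(** * Reflection, and vanishing of an even part *)

Section EvenPart.
Context {R : realType}.
Local Notation leb := (@lebesgue_measure R).

Lemma ge0_integral_opp (f : R -> \bar R) :
  measurable_fun [set: measurableTypeR R] f -> (forall x, (0 <= f x)%E) ->
  (\int[leb]_x f (- x)%R = \int[leb]_x f x)%E.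
Proof.
move=> mf f0.
have mN : measurable_fun [set: measurableTypeR R] (-%R : R -> measurableTypeR R).
  exact: oppr_measurable.
have f0' : {in [set: measurableTypeR R], forall y, (0 <= f y)%E} by move=> y _.
have := ge0_integral_pushforward mN leb measurableT mf f0'.
rewrite preimage_setT => <- //.
by apply: eq_measure_integral => //= A mA _; exact/lebesgue_measureN.
Qed.

Lemma L1_opp (f : R -> R) : L1 leb f -> L1 leb (fun x => f (- x)).
Proof.
move=> /integrableP[mf fi]; apply/integrableP; split.
  by apply: (measurableT_comp mf); exact: oppr_measurable.
by rewrite (@ge0_integral_opp (fun x => `|(f x)%:E|)%E) //; exact: measurableT_comp.
Qed.

Lemma rint_opp (f : R -> R) : L1 leb f -> rint leb (fun x => f (- x)) = rint leb f.
Proof.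
move=> hf; have mf := measurable_int _ hf.
rewrite /rint /Rintegral; congr fine.
rewrite integralE [RHS]integralE; congr (_ - _)%E.
  rewrite -(@ge0_integral_opp (fun x => (EFin \o f)^\+ x)%E) //.
    by apply: eq_integral => x _; rewrite !funeposE.
  exact: measurable_funepos.
rewrite -(@ge0_integral_opp (fun x => (EFin \o f)^\- x)%E) //.
  by apply: eq_integral => x _; rewrite !funenegE.
exact: measurable_funeneg.
Qed.

(** The primitive of [G x + G (- x)] from minus infinity vanishes off [0], and Lebesgue's
    differentiation theorem recovers the integrand almost everywhere. *)
Lemma even_part_ae_eq0 (G : R -> R) : L1 leb G -> rint leb G = 0 ->
  (forall c, 0 < c -> rint leb (fun x => G x * (c < `|x|)%R%:R) = 0) ->
  {ae leb, forall x, G x + G (- x) = 0}.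
Proof.
move=> iG G0 hG; pose H x := G x + G (- x).
have iH : L1 leb H by apply: L1D => //; exact: L1_opp.
have mN : measurable_fun [set: measurableTypeR R] (-%R : R -> R).
  exact: oppr_measurable.
have m1 (b : bool) : `|b%:R| <= 1 :> R by case: b; rewrite ?normr1 ?normr0.
have HF (A : set R) : measurable A ->
    (\int[leb]_(t in A) H t)%R =
    rint leb (fun x => G x * ((x \in A)%:R + (- x \in A)%:R)).
  move=> mA; have mi := measurable_mem (R := R) mA.
  have mi' : measurable_fun [set: measurableTypeR R] (fun x => (- x \in A)%:R : R).
    exact: (measurableT_comp mi mN).
  pose G1 x := G x * (x \in A)%:R; pose G2 x := G x * (- x \in A)%:R.
  have i1 : L1 leb G1 by apply: (L1M_bounded iG mi) => x; exact: m1.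
  have i2 : L1 leb G2 by apply: (L1M_bounded iG mi') => x; exact: m1.
  rewrite Rintegral_mkcond.
  transitivity (rint leb (fun x => G1 x + G2 (- x))).
    apply: rint_ext => x; rewrite /patch /G1 /G2 /H opprK.
    by case: ifP => _; rewrite ?mulr1 // !mulr0 addr0.
  rewrite rintD // ?rint_opp //; last exact: L1_opp.
  by rewrite -rintD //; apply: rint_ext => x; rewrite -mulrDr.
have iHA (A : set R) : measurable A -> leb.-integrable A (EFin \o H).
  by move=> mA; apply: integrableS iH.
(* The indicators of the half-line at [t] and at [- t] add up to the indicator of [|t| > - x] when
   [x < 0], once the endpoint is dropped, and to [2] minus the indicator of [|t| > x] when
   [x > 0]. *)
have F0 x : x != 0 -> (\int[leb]_(t in `]-oo, x]) H t)%R = 0.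
  rewrite neq_lt => /orP[x0|x0].
    rewrite -Rintegral_itv_bndo_bndc; last exact: iHA.
    rewrite HF // -[RHS](hG (- x)) ?oppr_gt0 //; apply: rint_ext => t; congr (_ * _).
    rewrite !mem_setE !in_itv /= ltr_normr !ltrN2 ltrNl.
    have [tx|xt] := ltP t x; last by rewrite add0r orbF ltrNl.
    have -> : (- x < t)%R = false by apply/negbTE; rewrite -leNgt; lra.
    by rewrite addr0.
  rewrite HF //.
  have iGc : L1 leb (fun t => G t * (x < `|t|)%R%:R).
    apply: (L1M_bounded (k := 1) iG); last by move=> t; exact: m1.
    have mi := measurable_mem (R := R) (measurable_itv `]x, +oo[ : measurable (`]x, +oo[ : set (measurableTypeR R))).
    have := measurableT_comp mi (@normr_measurable R [set: R]).
    by congr (measurable_fun _); apply/funext => t /=; rewrite mem_setE in_itv /= andbT.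
  transitivity (rint leb (fun t => 2 * G t + (-1) * (G t * (x < `|t|)%R%:R))).
    apply: rint_ext => t; rewrite !mem_setE !in_itv /= ltr_normr.
    have [tx|xt] := leP t x; have [tx'|xt'] := leP (- t) x.
    - by rewrite /=; ring.
    - by rewrite /=; ring.
    - by rewrite /=; ring.
    - by lra.
  by rewrite rintD ?rintZ ?G0 ?hG ?mulr0 ?addr0 //; exact: L1Z.
have hloc : locally_integrable [set: R] H.
  by apply: open_integrable_locally; [exact: openT|exact: iH].
have h := @FTC1Ny R H (fun y => iHA _ (measurable_itv _)) hloc.
have h0 : {ae leb, forall x, x != 0 :> R}.
  exists [set 0]; split => //; first by rewrite lebesgue_measure_set1.
  by move=> x /= /negP; rewrite negbK => /eqP.
apply: (@filterS2 _ _ (ae_filter_ringOfSetsType leb) _ _ _ _ h h0) => x [_ hx] x0.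
rewrite -[LHS]hx derive1E.
have -> : 'D_1 (fun x : R => \int[leb]_(t in `]-oo, x]) H t)%R x = 'D_1 (cst 0 : R -> R) x.
  have nx : \forall y \near x, y != 0.
    by apply: open_nbhs_nbhs; split; [exact: open_neq|exact: x0].
  by apply: near_eq_derive; apply: filterS nx => y; exact: F0.
by rewrite derive_cst.
Qed.

End EvenPart.

(** * The fundamental theorem of calculus on the half-line *)

Section HalfLine.
Context {R : realType}.
Local Notation leb := (@lebesgue_measure R).
Implicit Types (f F : R -> R) (s r z c : R).

Definition pos (x : R) : R := (0 < x)%R%:R.

Lemma measurable_pos : measurable_fun [set: measurableTypeR R] pos.
Proof.
have := measurable_mem (R := R) (measurable_itv `]0, +oo[ : measurable (`]0, +oo[ : set (measurableTypeR R))).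
by congr (measurable_fun _); apply/funext => t /=; rewrite mem_setE in_itv /= andbT.
Qed.

(** A compact exhaustion of the open half-line, since the integrands may be singular at [0]. The
    shift by two makes even the segment of index [0] nondegenerate. *)
Let seg (n : nat) : set (measurableTypeR R) := `[n.+2%:R^-1, n.+2%:R]%classic.

Let seg_lt n : n.+2%:R^-1 < n.+2%:R :> R.
Proof.
apply: (@lt_le_trans _ _ 1); last by rewrite ler1n.
by rewrite invf_lt1 ?ltr1n ?ltr0n.
Qed.

Let FTC_seg f F n : (forall x : R, 0 < x -> is_derive x 1 F (f x)) ->
  (forall x : R, 0 < x -> {for x, continuous f}) ->
  (\int[leb]_(x in seg n) (f x)%:E = (F n.+2%:R - F n.+2%:R^-1)%:E)%E.
Proof.
move=> dF cf; have p0 : 0 < n.+2%:R^-1 :> R by rewrite invr_gt0 ltr0n.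
have cF x : 0 < x -> {for x, continuous F}.
  by move=> x0; apply: differentiable_continuous; apply/derivable1_diffP; have [] := dF x x0.
rewrite (@continuous_FTC2 _ f F _ _ (seg_lt n)) //.
- apply: continuous_in_subspaceT => x /set_mem /=; rewrite in_itv /= => /andP[h _].
  by apply: cf; exact: lt_le_trans h.
- split.
  + move=> x; rewrite in_itv /= => /andP[h _].
    by have [] := dF x (lt_trans p0 h).
  + by apply: cvg_at_right_filter; apply: cF.
  + by apply: cvg_at_left_filter; apply: cF; exact: lt_trans (seg_lt n).
- move=> x; rewrite in_itv /= => /andP[h _].
  by rewrite derive1E; have [_ ->] := dF x (lt_trans p0 h).
Qed.

Let seg_nd : nondecreasing_seq seg.
Proof.
move=> m n mn; apply/subsetPset => x; rewrite /seg /= !in_itv /= => /andP[h1 h2].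
apply/andP; split; last by apply: le_trans h2 _; rewrite ler_nat.
by apply: le_trans h1; rewrite lef_pV2 ?posrE ?ltr0n // ler_nat.
Qed.

Let seg_near x : 0 < x -> \forall n \near \oo, x \in seg n.
Proof.
move=> x0; exists (maxn (Num.bound x) (Num.bound x^-1)) => // n /=.
rewrite geq_max => /andP[h1 h2].
have xi0 : 0 < x^-1 by rewrite invr_gt0.
rewrite mem_setE in_itv /=; apply/andP; split.
  rewrite -[x]invrK lef_pV2 ?posrE ?ltr0n //.
  apply: le_trans (ltW (archi_boundP (ltW xi0))) _; rewrite ler_nat.
  by apply: leq_trans h2 _; rewrite -addn2 leq_addr.
apply: le_trans (ltW (archi_boundP (ltW x0))) _; rewrite ler_nat.
by apply: leq_trans h1 _; rewrite -addn2 leq_addr.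
Qed.

Let seg_pos x n : x \in seg n -> 0 < x.
Proof.
by rewrite mem_setE in_itv /= => /andP[h _]; apply: lt_le_trans h; rewrite invr_gt0 ltr0n.
Qed.

Lemma L1_FTC f F (K : R) : measurable_fun [set: measurableTypeR R] f ->
  (forall x : R, 0 < x -> is_derive x 1 F (f x)) ->
  (forall x : R, 0 < x -> {for x, continuous f}) ->
  (forall x : R, 0 < x -> 0 <= f x) -> (forall x : R, 0 < x -> `|F x| <= K) ->
  L1 leb (fun x => f x * pos x).
Proof.
move=> mf dF cf f0 FK; apply/integrableP; split.
  by apply/measurable_EFinP; apply: measurable_funM => //; exact: measurable_pos.
have -> : (\int[leb]_x `|(EFin \o (fun x => f x * pos x)%R) x| = \int[leb]_(x in \bigcup_i seg i) (f x)%:E)%E.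
  rewrite [RHS]integral_mkcond; apply: eq_integral => x _.
  rewrite /patch /= /pos; have [x0|x0] := ltP 0 x.
    have xU : x \in \bigcup_i seg i.
      have [n _ /(_ n (leqnn n)) h] := seg_near x0.
      by apply/mem_set; exists n => //; exact: set_mem.
    by rewrite xU mulr1 ger0_norm // f0.
  rewrite mulr0 normr0; case: ifPn => // /set_mem [n _ xn].
  by have := seg_pos (mem_set xn); rewrite ltNge x0.
have mfi i : measurable_fun (seg i) (EFin \o f).
  by apply: measurable_funTS; exact/measurable_EFinP.
have f0i i x : seg i x -> (0 <= (EFin \o f) x)%E.
  by move=> /mem_set/seg_pos x0; rewrite lee_fin f0.
have h := ge0_nondecreasing_set_cvg_integral (mu := leb) seg_nd (fun i => measurable_itv _) mfi f0i.
apply: (@le_lt_trans _ _ (2 * K)%:E); last exact: ltry.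
apply: (cvge_le _ h); apply: nearW => n.
rewrite [leLHS]FTC_seg // lee_fin.
have p0 : 0 < n.+2%:R^-1 :> R by rewrite invr_gt0 ltr0n.
have := FK _ p0; have := FK n.+2%:R (ltr0n _ _); rewrite !ler_norml; lra.
Qed.

Lemma rint_FTC f F (l0 l1 : R) :
  (forall x : R, 0 < x -> is_derive x 1 F (f x)) ->
  (forall x : R, 0 < x -> {for x, continuous f}) ->
  L1 leb (fun x => f x * pos x) ->
  (fun n : nat => F n.+2%:R^-1) @ \oo --> l0 ->
  (fun n : nat => F n.+2%:R) @ \oo --> l1 ->
  rint leb (fun x => f x * pos x) = l1 - l0.
Proof.
move=> dF cf iF h0 h1.
pose G n x := f x * pos x * (x \in seg n)%:R.
have iG n : L1 leb (G n).
  apply: (L1M_bounded (k := 1) iF); first by apply: measurable_mem; exact: measurable_itv.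
  by move=> x; case: (_ \in _); rewrite ?normr1 ?normr0.
have mG n : measurable_fun [set: measurableTypeR R] (G n) by exact: L1_measurable (iG n).
have GL x : G ^~ x @ \oo --> f x * pos x.
  rewrite /G /pos; have [x0|x0] := ltP 0 x; last first.
    by apply: cvg_near_cst; apply: nearW => n; rewrite !mulr0 mul0r.
  by apply: cvg_near_cst; apply: filterS (seg_near x0) => n ->; rewrite !mulr1.
have Gb n x : `|G n x| <= `|f x * pos x|.
  by rewrite /G normrM; case: (_ \in _); rewrite ?normr1 ?normr0 ?mulr1 ?mulr0.
have [_ h] := rint_dct mG GL Gb (L1_norm iF).
apply: (@cvg_unique _ (@Rhausdorff R) _ _ _ _ h).
have -> : (fun n => rint leb (G n)) = (fun n : nat => F n.+2%:R - F n.+2%:R^-1).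
  apply/funext => n; rewrite -[RHS]/(fine (F n.+2%:R - F n.+2%:R^-1)%:E) -FTC_seg //.
  rewrite /rint /Rintegral; congr fine; rewrite [RHS]integral_mkcond.
  apply: eq_integral => x _; rewrite /patch /G /= /pos.
  case: ifPn => [xs|_]; last by rewrite mulr0.
  by rewrite (seg_pos xs) !mulr1.
exact: cvgB_seq.
Qed.

Lemma half_line_even f : measurable_fun [set: measurableTypeR R] f ->
  L1 leb (fun x => f x * pos x) ->
  L1 leb (fun x => f `|x|) /\ rint leb (fun x => f `|x|) = 2 * rint leb (fun x => f x * pos x).
Proof.
move=> mf iF; pose g x := f x * pos x.
(* At the origin [g x + g (- x)] is [0] whereas the even extension takes the value [f 0]; the
   discrepancy is carried by this null function. *)
pose e x : R := (x \in [set (0 : measurableTypeR R)])%:R.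
have Ee : (\int[leb]_x (e x)%:E = 0)%E.
  transitivity (leb ([set (0 : measurableTypeR R)] `&` setT)).
    rewrite -(integral_indic leb) //; by apply: eq_integral => x _; rewrite indicE.
  by rewrite setIT; exact: lebesgue_measure_set1.
have ie : L1 leb e.
  apply/integrableP; split.
    by apply/measurable_EFinP; apply: measurable_mem; exact: measurable_set1.
  have -> : (\int[leb]_x `|(EFin \o e) x| = \int[leb]_x (e x)%:E)%E.
    by apply: eq_integral => x _; rewrite /= /e ger0_norm.
  by rewrite Ee.
have i0 : L1 leb (fun x => f 0 * e x) by exact: L1Z.
have E x : f `|x| = g x + g (- x) + f 0 * e x.
  rewrite /g /pos oppr_gt0 /e; have [x0|x0|->] := ltrgtP x 0.
  - by rewrite mulr0 add0r mulr1 ltr0_norm // memNset ?mulr0 ?addr0 //= => xz; rewrite xz ltxx in x0.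
  - by rewrite mulr1 mulr0 addr0 gtr0_norm // memNset ?mulr0 ?addr0 //= => xz; rewrite xz ltxx in x0.
  - by rewrite normr0 !mulr0 !add0r mem_set // mulr1.
have ig := L1_opp iF; have ig2 := L1D iF ig.
split; first by apply: L1_ext (L1D ig2 i0) => x; rewrite -E.
transitivity (rint leb (fun x => g x + g (- x) + f 0 * e x)); first exact: rint_ext.
rewrite rintD // rintD // rint_opp //.
rewrite [X in _ + X](_ : _ = 0) ?addr0; first by rewrite -/g mulr2n mulrDl mul1r.
by rewrite rintZ // /rint /Rintegral Ee mulr0.
Qed.

End HalfLine.

(** * Gaussian weights and the Gamma function *)

Section Weights.
Context {R : realType}.
Local Notation leb := (@lebesgue_measure R).
Implicit Types (x s r z c t : R) (N : nat).

Lemma ge0_integral_scale c (f : R -> \bar R) : 0 < c ->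
  measurable_fun [set: measurableTypeR R] f -> (forall x, (0 <= f x)%E) ->
  (\int[leb]_x f x = c%:E * \int[leb]_x f (c * x)%R)%E.
Proof.
move=> c0 mf f0; pose phi : measurableTypeR R -> measurableTypeR R := fun x => c * x.
have mphi : measurable_fun [set: measurableTypeR R] phi by exact: measurable_funM.
pose k := NngNum (ltW c0).
have E (A : set (measurableTypeR R)) : measurable A -> leb A = mscale k (pushforward leb phi) A.
  move=> mA; apply: lebesgue_measure_unique => // _ [[u v]] /= _ <-.
  have pre : phi @^-1` `]u, v] = `]u / c, v / c]%classic.
    apply/seteqP; split => x /=; rewrite !in_itv /= /phi ltr_pdivrMr // ler_pdivlMr //.
      by rewrite ![x * c]mulrC.
    by rewrite ![x * c]mulrC.
  transitivity (c%:E * leb (`](u / c)%R, (v / c)%R]%classic : set (measurableTypeR R)))%E; last by rewrite -pre.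
  rewrite !lebesgue_measure_itv /= !lte_fin ltr_pM2r ?invr_gt0 //.
  case: ifPn => _; last by rewrite mule0.
  by rewrite -EFinB -EFinM -mulrBl mulrC divfK ?gt_eqF.
have f0' : {in [set: measurableTypeR R], forall y, (0 <= f y)%E} by move=> y _.
have := ge0_integral_pushforward mphi leb measurableT mf f0'.
rewrite preimage_setT /= => <-.
rewrite -[c]/(k%:num) -(ge0_integral_mscale (pushforward leb phi) measurableT k mf) //.
by apply: eq_measure_integral => //= A mA _; exact: E.
Qed.

Lemma pow_le_expR z N : 0 < z -> exists C : R, 0 <= C /\
  forall t, 0 <= t -> (1 + t) ^+ N <= C * expR (z * t).
Proof.
move=> z0; exists (N`!%:R * z ^- N * expR z); split.
  by rewrite !mulr_ge0 ?invr_ge0 ?exprn_ge0 ?expR_ge0 // ltW.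
move=> t t0; rewrite -[leRHS]mulrA -expRD.
have y0 : 0 <= z * (1 + t) by rewrite mulr_ge0 ?(ltW z0) // addr_ge0.
have : (z * (1 + t)) ^+ N <= N`!%:R * expR (z * (1 + t)).
  case: N => [|n].
    by rewrite expr0 fact0 mul1r; have := expR_ge1Dx (z * (1 + t)); lra.
  rewrite [leRHS]mulrC -ler_pdivrMr ?ltr0n ?fact_gt0 //.
  by apply: le_trans (expR_ge1Dxn n y0); rewrite lerDr.
rewrite exprMn mulrDr mulr1 => h.
have zN : 0 < z ^+ N by rewrite exprn_gt0.
by rewrite -(ler_pM2l zN); apply: le_trans h _; rewrite !mulrA [_ * N`!%:R]mulrC mulfK ?gt_eqF.
Qed.

Lemma powR_le_pow r s (M : nat) t : 0 < r -> 0 <= s -> s / r <= M%:R -> 0 <= t ->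
  t `^ s <= (1 + t `^ r) ^+ M.
Proof.
move=> r0 s0 sM t0.
have -> : t `^ s = (t `^ r) `^ (s / r) by rewrite -powRrM mulrC divfK ?gt_eqF.
have tr := powR_ge0 t r.
apply: (@le_trans _ _ ((1 + t `^ r) `^ (s / r))).
  by rewrite ge0_ler_powR ?nnegrE ?divr_ge0 ?(ltW r0) ?addr_ge0 // lerDr.
rewrite -powR_mulrn ?addr_ge0 //; apply: ler_powR => //; by rewrite lerDl.
Qed.

Lemma measurable_absp s : measurable_fun [set: measurableTypeR R] (fun x : R => `|x| `^ s).
Proof. by apply: (@measurableT_comp _ _ _ _ _ _ (@powR R ^~ s)) => //. Qed.

Lemma measurable_invpow d (T : measurableType d) (f : T -> R) N :
  measurable_fun [set: T] f -> (forall y, 0 <= f y) ->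
  measurable_fun [set: T] (fun y => f y ^- N).
Proof.
move=> mf f0; have -> : (fun y => f y ^- N) = (fun y => f y `^ (- N%:R)).
  by apply/funext => y; rewrite powR_invn.
by apply: (@measurableT_comp _ _ _ _ _ _ (@powR R ^~ _)).
Qed.

Let cpow s x : 0 < x -> {for x, continuous (@powR R ^~ s)}.
Proof.
move=> x0; apply: differentiable_continuous; apply/derivable1_diffP.
by have [] := is_derive1_powR s x0.
Qed.

(** The integrand is the derivative of the bounded function [- 1 / (1 + x^s)]; it serves as the
    comparison function for every power weight. *)
Let L1_logistic s : 0 < s ->
  L1 leb (fun x => s * x `^ (s - 1) * (1 + x `^ s) ^- 2 * pos x).
Proof.
move=> s0; have p x : 0 < 1 + x `^ s by rewrite ltr_pwDl // powR_ge0.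
apply: (@L1_FTC _ _ (fun x => - (1 + x `^ s)^-1) 1).
- apply: measurable_funM; first by apply: measurable_funM => //; exact: measurable_powR.
  apply: measurable_invpow => [|x]; last exact: ltW.
  by apply: measurable_funD => //; exact: measurable_powR.
- move=> x x0; have h := is_derive1_powR s x0.
  have h1 : is_derive x 1 (fun x => 1 + x `^ s) (s * x `^ (s - 1)).
    by have := is_deriveD (is_derive_cst (1 : R) x 1) h; rewrite add0r.
  have h2 := @is_deriveV _ (fun x => 1 + x `^ s) x _ 1 (lt0r_neq0 (p x)) h1.
  by apply: is_derive_eq; rewrite /GRing.scale /=; ring.
- move=> x x0; apply: cvgM; first by apply: cvgM; [exact: cvg_cst|exact: cpow].
  apply: cvgV; first by rewrite expf_neq0 // gt_eqF.
  by apply: cvgM; apply: cvgD; [exact: cvg_cst|exact: cpow|exact: cvg_cst|exact: cpow].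
- by move=> x _; rewrite !mulr_ge0 ?powR_ge0 ?(ltW s0) // invr_ge0 exprn_ge0 // ltW.
- move=> x _; rewrite normrN ger0_norm ?invr_ge0 ?(ltW (p x)) //.
  by rewrite invf_le1 // lerDl powR_ge0.
Qed.

(** The bound [1 + x^s <= 2 (1 + x^r)^M], squared, reduces the claim to [L1_logistic]; hence the
    exponent [2 * M]. *)
Lemma L1_pow_decay r s (M N : nat) : 0 < r -> 0 < s -> s / r <= M%:R -> (2 * M <= N)%N ->
  L1 leb (fun x => `|x| `^ (s - 1) * (1 + `|x| `^ r) ^- N).
Proof.
move=> r0 s0 sM MN; pose f x := x `^ (s - 1) * (1 + x `^ r) ^- N.
have p q x : 0 < 1 + x `^ q by rewrite ltr_pwDl // powR_ge0.
have mf : measurable_fun [set: measurableTypeR R] f.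
  apply: measurable_funM; first exact: measurable_powR.
  apply: measurable_invpow => [|x]; last exact: ltW.
  by apply: measurable_funD => //; exact: measurable_powR.
suff i1 : L1 leb (fun x => f x * pos x) by have [] := half_line_even mf i1.
apply: L1_le _ _ (L1Z (4 / s) (L1_logistic s0)).
  by apply: measurable_funM => //; exact: measurable_pos.
move=> x; rewrite /pos; have [x0|x0] := ltP 0 x; last by rewrite !mulr0 normr0.
rewrite !mulr1 ger0_norm; last by rewrite mulr_ge0 ?powR_ge0 // invr_ge0 exprn_ge0 // ltW.
have -> : 4 / s * (s * x `^ (s - 1) * (1 + x `^ s) ^- 2) = x `^ (s - 1) * (4 * (1 + x `^ s) ^- 2).
  by field; rewrite !gt_eqF.
rewrite ler_wpM2l ?powR_ge0 // -ler_pdivrMl // mulrC -invrM ?unitfE ?expf_neq0 ?gt_eqF //.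
rewrite lef_pV2 ?posrE ?mulr_gt0 ?exprn_gt0 //.
have u1 : 1 <= 1 + x `^ r by rewrite lerDl powR_ge0.
have h : 1 + x `^ s <= 2 * (1 + x `^ r) ^+ M.
  have := powR_le_pow r0 (ltW s0) sM (ltW x0); have := exprn_ege1 M u1; lra.
apply: (@le_trans _ _ ((2 * (1 + x `^ r) ^+ M) ^+ 2)).
  by rewrite lerXn2r ?nnegrE ?mulr_ge0 ?exprn_ge0 ?(ltW (p _ _)).
have -> : (2 * (1 + x `^ r) ^+ M) ^+ 2 = 4 * (1 + x `^ r) ^+ (2 * M).
  by rewrite exprMn -exprM mulnC; congr (_ * _); rewrite expr2 -natrM.
by rewrite ler_wpM2l // ler_weXn2l.
Qed.

Definition gfun r s z x := `|x| `^ (s - 1) * expR (- (z * `|x| `^ r)).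

(** Classically [(2/r) Gamma(s/r) z^(-s/r)]. It is handled through its positivity, its recurrence in
    [s] and its scaling in [z]; the properties of [Gamma] are the case [r = z = 1]. *)
Definition gweight r s z := rint leb (gfun r s z).

Lemma measurable_gauss r z : measurable_fun [set: measurableTypeR R] (fun x : R => expR (- (z * `|x| `^ r))).
Proof.
apply: (@measurableT_comp _ _ _ _ _ _ (@expR R)) => //.
by apply: measurableT_comp => //; apply: measurable_funM => //; exact: measurable_absp.
Qed.

Lemma L1_gfun r s z : 0 < r -> 0 < s -> 0 < z -> L1 leb (gfun r s z).
Proof.
move=> r0 s0 z0; have sM : s / r <= (Num.bound (s / r))%:R.
  by apply/ltW/archi_boundP; rewrite divr_ge0 ?ltW.
have [C [C0 hC]] := pow_le_expR (2 * Num.bound (s / r)) z0.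
apply: L1_le _ _ (L1Z C (L1_pow_decay r0 s0 sM (leqnn _))).
  by apply: measurable_funM; [exact: measurable_absp|exact: measurable_gauss].
move=> x; rewrite /gfun ger0_norm; last by rewrite mulr_ge0 ?powR_ge0 ?expR_ge0.
rewrite mulrCA ler_wpM2l ?powR_ge0 // expRN.
rewrite ler_pdivlMr; last by rewrite exprn_gt0 // ltr_pwDl // powR_ge0.
by rewrite ler_pdivrMl ?expR_gt0 // [leRHS]mulrC; exact: hC (powR_ge0 _ _).
Qed.

Let powR_seq_cvg0 s : 0 < s -> (fun n : nat => n.+2%:R^-1 `^ s : R) @ \oo --> (0 : R).
Proof.
move=> s0; have /cvg_at_rightP := @powR_cvg0 R s s0; apply; split.
  by move=> n; rewrite invr_gt0 ltr0n.
have h : (fun n : nat => n.+1%:R^-1 : R) @ \oo --> (0 : R) by exact: cvg_harmonic.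
by move: h; rewrite -(cvg_shiftS (fun n : nat => n.+1%:R^-1 : R)).
Qed.

(** Integration by parts: the derivative of [x^s exp(-z x^r)] has integral [0] over the
    half-line. *)
Lemma gweight_rec r s z : 0 < r -> 0 < s -> 0 < z ->
  s * gweight r s z = z * r * gweight r (s + r) z.
Proof.
move=> r0 s0 z0; have sr0 : 0 < s + r by rewrite addr_gt0.
pose g q x := x `^ (q - 1) * expR (- (z * x `^ r)).
have mE : measurable_fun [set: measurableTypeR R] (fun x => expR (- (z * x `^ r))).
  apply: (@measurableT_comp _ _ _ _ _ _ (@expR R)) => //.
  by apply: measurableT_comp => //; apply: measurable_funM => //; exact: measurable_powR.
have mg q : measurable_fun [set: measurableTypeR R] (g q).
  by apply: measurable_funM => //; exact: measurable_powR.
have ig q : 0 < q -> L1 leb (fun x => g q x * pos x).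
  move=> q0; have h : L1 leb (fun x => gfun r q z x * pos x).
    apply: (L1M_bounded (k := 1) (L1_gfun r0 q0 z0)); first exact: measurable_pos.
    by move=> x; rewrite /pos; case: (_ < _); rewrite ?normr1 ?normr0.
  apply: L1_ext h => x.
  rewrite /pos /g /gfun; have [x0|x0] := ltP 0 x; last by rewrite !mulr0.
  by rewrite gtr0_norm.
have gE q : 0 < q -> gweight r q z = 2 * rint leb (fun x => g q x * pos x).
  by move=> q0; have [_ <-] := half_line_even (mg q) (ig q q0).
pose f x := s * g s x + (- (z * r)) * g (s + r) x.
pose F x := x `^ s * expR (- (z * x `^ r)).
have i1 := L1Z s (ig s s0); have i2 := L1Z (- (z * r)) (ig _ sr0).
have iF : L1 leb (fun x => f x * pos x).
  by apply: L1_ext (L1D i1 i2) => x; rewrite /f; ring.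
have h : rint leb (fun x => f x * pos x) = 0 - 0.
  apply: (rint_FTC (F := F)) => //.
  - move=> x x0; have h1 := is_derive1_powR s x0; have h2 := is_derive1_powR r x0.
    have h3 : is_derive x 1 (fun x => - (z * x `^ r)) (- (z * (r * x `^ (r - 1)))).
      by apply: is_derive_eq.
    have h4 : is_derive x 1 (fun x => expR (- (z * x `^ r)))
        (expR (- (z * x `^ r)) * - (z * (r * x `^ (r - 1)))).
      exact: (@is_derive1_comp _ (@expR R) (fun x => - (z * x `^ r))).
    apply: is_derive_eq; rewrite /GRing.scale /= /f /g.
    have -> : x `^ (s + r - 1) = x `^ s * x `^ (r - 1).
      have -> : s + r - 1 = s + (r - 1) by ring.
      by apply: powRD; rewrite (gt_eqF x0) implybT.
    by ring.
  - move=> x x0; have ce : {for x, continuous (fun x => expR (- (z * x `^ r)))}.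
      apply: (@continuous_comp _ _ _ (fun x : R => - (z * x `^ r)) (@expR R)).
        by apply: cvgN; apply: cvgM; [exact: cvg_cst|exact: cpow].
      exact: continuous_expR.
    by apply: cvgD; apply: cvgM; try exact: cvg_cst; apply: cvgM => //; exact: cpow.
  - apply: (@squeeze_cvgr _ _ _ _ (cst 0) (fun n : nat => n.+2%:R^-1 `^ s)) => //;
      [|exact: cvg_cst|exact: powR_seq_cvg0].
    apply: nearW => n; rewrite /F mulr_ge0 ?powR_ge0 ?expR_ge0 //=.
    by rewrite ler_piMr ?powR_ge0 // -expR0 ler_expR oppr_le0 mulr_ge0 ?powR_ge0 // ltW.
  - pose M := Num.bound (s / r).
    have sM : s / r <= M%:R by apply/ltW/archi_boundP; rewrite divr_ge0 ?ltW.
    have [C [C0 hC]] := pow_le_expR M.+1 z0.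
    have lim : (fun n : nat => C * n.+2%:R^-1 `^ r) @ \oo --> (C * 0 : R).
      by apply: cvgMr; exact: powR_seq_cvg0.
    rewrite mulr0 in lim.
    apply: (@squeeze_cvgr _ _ _ _ (cst 0) (fun n : nat => C * n.+2%:R^-1 `^ r)) => //;
      last exact: cvg_cst.
    apply: nearW => n; rewrite /F mulr_ge0 ?powR_ge0 ?expR_ge0 //=.
    set x : R := n.+2%:R; have x0 : 0 < x by rewrite ltr0n.
    have xr0 : 0 < x `^ r by rewrite powR_gt0.
    have -> : x^-1 `^ r = (x `^ r)^-1.
      by rewrite -powR_inv1 ?(ltW x0) // -powRrM mulrC powRrM powR_inv1 // powR_ge0.
    rewrite expRN ler_pdivlMr // mulrAC ler_pdivrMr ?expR_gt0 //.
    apply: le_trans (hC _ (ltW xr0)); rewrite exprSr.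
    apply: ler_pM; rewrite ?powR_ge0 //; last by rewrite lerDr.
    by apply: powR_le_pow => //; exact: ltW.
move: h; rewrite subr0.
have -> : rint leb (fun x => f x * pos x) =
    rint leb (fun x => s * (g s x * pos x) + - (z * r) * (g (s + r) x * pos x)).
  by apply: rint_ext => x; rewrite /f; ring.
rewrite rintD // !rintZ //; [|exact: ig|exact: ig].
by rewrite (gE s) // (gE (s + r)) // => h; lra.
Qed.

Lemma gweight_scale r s z : 0 < r -> 0 < s -> 0 < z ->
  gweight r s z = z `^ (- (s / r)) * gweight r s 1.
Proof.
move=> r0 s0 z0; pose c := z `^ r^-1; have c0 : 0 < c by rewrite powR_gt0.
have ge0 u x : 0 <= gfun r s u x by rewrite mulr_ge0 ?powR_ge0 ?expR_ge0.
have mg u : measurable_fun [set: measurableTypeR R] (gfun r s u).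
  by apply: measurable_funM; [exact: measurable_absp|exact: measurable_gauss].
have cr : c `^ r = z by rewrite -powRrM mulVf ?gt_eqF // powRr1 // ltW.
have E x : gfun r s 1 (c * x) = c `^ (s - 1) * gfun r s z x.
  rewrite /gfun normrM (gtr0_norm c0) !powRM ?(ltW c0) // cr mul1r.
  by rewrite -mulrA.
have mg1 : measurable_fun [set: measurableTypeR R] (fun x => (gfun r s 1 x)%:E).
  by apply/measurable_EFinP; exact: mg.
have ge1 x : (0 <= (gfun r s 1 x)%:E)%E by rewrite lee_fin.
have h := ge0_integral_scale c0 mg1 ge1.
have : gweight r s 1 = c `^ s * gweight r s z.
  rewrite {1}/gweight /rint /Rintegral h.
  have -> : (\int[leb]_x (gfun r s 1 (c * x))%:E = \int[leb]_x (c `^ (s - 1) * gfun r s z x)%:E)%E.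
    by apply: eq_integral => x _; rewrite E.
  have i1 := L1Z (c `^ (s - 1)) (L1_gfun r0 s0 z0).
  rewrite fineM //; last exact: integrable_fin_num i1.
  rewrite -[fine (\int[leb]_x _)%E]/(rint leb (fun x => c `^ (s - 1) * gfun r s z x)).
  rewrite rintZ; last exact: L1_gfun.
  by rewrite mulrA /= mulr_powRB1 // ltW.
move=> ->; rewrite mulrA.
have -> : z `^ (- (s / r)) * c `^ s = 1.
  rewrite /c -powRrM [r^-1 * s]mulrC -powRD ?addNr ?powRr0 //.
  by rewrite (gt_eqF z0) implybT.
by rewrite mul1r.
Qed.

Lemma gweight_gt0 r s z : 0 < r -> 0 < s -> 0 < z -> 0 < gweight r s z.
Proof.
(* The integrand is bounded below on [[1, 2]]; the [2^-1] bounds [x^(s-1)] also when [s < 1], since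
   [x^s >= 1] and [x <= 2]. *)
move=> r0 s0 z0; pose k := 2^-1 * expR (- (z * 2 `^ r)).
pose I : set (measurableTypeR R) := `[1, 2]%classic.
have k0 : 0 < k by rewrite mulr_gt0 ?expR_gt0.
have Ie : (\int[leb]_x (\1_I x)%:E = 1)%E.
  rewrite integral_indic //; last exact: measurable_itv.
  rewrite setIT; transitivity (leb (`[1%R, 2%R]%classic : set (measurableTypeR R))) => //.
  by rewrite lebesgue_measure_itv /= lte_fin ltr1n -EFinB; congr (_%:E); ring.
have iI : L1 leb (\1_I : R -> R).
  apply/integrableP; split.
    by apply/measurable_EFinP; apply: measurable_indic; exact: measurable_itv.
  have -> : (\int[leb]_x `|(EFin \o (\1_I : R -> R)) x| = \int[leb]_x (\1_I x)%:E)%E.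
    by apply: eq_integral => x _; rewrite /= ger0_norm // indicE.
  by rewrite Ie ltry.
apply: (@lt_le_trans _ _ (rint leb (fun x => k * \1_I x))).
  rewrite rintZ // /rint /Rintegral Ie /= mulr1.
  exact: k0.
apply: rint_le; [exact: L1Z|exact: L1_gfun|move=> x].
rewrite indicE; case: (boolP (x \in I)) => [|_]; last first.
  by rewrite mulr0 mulr_ge0 ?powR_ge0 ?expR_ge0.
rewrite mem_setE in_itv /= => /andP[x1 x2]; have x0 : 0 < x by lra.
rewrite mulr1 /k /gfun gtr0_norm //; apply: ler_pM; rewrite ?expR_ge0 //.
  have := mulr_powRB1 (ltW x0) s0; have : 1 <= x `^ s.
    by rewrite -(powRr0 x) ler_powR // ltW.
  have := powR_ge0 x (s - 1); nra.
by rewrite ler_expR lerN2 ler_wpM2l ?(ltW z0) // ge0_ler_powR ?nnegrE // ltW.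
Qed.

Lemma GammaE s : 0 < s -> Gamma s = gweight 1 s 1 / 2.
Proof.
move=> s0; pose g x := x `^ (s - 1) * expR (- x).
have mg : measurable_fun [set: measurableTypeR R] g.
  apply: measurable_funM; first exact: measurable_powR.
  by apply: (@measurableT_comp _ _ _ _ _ _ (@expR R)) => //; exact: oppr_measurable.
have E x : gfun 1 s 1 x = g `|x|.
  by rewrite /gfun /g powRr1 // mul1r.
have ig : L1 leb (fun x => g x * pos x).
  have h : L1 leb (fun x => gfun 1 s 1 x * pos x).
    apply: (L1M_bounded (k := 1) (L1_gfun ltr01 s0 ltr01)); first exact: measurable_pos.
    by move=> x; rewrite /pos; case: (_ < _); rewrite ?normr1 ?normr0.
  apply: L1_ext h => x; rewrite E /pos; have [x0|x0] := ltP 0 x; last by rewrite !mulr0.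
  by rewrite gtr0_norm.
have [_ h] := half_line_even mg ig.
have -> : gweight 1 s 1 = rint leb (fun x => g `|x|) by exact: rint_ext.
rewrite h mulrC mulKf ?pnatr_eq0 //.
rewrite /Gamma Rintegral_mkcond; apply: rint_ext => x.
rewrite /patch mem_setE in_itv /= andbT /pos; case: ifP => _; first by rewrite mulr1.
by rewrite mulr0.
Qed.

Lemma Gamma_gt0 s : 0 < s -> 0 < Gamma s.
Proof. by move=> s0; rewrite GammaE // divr_gt0 // gweight_gt0. Qed.

Lemma GammaS s : 0 < s -> Gamma (s + 1) = s * Gamma s.
Proof.
move=> s0; rewrite !GammaE ?addr_gt0 //.
have := gweight_rec ltr01 s0 ltr01; rewrite !mul1r => <-.
by rewrite mulrA.
Qed.

End Weights.

(** * The Bessel kernel as an entire function of the squared variable *)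

Section Bessel.
Context {R : realType}.
Implicit Types (b e x y z nu : R).

Fixpoint poch b (m : nat) : R := if m is m'.+1 then poch b m' * (b + m'%:R) else 1.

Lemma poch_gt0 b m : 0 < b -> 0 < poch b m.
Proof.
by move=> b0; elim: m => //= m IH; rewrite mulr_gt0 // ltr_wpDr.
Qed.

Definition bcoef b (m : nat) : R := (-1) ^+ m / (m`!%:R * poch b m).

(** The hypergeometric function [0F1(; b; -y)]. One has [j_nu(z) = bessel (nu + 1) ((z/2)^2)], and
    in this variable the differential equation has the form required by the energy estimate. *)
Definition bessel b y : R := limn (pseries (bcoef b) y).

Lemma factS_neq0 m : m`!%:R != 0 :> R.
Proof. by rewrite pnatr_eq0 -lt0n fact_gt0. Qed.

Lemma bcoefS b m : 0 < b -> m.+1%:R * (b + m%:R) * bcoef b m.+1 = - bcoef b m.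
Proof.
move=> b0; have p0 := lt0r_neq0 (poch_gt0 m b0).
have bm : b + m%:R != 0 by rewrite gt_eqF // ltr_wpDr.
rewrite /bcoef exprS factS natrM /=; field.
by rewrite p0 bm factS_neq0 /= nat1r pnatr_eq0.
Qed.

Lemma sum_exp_le x n : 0 <= x -> \sum_(i < n) x ^+ i / i`!%:R <= expR x.
Proof.
move=> x0; rewrite -(big_mkord xpredT (fun i => x ^+ i / i`!%:R)).
have h : nondecreasing_seq (series (exp_coeff x)).
  by apply/nondecreasing_seqP => k; rewrite /series /= big_nat_recr //= lerDl exp_coeff_ge0.
by have := nondecreasing_cvgn_le h (is_cvg_series_exp_coeff x) n.
Qed.

Lemma exp_term_le x n : 0 <= x -> x ^+ n / n`!%:R <= expR x.
Proof.
move=> x0; apply: le_trans (sum_exp_le n.+1 x0); rewrite big_ord_recr /= lerDr.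
by apply: sumr_ge0 => i _; rewrite divr_ge0 ?exprn_ge0.
Qed.

(* The factor [poch b m] of the denominator beats every geometric sequence. *)
Lemma bcoef_le b e m : 2^-1 <= b -> 0 < e -> `|bcoef b m| <= expR (2 / e) * (e ^+ m / m`!%:R).
Proof.
move=> hb e0; have b0 : 0 < b by lra.
have p0 := poch_gt0 m b0.
have f0 : 0 < m`!%:R :> R by rewrite ltr0n fact_gt0.
have h : m`!%:R <= 2 ^+ m * poch b m.
  elim: m {p0 f0} => [|m IH]; first by rewrite expr0 mul1r.
  have -> : 2 ^+ m.+1 * poch b m.+1 = (2 * (b + m%:R)) * (2 ^+ m * poch b m).
    by rewrite exprS /=; ring.
  rewrite factS natrM; apply: ler_pM => //; rewrite -natr1.
  by have : 0 <= m%:R :> R by []; lra.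
rewrite /bcoef normrM normrX normrN1 expr1n mul1r ger0_norm ?invr_ge0 ?mulr_ge0 ?(ltW p0) //.
rewrite invfM [m`!%:R^-1 * _]mulrC mulrA ler_pM2r ?invr_gt0 //.
have e1 := exp_term_le m (ltW (divr_gt0 (ltr0Sn R 1) e0)).
apply: le_trans (ler_wpM2r (exprn_ge0 _ (ltW e0)) e1).
rewrite -[leRHS]mulrA [_^-1 * _]mulrC mulrA -exprMn divfK ?gt_eqF //.
by rewrite ler_pdivlMr // mulrC ler_pdivrMr.
Qed.

Lemma cvg_pseries_fact (c : nat -> R) (C : R) x :
  (forall m, `|c m| <= C / m`!%:R) -> cvgn (pseries c x).
Proof.
move=> hc; apply: normed_cvg.
apply: (@series_le_cvg _ _ (fun i => C * exp_coeff `|x| i)) => [n|n|n|] //.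
- exact: normr_ge0.
- have C0 : 0 <= C by have := le_trans (normr_ge0 _) (hc 0); rewrite fact0 divr1.
  by rewrite mulr_ge0 // exp_coeff_ge0.
- rewrite /= normrM normrX /exp_coeff /= mulrA mulrAC ler_wpM2r ?exprn_ge0 //.
- apply: is_cvg_seriesZ; exact: is_cvg_series_exp_coeff.
Qed.

Section Ode.
Variable b : R.
Hypothesis hb : 2^-1 <= b.

(** As [(m+1) / (m+1)! = 1 / m!], a bound of this form survives formal differentiation, so the same
    constant serves the series and its three derivatives. *)
Let c0 m : `|bcoef b m| <= expR 2 / m`!%:R.
Proof. by have := bcoef_le m hb ltr01; rewrite divr1 expr1n mul1r. Qed.

Let fE m : m.+1%:R / (m.+1)`!%:R = (m`!%:R)^-1 :> R.
Proof.
by rewrite factS natrM invfM mulrA divff ?mul1r // pnatr_eq0.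
Qed.

Let c1 m : `|pseries_diffs (bcoef b) m| <= expR 2 / m`!%:R.
Proof.
rewrite /pseries_diffs normrM normr_nat.
by apply: le_trans (ler_wpM2l _ (c0 m.+1)) _ => //; rewrite mulrCA fE.
Qed.

Let c2 m : `|pseries_diffs (pseries_diffs (bcoef b)) m| <= expR 2 / m`!%:R.
Proof.
rewrite {1}/pseries_diffs normrM normr_nat.
by apply: le_trans (ler_wpM2l _ (c1 m.+1)) _ => //; rewrite mulrCA fE.
Qed.

Let c3 m : `|pseries_diffs (pseries_diffs (pseries_diffs (bcoef b))) m| <= expR 2 / m`!%:R.
Proof.
rewrite {1}/pseries_diffs normrM normr_nat.
by apply: le_trans (ler_wpM2l _ (c2 m.+1)) _ => //; rewrite mulrCA fE.
Qed.

Lemma cvg_bessel y : pseries (bcoef b) y @ \oo --> bessel b y.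
Proof. by have h := @cvg_pseries_fact _ _ y c0; exact: h. Qed.

Let J1 y := limn (pseries (pseries_diffs (bcoef b)) y).
Let J2 y := limn (pseries (pseries_diffs (pseries_diffs (bcoef b))) y).

Let dJ y : is_derive y 1 (bessel b) (J1 y).
Proof.
apply: (@pseries_snd_diffs _ _ (`|y| + 1)).
- exact: (@cvg_pseries_fact _ _ _ c0).
- exact: (@cvg_pseries_fact _ _ _ c1).
- exact: (@cvg_pseries_fact _ _ _ c2).
- by rewrite [ltRHS]ger0_norm ?addr_ge0 // ltrDl.
Qed.

Let dJ1 y : is_derive y 1 J1 (J2 y).
Proof.
apply: (@pseries_snd_diffs _ _ (`|y| + 1)).
- exact: (@cvg_pseries_fact _ _ _ c1).
- exact: (@cvg_pseries_fact _ _ _ c2).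
- exact: (@cvg_pseries_fact _ _ _ c3).
- by rewrite [ltRHS]ger0_norm ?addr_ge0 // ltrDl.
Qed.

Lemma continuous_bessel : continuous (bessel b).
Proof.
move=> y; apply: differentiable_continuous; apply/derivable1_diffP.
by have [] := dJ y.
Qed.

(** The partial sums are taken with [n] terms for the second derivative and [n.+1] for the others,
    so that the recurrence of the coefficients makes their combination exactly [0] for every [n]. *)
Lemma bessel_ode y : y * J2 y + b * J1 y + bessel b y = 0.
Proof.
have b0 : 0 < b by apply: lt_le_trans hb; rewrite invr_gt0.
pose S0 := pseries (bcoef b) y.
pose S1 := pseries (pseries_diffs (bcoef b)) y.
pose S2 := pseries (pseries_diffs (pseries_diffs (bcoef b))) y.
have h0 : (fun n : nat => S0 n.+1) @ \oo --> bessel b y.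
  by rewrite (cvg_shiftS S0); exact: cvg_bessel.
have h1 : (fun n : nat => b * S1 n.+1) @ \oo --> b * J1 y.
  by apply: cvgMr; rewrite (cvg_shiftS S1); exact: (@cvg_pseries_fact _ _ _ c1).
have h2 : (fun n : nat => y * S2 n) @ \oo --> y * J2 y.
  by apply: cvgMr; exact: (@cvg_pseries_fact _ _ _ c2).
have h : (fun n : nat => y * S2 n + b * S1 n.+1 + S0 n.+1) @ \oo --> y * J2 y + b * J1 y + bessel b y.
  by apply: cvgD h0; apply: cvgD.
apply: (@cvg_unique _ (@Rhausdorff R) _ _ _ _ h).
have E n : y * S2 n + b * S1 n.+1 + S0 n.+1 = 0.
  rewrite /S0 /S1 /S2 /pseries /series /= !big_mkord.
  have -> : y * \sum_(k < n) pseries_diffs (pseries_diffs (bcoef b)) k * y ^+ k =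
      \sum_(k < n.+1) k%:R * (k.+1%:R * bcoef b k.+1 * y ^+ k).
    rewrite big_ord_recl mul0r add0r mulr_sumr; apply: eq_bigr => k _.
    by rewrite /pseries_diffs lift0 exprS; ring.
  rewrite mulr_sumr -!big_split big1 //= => k _.
  transitivity ((k.+1%:R * (b + k%:R) * bcoef b k.+1 + bcoef b k) * y ^+ k).
    by rewrite /pseries_diffs; ring.
  by rewrite bcoefS // addNr mul0r.
have -> : (fun n => y * S2 n + b * S1 n.+1 + S0 n.+1) = cst 0 by exact/funext.
exact: cvg_cst.
Qed.

Lemma bessel0 : bessel b 0 = 1.
Proof.
rewrite /bessel; apply/(@cvg_lim _ (@Rhausdorff R)).
apply: cvg_near_cst; near=> n.
have n0 : (0 < n)%N by near: n; exact: nbhs_infty_gt.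
rewrite /pseries /series /= big_mkord; apply/eqP.
rewrite (bigD1 (Ordinal n0)) //= expr0 mulr1 big1 ?addr0.
  by rewrite /bcoef expr0 fact0 /= mulr1 divr1.
by move=> i i0; rewrite expr0n -[_ == 0%N]/(i == Ordinal n0) (negbTE i0) mulr0.
Unshelve. all: by end_near. Qed.

(** The energy estimate with [c = 0] and [d = 1]: again [2^-1 <= b] is the condition. *)
Lemma bessel_le1 y : 0 <= y -> `|bessel b y| <= 1.
Proof.
move=> y0; have -> : (1 : R) = `|bessel b 0| by rewrite bessel0 normr1.
apply: (@ode_energy_bound _ (bessel b) J1 J2 b 0 1) => // x x0.
by rewrite mul0r addr0 mul1r; exact: bessel_ode.
Qed.

End Ode.

Lemma Gamma_poch b m : 0 < b -> Gamma (b + m%:R) = Gamma b * poch b m.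
Proof.
move=> b0; elim: m => [|m IH]; first by rewrite addr0 mulr1.
by rewrite -natr1 addrA GammaS ?IH /=; [ring|rewrite ltr_wpDr].
Qed.

Lemma jbesselE nu z : - (2^-1 : R) <= nu -> jbessel nu z = bessel (nu + 1) ((z / 2) ^+ 2).
Proof.
move=> hnu; have hb : 2^-1 <= nu + 1 by lra.
have b0 : 0 < nu + 1 by lra.
have G0 := Gamma_gt0 b0.
have h : Gamma (nu + 1) *
    limn (fun n : nat => (Gamma (nu + 1))^-1 * pseries (bcoef (nu + 1)) ((z / 2) ^+ 2) n) =
    bessel (nu + 1) ((z / 2) ^+ 2).
  have c : (fun n : nat => (Gamma (nu + 1))^-1 * pseries (bcoef (nu + 1)) ((z / 2) ^+ 2) n)
      @ \oo --> (Gamma (nu + 1))^-1 * bessel (nu + 1) ((z / 2) ^+ 2).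
    by apply: cvgMr; exact: cvg_bessel.
  rewrite (cvg_lim (@Rhausdorff R) c).
  by rewrite mulrA divff ?mul1r // gt_eqF.
rewrite /jbessel -h; congr *%R; congr (lim (_ @ \oo)); apply/funext => n.
rewrite /pseries /series /= mulr_sumr; apply: eq_bigr => m _.
have -> : nu + m%:R + 1 = nu + 1 + m%:R by ring.
rewrite Gamma_poch // /bcoef exprM; have p0 := lt0r_neq0 (poch_gt0 m b0).
by field; rewrite p0 factS_neq0 /= gt_eqF.
Qed.

End Bessel.

(** * Bessel transform of a Gaussian *)

Section GaussTransform.
Context {R : realType}.
Local Notation leb := (@lebesgue_measure R).
Implicit Types (r s y z : R).

(** Addition of exponents for powers of [|x|] can fail at [x = 0], so such integrands are compared
    off the origin. *)
Lemma rint_off0 (f g : R -> R) : (forall x : R, x != 0 -> f x = g x) ->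
  measurable_fun [set: measurableTypeR R] f -> measurable_fun [set: measurableTypeR R] g ->
  rint leb f = rint leb g.
Proof.
move=> fg mf mg; rewrite /rint /Rintegral; congr fine.
apply: ae_eq_integral => //; try exact/measurable_EFinP.
exists [set 0]; split; [exact: measurable_set1|exact: lebesgue_measure_set1|].
move=> x /= h; apply/eqP/negPn/negP => x0; apply: h => _.
by rewrite /= fg.
Qed.

Lemma L1_powM_gfun r s z m : 0 < r -> 0 < s -> 0 < z ->
  L1 leb (fun x => (`|x| `^ r) ^+ m * gfun r s z x).
Proof.
move=> r0 s0 z0; have z2 : 0 < z / 2 by rewrite divr_gt0.
have [C [C0 hC]] := pow_le_expR m z2.
apply: L1_le _ _ (L1Z C (L1_gfun r0 s0 z2)) => [|x].
  apply: measurable_funM; last exact: L1_measurable (L1_gfun r0 s0 z0).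
  by apply: measurable_funX; exact: measurable_absp.
have X0 := powR_ge0 `|x| r; rewrite /gfun; move: (`|x| `^ r) X0 => X X0.
rewrite ger0_norm ?mulr_ge0 ?exprn_ge0 ?powR_ge0 ?expR_ge0 //.
have E : expR (- (z * X)) = expR (- (z / 2 * X)) * expR (- (z / 2 * X)).
  by rewrite -expRD; congr expR; field.
have h : X ^+ m * expR (- (z / 2 * X)) <= C.
  rewrite expRN ler_pdivrMr ?expR_gt0 //; apply: le_trans (hC X X0).
  by apply: lerXn2r; rewrite ?nnegrE ?addr_ge0 // lerDr.
rewrite E [leLHS](_ : _ = X ^+ m * expR (- (z / 2 * X)) * (`|x| `^ (s - 1) * expR (- (z / 2 * X)))).
  by rewrite ler_wpM2r // mulr_ge0 ?powR_ge0 ?expR_ge0.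
by ring.
Qed.

Lemma rint_powM_gfun r s z m : 0 < r -> 0 < s -> 0 < z ->
  rint leb (fun x => (`|x| `^ r) ^+ m * gfun r s z x) = gweight r s z * poch (s / r) m * z ^- m.
Proof.
move=> r0 s0 z0.
have sm0 j : 0 < s + r * j%:R by rewrite ltr_wpDr // mulr_ge0 // ltW.
have -> : rint leb (fun x => (`|x| `^ r) ^+ m * gfun r s z x) = gweight r (s + r * m%:R) z.
  apply: rint_off0.
  - move=> x x0; have ax : 0 < `|x| by rewrite normr_gt0.
    rewrite /gfun mulrA -powR_mulrn ?powR_ge0 // -powRrM -powRD; last by rewrite (gt_eqF ax) implybT.
    by congr (_ `^ _ * _); ring.
  - exact: L1_measurable (L1_powM_gfun _ r0 s0 z0).
  - exact: L1_measurable (L1_gfun r0 (sm0 m) z0).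
elim: m => [|m IH]; first by rewrite mulr0 addr0 expr0 invr1 !mulr1.
have E : s + r * m.+1%:R = s + r * m%:R + r by rewrite -natr1; ring.
have := gweight_rec r0 (sm0 m) z0; rewrite -E IH => h.
apply: (mulfI (lt0r_neq0 (mulr_gt0 z0 r0))); rewrite -h exprS /=.
by field; rewrite expf_neq0 ?(gt_eqF z0) ?(gt_eqF r0).
Qed.

(** Term by term, the Pochhammer symbol in the Gaussian moment of order [m] cancels the one in the
    Bessel coefficient, and what remains is the exponential series. *)
Lemma gauss_bessel r s z y : 0 < r -> 0 < s -> 2^-1 <= s / r -> 0 < z -> 0 <= y ->
  rint leb (fun x => bessel (s / r) (y * `|x| `^ r) * gfun r s z x) =
  gweight r s z * expR (- (y / z)).
Proof.
move=> r0 s0 hb z0 y0; set b := s / r in hb *.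
have b0 : 0 < b by apply: lt_le_trans hb; rewrite invr_gt0.
(* The rate in [bcoef_le] is chosen with [e * y <= z / 2]: the partial sums grow at most like
   [exp(z X / 2)] and half of the Gaussian is left as a dominating function. *)
pose e := z / (2 * (y + 1)).
have y1 : 0 < 2 * (y + 1) by lra.
have e0 : 0 < e by rewrite divr_gt0.
have ey : e * y <= z / 2.
  rewrite /e mulrAC ler_pdivrMr //.
  have -> : z / 2 * (2 * (y + 1)) = z * y + z by field.
  by rewrite lerDl ltW.
pose F n x := pseries (bcoef b) (y * `|x| `^ r) n * gfun r s z x.
have g0 u x : 0 <= gfun r s u x by rewrite mulr_ge0 ?powR_ge0 ?expR_ge0.
have FE n : F n = fun x => \sum_(m < n) (bcoef b m * y ^+ m) * ((`|x| `^ r) ^+ m * gfun r s z x).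
  apply/funext => x; rewrite /F /pseries /series /= big_mkord mulr_suml.
  by apply: eq_bigr => m _; rewrite exprMn; ring.
have LT m := L1Z (bcoef b m * y ^+ m) (L1_powM_gfun m r0 s0 z0).
have LF n : L1 leb (F n) by rewrite FE; exact: (@L1_sum _ _ _ leb n (fun m x =>
    bcoef b m * y ^+ m * ((`|x| `^ r) ^+ m * gfun r s z x)) LT).
have [||||_ h] := @rint_dct _ _ _ leb F (fun x => bessel b (y * `|x| `^ r) * gfun r s z x)
   (fun x => expR (2 / e) * gfun r s (z / 2) x).
- by move=> n; exact: L1_measurable (LF n).
- by move=> x; apply: cvgMl; exact: cvg_bessel.
- move=> n x; have X0 : 0 <= y * `|x| `^ r by rewrite mulr_ge0 ?powR_ge0.
  have hB : `|pseries (bcoef b) (y * `|x| `^ r) n| <= expR (2 / e) * expR (e * (y * `|x| `^ r)).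
    rewrite /pseries /series /= big_mkord; apply: le_trans (ler_norm_sum _ _ _) _.
    apply: le_trans (ler_wpM2l (expR_ge0 _) (sum_exp_le n (mulr_ge0 (ltW e0) X0))).
    rewrite mulr_sumr; apply: ler_sum => m _; rewrite normrM [X in _ * X]ger0_norm ?exprn_ge0 //.
    apply: le_trans (ler_wpM2r (exprn_ge0 _ X0) (bcoef_le m hb e0)) _.
    by rewrite (exprMn m e) -!mulrA [_^-1 * _]mulrC.
  rewrite /F normrM (ger0_norm (g0 _ _)); apply: le_trans (ler_wpM2r (g0 _ _) hB) _.
  rewrite -mulrA ler_wpM2l ?expR_ge0 // /gfun mulrCA ler_wpM2l ?powR_ge0 // -expRD ler_expR.
  have := ler_wpM2r (powR_ge0 `|x| r) ey; move: (`|x| `^ r) => X hX.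
  have -> : - (z / 2 * X) = z / 2 * X - z * X by field.
  by rewrite lerD2r mulrA.
- by apply: L1Z; apply: L1_gfun => //; rewrite divr_gt0.
have E n : rint leb (F n) = gweight r s z * series (exp_coeff (- (y / z))) n.
  rewrite FE (@rint_sum _ _ _ leb n (fun m x => bcoef b m * y ^+ m * ((`|x| `^ r) ^+ m * gfun r s z x))) //.
  rewrite /series /= big_mkord mulr_sumr; apply: eq_bigr => m _.
  rewrite rintZ ?rint_powM_gfun //; last exact: L1_powM_gfun.
  rewrite /bcoef /exp_coeff /= (exprNn (y / z)) (exprMn m y) (exprVn z) -/b; have := lt0r_neq0 (poch_gt0 m b0).
  have := factS_neq0 (R := R) m; have := expf_neq0 m (lt0r_neq0 z0).
  by move: (z ^+ m) (m`!%:R) (poch _ m) => Z M P Z0 M0 P0; field; rewrite M0 P0 Z0.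
apply: (@cvg_unique _ (@Rhausdorff R) _ _ _ _ h).
have -> : (fun n => rint leb (F n)) = (fun n => gweight r s z * series (exp_coeff (- (y / z))) n).
  exact/funext.
by apply: cvgMr; exact: is_cvg_series_exp_coeff.
Qed.

End GaussTransform.

(** * Hankel transforms and Parseval's identity against Gaussians *)

Section Hankel.
Context {R : realType}.
Local Notation leb := (@lebesgue_measure R).
Implicit Types (f g phi : R -> R) (r s z q b : R).

Lemma integral_rint d (T : measurableType d) (mu : {measure set T -> \bar R}) (f : T -> R) :
  L1 mu f -> (\int[mu]_x (f x)%:E = (rint mu f)%:E)%E.
Proof. by move=> hf; rewrite /rint /Rintegral fineK //; exact: integrable_fin_num. Qed.

Lemma fubini_L1 (K : R -> R -> R) f g : L1 leb f -> L1 leb g ->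
  measurable_fun [set: measurableTypeR R * measurableTypeR R] (fun p => K p.1 p.2) ->
  (forall x t, `|K x t| <= 1) ->
  L1 leb (fun t => g t * rint leb (fun x => f x * K x t)) /\
  rint leb (fun t => g t * rint leb (fun x => f x * K x t)) =
  rint leb (fun x => f x * rint leb (fun t => K x t * g t)).
Proof.
move=> hf hg mK K1; have mf := L1_measurable hf; have mg := L1_measurable hg.
pose h (p : measurableTypeR R * measurableTypeR R) : \bar R := (f p.1 * g p.2 * K p.1 p.2)%:E.
have mKx x : measurable_fun [set: measurableTypeR R] (K x).
  exact: measurableT_comp mK (pair1_measurable x).
have mKt t : measurable_fun [set: measurableTypeR R] (K ^~ t).
  exact: measurableT_comp mK (pair2_measurable t).
have mh : measurable_fun [set: measurableTypeR R * measurableTypeR R] h.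
  apply/measurable_EFinP; apply: measurable_funM => //; apply: measurable_funM.
    exact: measurableT_comp mf measurable_fst.
  exact: measurableT_comp mg measurable_snd.
have LK x : L1 leb (fun t => K x t * g t).
  by apply: L1_ext (L1M_bounded hg (mKx x) (K1 x)) => t; rewrite mulrC.
have LK' t : L1 leb (fun x => f x * K x t) by exact: L1M_bounded hf (mKt t) (K1 ^~ t).
have hx x : (\int[leb]_t h (x, t) = (f x * rint leb (fun t => K x t * g t))%:E)%E.
  rewrite -rintZ // -integral_rint; last exact: L1Z.
  by apply: eq_integral => t _; rewrite /h /=; congr EFin; ring.
have ht t : (\int[leb]_x h (x, t) = (g t * rint leb (fun x => f x * K x t))%:E)%E.
  rewrite -rintZ // -integral_rint; last exact: L1Z.
  by apply: eq_integral => x _; rewrite /h /=; congr EFin; ring.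
have hfin : (\int[leb]_x \int[leb]_t `|h (x, t)| < +oo)%E.
  apply: (@le_lt_trans _ _ (\int[leb]_x (`|f x| * rint leb (fun t => `|g t|))%:E)%E); last first.
    rewrite integral_rint ?ltry //.
    by apply: L1_ext (L1Z (rint leb (fun t => `|g t|)) (L1_norm hf)) => x; rewrite mulrC.
  have hb x : (\int[leb]_t `|h (x, t)| <= (`|f x| * rint leb (fun t => `|g t|))%:E)%E.
    rewrite -rintZ; last exact: L1_norm.
    rewrite -integral_rint; last by apply: L1Z; exact: L1_norm.
    apply: ge0_le_integral => //.
    - apply: measurableT_comp => //; exact: measurableT_comp mh (pair1_measurable x).
    - by apply/measurable_EFinP; apply: measurable_funM => //; exact: measurableT_comp.
    - by move=> t _; rewrite lee_fin !normrM ler_piMr // mulr_ge0.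
  apply: ge0_le_integral => //.
  - by move=> x _; exact: integral_ge0.
  - have m' : measurable_fun [set: measurableTypeR R * measurableTypeR R] (fun p => `|h p|%E).
      by apply: measurableT_comp => //.
    have H := @measurable_fun_fubini_tonelli_F _ _ _ _ _ leb (fun p => `|h p|%E) m' (fun p => abse_ge0 (h p)).
    exact H.
  - by apply/measurable_EFinP; apply: measurable_funM => //; exact: measurableT_comp.
have ih := (@integrable12ltyP _ _ _ _ R leb leb h mh).2 hfin.
have L : L1 leb (fun t => g t * rint leb (fun x => f x * K x t)).
  apply: L1_le _ _ (L1Z (rint leb (fun x => `|f x|)) (L1_norm hg)) => [|t].
    apply/measurable_EFinP; have := measurable_fubini_G ih; congr (measurable_fun _).
    by apply/funext => t; rewrite /fubini_G ht.
  rewrite normrM mulrC ler_wpM2r //; apply: rint_norm_le => //; first exact: L1_norm.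
  by move=> x; rewrite normrM ler_piMr.
split => //; have := Fubini ih.
under eq_integral do rewrite hx; under [in RHS]eq_integral do rewrite ht.
by rewrite /rint /Rintegral => ->.
Qed.

(** [phi] is meant to include the density of the measure, so the integral is against Lebesgue
    measure. The kernel is even in [x], hence only the even part of [phi] matters. *)
Definition hankel b r q phi (t : R) : R :=
  rint leb (fun x : R => phi x * bessel b (q * `|x| `^ r * `|t| `^ r)).

Section Parseval.
Variables (r s q : R) (phi : R -> R).
Hypotheses (r0 : 0 < r) (s0 : 0 < s) (hb : 2^-1 <= s / r) (q0 : 0 <= q).
Hypothesis Lphi : L1 leb phi.

Let K (x t : R) := bessel (s / r) (q * `|x| `^ r * `|t| `^ r).

Let mK : measurable_fun [set: measurableTypeR R * measurableTypeR R] (fun p => K p.1 p.2).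
Proof.
apply: (@measurableT_comp _ _ _ _ _ _ (bessel (s / r))).
  by apply: continuous_measurable_fun; exact: continuous_bessel.
apply: measurable_funM.
  apply: measurable_funM => //; exact: measurableT_comp (measurable_absp r) measurable_fst.
exact: measurableT_comp (measurable_absp r) measurable_snd.
Qed.

Let K1 x t : `|K x t| <= 1.
Proof. by apply: bessel_le1 => //; rewrite !mulr_ge0 ?powR_ge0. Qed.

Lemma hankel_parseval z : 0 < z ->
  L1 leb (fun t => gfun r s z t * hankel (s / r) r q phi t) /\
  rint leb (fun t => gfun r s z t * hankel (s / r) r q phi t) =
  gweight r s z * rint leb (fun x => phi x * expR (- (q * `|x| `^ r / z))).
Proof.
move=> z0; have [L E] := fubini_L1 Lphi (L1_gfun r0 s0 z0) mK K1; split => //.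
rewrite {}E -rintZ; last first.
  apply: (@L1M_bounded _ _ _ _ _ _ 1) => //.
    apply: (@measurableT_comp _ _ _ _ _ _ (@expR R)) => //; apply: measurableT_comp => //.
    by apply: measurable_funM => //; apply: measurable_funM => //; exact: measurable_absp.
  move=> x; rewrite ger0_norm ?expR_ge0 // -expR0 ler_expR oppr_le0.
  by rewrite !mulr_ge0 ?powR_ge0 ?invr_ge0 // ltW.
apply: rint_ext => x; rewrite gauss_bessel //; last by rewrite mulr_ge0 ?powR_ge0.
by ring.
Qed.

(** Fubini's theorem makes the product with a Gaussian integrable, hence measurable; dividing the
    Gaussian out gives the claim. *)
Lemma measurable_hankel : measurable_fun [set: measurableTypeR R] (hankel (s / r) r q phi).
Proof.
have [L _] := fubini_L1 Lphi (L1_gfun r0 ltr01 ltr01) mK K1.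
have -> : hankel (s / r) r q phi =
    fun t => expR (`|t| `^ r) * (gfun r 1 1 t * hankel (s / r) r q phi t).
  apply/funext => t; rewrite mulrA -[LHS]mul1r; congr (_ * _).
  by rewrite /gfun subrr powRr0 !mul1r -expRD addrN expR0.
apply: measurable_funM; last exact: L1_measurable L.
by apply: (@measurableT_comp _ _ _ _ _ _ (@expR R)) => //; exact: measurable_absp.
Qed.

End Parseval.

End Hankel.

(** * A common form for the norm conditions *)

Section Growth.
Context {R : realType}.
Local Notation leb := (@lebesgue_measure R).
Implicit Types (r s rho a : R) (G Phi : R -> R).

(** A constant plus an integrable function for the weight [|x|^(s-1)]. All exponents from [1] to
    infinity yield such a bound, called [tame]; a finite exponent allows an arbitrarily small
    constant, called [small], and this is the source of decay. *)
Definition dominated s G (M : R) := exists H : R -> R,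
  [/\ forall x, 0 <= H x, L1 leb (fun x : R => `|x| `^ (s - 1) * H x) & forall x, G x <= M + H x].

Definition tame s G := exists M : R, 0 <= M /\ dominated s G M.

Definition small s G := forall e : R, 0 < e -> dominated s G e.

Lemma small_tame s G : small s G -> tame s G.
Proof. by move=> /(_ 1 ltr01) h; exists 1. Qed.

Lemma powR_expR_bounded rho a : 0 <= rho -> 0 < a -> exists C : R, 0 <= C /\
  forall y, 0 <= y -> y `^ rho * expR (- (a * y)) <= C.
Proof.
move=> rho0 a0; have [C [C0 hC]] := pow_le_expR (Num.bound rho) a0.
exists C; split=> // y y0; rewrite expRN ler_pdivrMr ?expR_gt0 //.
apply: le_trans (hC y y0); rewrite -[X in (1 + X) ^+ _]powRr1 //.
by apply: powR_le_pow => //; rewrite divr1; apply/ltW/archi_boundP.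
Qed.

Section Bound.
Variables (r s rho C : R) (G Phi : R -> R).
Hypotheses (r0 : 0 < r) (s0 : 0 < s) (rho0 : 0 <= rho) (C0 : 0 <= C).
Hypothesis mPhi : measurable_fun [set: measurableTypeR R] Phi.
Hypothesis hPhi : forall x : R, `|Phi x| <= C * (`|x| `^ rho * (`|x| `^ (s - 1) * G x)).

Lemma tame_L1 a : 0 < a -> tame s G ->
  exists N : nat, L1 leb (fun x => `|Phi x| * (1 + a * `|x| `^ r) ^- N).
Proof.
move=> a0 [M [M0 [H [H0 LH GH]]]].
pose m1 := Num.bound (rho / r); pose m2 := Num.bound (s / r).
have h1 : rho / r <= m1%:R by apply/ltW/archi_boundP; rewrite divr_ge0 // ltW.
have h2 : s / r <= m2%:R by apply/ltW/archi_boundP; rewrite divr_ge0 ?ltW.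
(* The power [m1] absorbs the factor [|x|^rho], and [2 * m2] makes the constant [M] integrable
   against [|x|^(s-1)]. *)
pose N := (m1 + 2 * m2)%N; exists N.
pose c := Num.min 1 a; have c0 : 0 < c by rewrite lt_min ltr01.
have LP := L1_pow_decay r0 s0 h2 (leqnn (2 * m2)).
apply: L1_le _ _ (L1Z (C * c ^- N) (L1D (L1Z M LP) LH)).
  apply: measurable_funM; first exact: measurableT_comp.
  apply: measurable_invpow => [|x]; last by rewrite addr_ge0 // mulr_ge0 ?powR_ge0 // ltW.
  by apply: measurable_funD => //; apply: measurable_funM => //; exact: measurable_absp.
move=> x; have X0 := powR_ge0 `|x| r; have W0 := powR_ge0 `|x| (s - 1).
have hrho := powR_le_pow r0 rho0 h1 (normr_ge0 x).
have := hPhi x; have := GH x; have := H0 x.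
move: (`|x| `^ r) X0 (`|x| `^ (s - 1)) W0 (`|x| `^ rho) (powR_ge0 `|x| rho) hrho => X X0 W W0 P P0 hP Hx0 hG hx.
have X1 : 0 < 1 + X by rewrite ltr_pwDl.
have aX : 0 < 1 + a * X by rewrite ltr_pwDl // mulr_ge0 // ltW.
rewrite normrM normr_id (ger0_norm (x := _ ^- _)) ?invr_ge0 ?exprn_ge0 ?(ltW aX) //.
have cX : c * (1 + X) <= 1 + a * X.
  rewrite mulrDr mulr1 lerD ?ge_min ?lexx // ler_wpM2r // ge_min lexx orbT //.
have hN : (1 + a * X) ^- N <= c ^- N * ((1 + X) ^- m1 * (1 + X) ^- (2 * m2)).
  rewrite -invfM -exprD -/N -invfM -exprMn lef_pV2 ?posrE ?exprn_gt0 ?mulr_gt0 //.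
  by apply: lerXn2r; rewrite ?nnegrE ?mulr_ge0 // ltW.
have V1 : 0 <= (1 + X) ^- m1 by rewrite invr_ge0 exprn_ge0 // ltW.
have V2 : 0 <= (1 + X) ^- (2 * m2) by rewrite invr_ge0 exprn_ge0 // ltW.
have V3 : (1 + X) ^- (2 * m2) <= 1.
  by rewrite invf_le1 ?exprn_gt0 // exprn_ege1 // lerDl.
have PV : P * (1 + X) ^- m1 <= 1 by rewrite ler_pdivrMr ?exprn_gt0 // mul1r.
have hx' : `|Phi x| <= C * (P * (W * (M + H x))).
  by apply: le_trans hx _; rewrite !ler_wpM2l.
have c' : 0 <= c ^- N by rewrite invr_ge0 exprn_ge0 // ltW.
apply: le_trans (ler_pM _ _ hx' hN) _ => //; first by rewrite invr_ge0 exprn_ge0 // ltW.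
rewrite [leLHS](_ : _ = C * c ^- N * (P * (1 + X) ^- m1 * (W * (M + H x) * (1 + X) ^- (2 * m2)))); last by ring.
rewrite ler_wpM2l ?mulr_ge0 //.
apply: (@le_trans _ _ (W * (M + H x) * (1 + X) ^- (2 * m2))).
  by rewrite -[leRHS]mul1r ler_wpM2r // !mulr_ge0 // addr_ge0.
rewrite mulrDr mulrDl lerD //; last by rewrite -[leRHS]mulr1 ler_wpM2l // mulr_ge0.
by rewrite mulrA (mulrC W).
Qed.

Lemma tame_L1_expR c : 0 < c -> tame s G -> L1 leb (fun x => Phi x * expR (- (c * `|x| `^ r))).
Proof.
move=> c0 tG; have [N LN] := tame_L1 ltr01 tG; have [D [D0 hD]] := pow_le_expR N c0.
have mX := measurable_absp (R := R) r.
apply: L1_le _ _ (L1Z D LN) => [|x].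
  by apply: measurable_funM => //; exact: measurable_gauss.
have X0 := powR_ge0 `|x| r; have p0 : 0 < (1 + 1 * `|x| `^ r) ^+ N.
  by rewrite exprn_gt0 // ltr_pwDl // mul1r.
rewrite (normrM (Phi x)) (ger0_norm (expR_ge0 _)) mulrCA ler_wpM2l //.
by rewrite ler_pdivlMr // mulrC expRN ler_pdivrMr ?expR_gt0 // mul1r hD.
Qed.

(** In the integral at [u], the constant part of the bound contributes a multiple of [e] that is
    uniform in [u], because the scaling of the Gaussian weight compensates [u^(-s/r)]. The
    integrable part contributes [O(u^(-s/r))]. The factor [|x|^rho] costs [u^(rho/r)], which the
    index [(s + 2 rho) / r] covers. *)
Lemma small_decay a : 0 < a -> small s G ->
  (fun n : nat => lmom leb ((s + 2 * rho) / r) Phi (fun x => a * `|x| `^ r) 0 (1 + n%:R)) @ \oo --> (0 : R).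
Proof.
move=> a0 sG; have a2 : 0 < a / 2 by rewrite divr_gt0.
have [K [K0 hK]] := powR_expR_bounded (divr_ge0 rho0 (ltW r0)) a2.
set b := (s + 2 * rho) / r.
have hs := L1_gfun r0 s0.
have key e H u : 0 < e -> 1 <= u -> (forall x : R, 0 <= H x) ->
    L1 leb (fun x : R => `|x| `^ (s - 1) * H x) -> (forall x, G x <= e + H x) ->
    `|lmom leb b Phi (fun x => a * `|x| `^ r) 0 u| <=
    C * K * (e * (a / 2) `^ (- (s / r)) * gweight r s 1 +
       rint leb (fun x : R => `|x| `^ (s - 1) * H x) * u `^ (- (s / r))).
  move=> e0 u1 H0 LH GH; have u0 : 0 < u by apply: lt_le_trans u1.
  have au : 0 < a / 2 / u by rewrite divr_gt0.
  pose D x := C * K * u `^ (- (s / r)) * (e * gfun r s (a / 2 / u) x + `|x| `^ (s - 1) * H x).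
  have LD : L1 leb D by apply: L1Z; apply: L1D => //; apply: L1Z; exact: L1_gfun.
  have hD x : `|Phi x * kap b 0 u (a * `|x| `^ r)| <= D x.
    rewrite kap0E normrM (ger0_norm (x := _ * expR _)) ?mulr_ge0 ?powR_ge0 ?expR_ge0 //.
    have hx : `|Phi x| <= C * (`|x| `^ rho * (`|x| `^ (s - 1) * (e + H x))).
      by apply: le_trans (hPhi x) _; rewrite !ler_wpM2l ?powR_ge0.
    have E1 : `|x| `^ rho = u `^ (rho / r) * (`|x| `^ r / u) `^ (rho / r).
      rewrite -powRM ?(ltW u0) ?divr_ge0 ?powR_ge0 ?(ltW u0) //.
      by rewrite mulrCA divff ?(gt_eqF u0) // mulr1 -powRrM mulrC divfK // gt_eqF.
    have Y0 : 0 <= `|x| `^ r / u by rewrite divr_ge0 ?powR_ge0 // ltW.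
    have E2 : expR (- (a * `|x| `^ r / u)) =
        expR (- (a / 2 * (`|x| `^ r / u))) * expR (- (a / 2 / u * `|x| `^ r)).
      by rewrite -expRD; congr expR; field; rewrite gt_eqF.
    have E3 : u `^ (- b) * u `^ (rho / r) <= u `^ (- (s / r)).
      rewrite -powRD; last by rewrite (gt_eqF u0) implybT.
      rewrite ler_powR // /b.
      have -> : - ((s + 2 * rho) / r) + rho / r = - (s / r) - rho / r by field; rewrite gt_eqF.
      by rewrite lerBlDr lerDl divr_ge0 // ltW.
    apply: le_trans (ler_wpM2r (mulr_ge0 (powR_ge0 _ _) (expR_ge0 _)) hx) _.
    rewrite E1 E2.
    have W0 := powR_ge0 `|x| (s - 1); have hY := hK _ Y0.
    rewrite /D /gfun; have V1 := expR_ge0 (- (a / 2 / u * `|x| `^ r)).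
    have V2 : expR (- (a / 2 / u * `|x| `^ r)) <= 1.
      by rewrite -[leRHS]expR0 ler_expR oppr_le0 mulr_ge0 ?powR_ge0 // ltW.
    move: (expR (- (a / 2 / u * `|x| `^ r))) V1 V2 => V V1 V2.
    have U0 := powR_ge0 u (- (s / r)).
    have UU0 : 0 <= u `^ (- b) * u `^ (rho / r) by rewrite mulr_ge0 ?powR_ge0.
    have YY0 : 0 <= (`|x| `^ r / u) `^ (rho / r) * expR (- (a / 2 * (`|x| `^ r / u))).
      by rewrite mulr_ge0 ?powR_ge0 ?expR_ge0.
    have h := ler_pM UU0 YY0 E3 hY.
    apply: (@le_trans _ _ (C * (`|x| `^ (s - 1) * (e + H x)) * V * (u `^ (- (s / r)) * K))).
      rewrite [leLHS](_ : _ = C * (`|x| `^ (s - 1) * (e + H x)) * V *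
        (u `^ (- b) * u `^ (rho / r) * ((`|x| `^ r / u) `^ (rho / r) * expR (- (a / 2 * (`|x| `^ r / u)))))).
        by rewrite ler_wpM2l // !mulr_ge0 // addr_ge0 // ltW.
      by ring.
    rewrite [leLHS](_ : _ = C * K * u `^ (- (s / r)) * (`|x| `^ (s - 1) * (e + H x) * V)); last by ring.
    rewrite ler_wpM2l ?mulr_ge0 // mulrDr mulrDl lerD //.
      by rewrite (mulrC _ e) -mulrA.
    by rewrite -[leRHS]mulr1 ler_wpM2l // mulr_ge0.
  have mL : measurable_fun [set: measurableTypeR R] (fun x => Phi x * kap b 0 u (a * `|x| `^ r)).
    apply: measurable_funM => //; under eq_fun do rewrite kap0E.
    apply: measurable_funM => //; apply: (@measurableT_comp _ _ _ _ _ _ (@expR R)) => //.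
    apply: measurableT_comp => //; apply: measurable_funM => //; apply: measurable_funM => //.
    exact: measurable_absp.
  apply: le_trans (rint_norm_le (L1_le mL hD LD) LD hD) _.
  rewrite /D rintZ; last by apply: L1D => //; apply: L1Z; exact: L1_gfun.
  rewrite rintD //; last by apply: L1Z; exact: L1_gfun.
  rewrite rintZ; last exact: L1_gfun.
  rewrite -[rint leb (gfun _ _ _)]/(gweight r s (a / 2 / u)) gweight_scale //.
  rewrite powRM ?(ltW a2) ?invr_ge0 ?(ltW u0) //.
  have -> : u^-1 `^ (- (s / r)) = u `^ (s / r).
    by rewrite -[u^-1]powR_inv1 ?(ltW u0) // -powRrM mulN1r opprK.
  rewrite [leLHS](_ : _ = C * K * (e * (a / 2) `^ (- (s / r)) * gweight r s 1 *
     (u `^ (- (s / r)) * u `^ (s / r)) + rint leb (fun x => `|x| `^ (s - 1) * H x) * u `^ (- (s / r)))).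
    rewrite -powRD; last by rewrite (gt_eqF u0) implybT.
    by rewrite addNr powRr0 mulr1.
  by ring.
apply/cvgrPdist_le => e e0.
set g := (a / 2) `^ (- (s / r)) * gweight r s 1.
have g0 : 0 <= g by rewrite mulr_ge0 ?powR_ge0 // ltW // gweight_gt0.
pose d := e / 2 / (1 + C * K * g).
have CKg : 0 < 1 + C * K * g by apply: ltr_pwDl => //; exact: mulr_ge0 (mulr_ge0 C0 K0) g0.
have d0 : 0 < d by rewrite !divr_gt0.
have [H [H0 LH GH]] := sG d d0.
set I := rint leb (fun x : R => `|x| `^ (s - 1) * H x) in key *.
have hc : (fun n : nat => C * K * rint leb (fun x : R => `|x| `^ (s - 1) * H x) * (1 + n%:R) `^ (- (s / r))) @ \oo --> (0 : R).
  rewrite -(mulr0 (C * K * I)); apply: cvgMr.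
  have sr : 0 < s / r by rewrite divr_gt0.
  have -> : (fun n : nat => (1 + n%:R) `^ (- (s / r)) : R) = (fun n : nat => n.+1%:R^-1 `^ (s / r)).
    by apply/funext => n; rewrite nat1r -[n.+1%:R^-1]powR_inv1 // -powRrM mulN1r.
  have /cvg_at_rightP := @powR_cvg0 R _ sr; apply; split; last exact: cvg_harmonic.
  by move=> n; rewrite invr_gt0.
have hd : C * K * (d * g) <= e / 2.
  rewrite /d mulrCA mulrAC mulrC [X in X <= _](_ : _ = e / 2 * ((C * K * g) / (1 + C * K * g))); last by ring.
  rewrite -[leRHS]mulr1 ler_wpM2l ?divr_ge0 ?(ltW e0) // ler_pdivrMr // mul1r.
  by rewrite lerDr.
have e2 : 0 < e / 2 by rewrite divr_gt0.
have /cvgrPdist_le/(_ _ e2)[N _ hN] := hc.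
exists N => // n /= Nn; rewrite sub0r normrN.
apply: le_trans (key d H (1 + n%:R) d0 _ H0 LH GH) _; first by rewrite lerDl.
have := hN n Nn; rewrite sub0r normrN => h2.
have h3 := le_trans (ler_norm _) h2.
by rewrite mulrDr -[d * _ * _]mulrA -/g [e]splitr lerD // mulrA.
Qed.

End Bound.

End Growth.

(** * The uncertainty principle for one Hankel transform *)

Section HankelUncertainty.
Context {R : realType}.
Local Notation leb := (@lebesgue_measure R).
Variables (r s0 rho A B q C1 C2 : R) (phi G1 G2 : R -> R).
Hypotheses (r0 : 0 < r) (s00 : 0 < s0) (rho0 : 0 <= rho) (A0 : 0 < A) (B0 : 0 < B).
Hypotheses (ABq : A * B = q) (hb : 2^-1 <= (s0 + 2 * rho) / r).
Hypotheses (C10 : 0 <= C1) (C20 : 0 <= C2).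
Hypothesis mphi : measurable_fun [set: measurableTypeR R] phi.

Local Notation s := (s0 + 2 * rho).
Local Notation psi := (hankel (s / r) r q phi).

Hypothesis hphi : forall x : R, `|phi x| * expR (A * `|x| `^ r) <=
  C1 * (`|x| `^ rho * (`|x| `^ (s0 - 1) * G1 x)).
Hypothesis hpsi : forall t : R, `|psi t| * `|t| `^ (s - 1) * expR (B * `|t| `^ r) <=
  C2 * (`|t| `^ rho * (`|t| `^ (s0 - 1) * G2 t)).
Hypotheses (tame1 : tame s0 G1) (tame2 : tame s0 G2) (small12 : small s0 G1 \/ small s0 G2).

(** The case [rho = 0] serves the even component and [rho = 1] the odd one. In the latter both sides
    carry an extra factor of the variable, which raises the index by [2 rho / r] while [G1] and [G2]
    are still measured with the weight of [s0]. *)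
Theorem hankel_uncertainty : {ae leb, forall x, phi x + phi (- x) = 0}.
Proof.
have s_gt0 : 0 < s by rewrite ltr_wpDr // mulr_ge0.
have q0 : 0 <= q by rewrite -ABq mulr_ge0 // ltW.
have mE c : measurable_fun [set: measurableTypeR R] (fun x : R => expR (c * `|x| `^ r)).
  apply: (@measurableT_comp _ _ _ _ _ _ (@expR R)) => //.
  by apply: measurable_funM => //; exact: measurable_absp.
pose Phi x := phi x * expR (A * `|x| `^ r).
pose Psi t := psi t * `|t| `^ (s - 1) * expR (B * `|t| `^ r).
have mPhi : measurable_fun [set: measurableTypeR R] Phi by exact: measurable_funM.
have hPhi x : `|Phi x| <= C1 * (`|x| `^ rho * (`|x| `^ (s0 - 1) * G1 x)).
  by rewrite normrM (ger0_norm (expR_ge0 _)).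
have A2 : 0 < 2 * A by rewrite mulr_gt0.
have B2 : 0 < 2 * B by rewrite mulr_gt0.
have [N1 L1Phi] := tame_L1 r0 s00 rho0 C10 mPhi hPhi A2 tame1.
have LPhi (c : R) : 0 < c -> L1 leb (fun x => Phi x * expR (- (c * `|x| `^ r))).
  by move=> c0; exact: (tame_L1_expR r0 s00 rho0 C10 mPhi hPhi).
have Lphi : L1 leb phi.
  by apply: L1_ext (LPhi A A0) => x; rewrite /Phi -mulrA -expRD addrN expR0 mulr1.
have mPsi : measurable_fun [set: measurableTypeR R] Psi.
  apply: measurable_funM => //; apply: measurable_funM; last exact: measurable_absp.
  exact: (measurable_hankel r0 hb q0 Lphi).
have hPsi t : `|Psi t| <= C2 * (`|t| `^ rho * (`|t| `^ (s0 - 1) * G2 t)).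
  by rewrite /Psi !normrM (ger0_norm (expR_ge0 _)) (ger0_norm (powR_ge0 _ _)).
have [N2 L1Psi] := tame_L1 r0 s00 rho0 C20 mPsi hPsi B2 tame2.
have X0 a (x : R) : 0 < a -> 0 <= a * `|x| `^ r by move=> a0; rewrite mulr_ge0 ?powR_ge0 // ltW.
have mX a : measurable_fun [set: measurableTypeR R] (fun x : R => a * `|x| `^ r).
  by apply: measurable_funM => //; exact: measurable_absp.
pose b := s / r.
pose g := (B `^ (- b) * gweight r s 1)^-1.
have W0 := gweight_gt0 r0 s_gt0 ltr01.
(* Parseval's identity at [z = B (1 - T) / (1 + T)]: the rates [A + q / z] and [B + z] become
   [2A / (1 - T)] and [2B / (1 + T)]. The factor [z^(-b)] of the Gaussian mass distributes over the
   two sides and leaves the constant [g]. *)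
have rel T : `|T| < 1 -> lmom leb b Phi (fun x => 2 * A * `|x| `^ r) 0 (1 - T) =
    g * lmom leb b Psi (fun t => 2 * B * `|t| `^ r) 0 (1 + T).
  rewrite ltr_norml => /andP[T1 T2].
  have u0 : 0 < 1 - T by rewrite subr_gt0.
  have v0 : 0 < 1 + T by rewrite -ltrBlDl sub0r.
  have z0 : 0 < B * ((1 - T) / (1 + T)) by rewrite mulr_gt0 // divr_gt0.
  have [_ P] := hankel_parseval r0 s_gt0 hb q0 Lphi z0.
  have q1 : 0 < q by rewrite -ABq mulr_gt0.
  have qz0 : 0 < q / (B * ((1 - T) / (1 + T))) by rewrite divr_gt0.
  pose I := rint leb (fun x => phi x * expR (- (q * `|x| `^ r / (B * ((1 - T) / (1 + T)))))).
  have LI : L1 leb (fun x => phi x * expR (- (q * `|x| `^ r / (B * ((1 - T) / (1 + T)))))).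
    apply: L1_ext (LPhi _ (addr_gt0 A0 qz0)) => x.
    rewrite /Phi -mulrA -expRD; congr (_ * expR _); ring.
  have -> : lmom leb b Phi (fun x => 2 * A * `|x| `^ r) 0 (1 - T) = (1 - T) `^ (- b) * I.
    rewrite /I -rintZ //; apply: rint_ext => x.
    have E : expR (A * `|x| `^ r) * expR (- (2 * A * `|x| `^ r / (1 - T))) =
        expR (- (q * `|x| `^ r / (B * ((1 - T) / (1 + T))))).
      by rewrite -expRD -ABq; congr expR; field; rewrite (gt_eqF u0) (gt_eqF v0) (gt_eqF B0).
    by rewrite -E kap0E /Phi; ring.
  have -> : lmom leb b Psi (fun t => 2 * B * `|t| `^ r) 0 (1 + T) =
      (1 + T) `^ (- b) * (gweight r s (B * ((1 - T) / (1 + T))) * I).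
    rewrite /I -P -rintZ; last by have [] := hankel_parseval r0 s_gt0 hb q0 Lphi z0.
    apply: rint_ext => t.
    have E : expR (B * `|t| `^ r) * expR (- (2 * B * `|t| `^ r / (1 + T))) =
        expR (- (B * ((1 - T) / (1 + T)) * `|t| `^ r)).
      by rewrite -expRD; congr expR; field; rewrite (gt_eqF v0).
    by rewrite /gfun -E kap0E /Psi; ring.
  have E : (1 + T) `^ (- b) * (B * ((1 - T) / (1 + T))) `^ (- b) = B `^ (- b) * (1 - T) `^ (- b).
    rewrite -!powRM ?(ltW u0) ?(ltW v0) ?(ltW z0) ?(ltW B0) //; congr (_ `^ _).
    by field; rewrite gt_eqF.
  rewrite gweight_scale // -/b [RHS](_ : _ = g * ((1 + T) `^ (- b) * (B * ((1 - T) / (1 + T))) `^ (- b) *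
    gweight r s 1 * I)); last by ring.
  by rewrite E /g; field; rewrite (gt_eqF W0) gt_eqF ?powR_gt0.
have decay : (fun n : nat => lmom leb b Phi (fun x => 2 * A * `|x| `^ r) 0 (1 + n%:R)) @ \oo --> (0 : R) \/
    (fun n : nat => lmom leb b Psi (fun x => 2 * B * `|x| `^ r) 0 (1 + n%:R)) @ \oo --> (0 : R).
  case: small12 => h; [left|right].
    have := small_decay r0 s00 rho0 C10 mPhi hPhi A2 h; exact.
  have := small_decay r0 s00 rho0 C20 mPsi hPsi B2 h; exact.
have Z := @two_sided_laplace_eq0 _ (measurableTypeR R) _ (measurableTypeR R) R leb leb b g
  Phi (fun x => 2 * A * `|x| `^ r) Psi (fun t => 2 * B * `|t| `^ r) N1 N2 hb (fun x => X0 (2 * A) x A2) (fun x => X0 (2 * B) x B2) (mX _) mPhi (mX _) mPsi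
  L1Phi L1Psi rel decay.
have Z' l : 0 < l -> rint leb (fun x => Phi x * expR (- (l * `|x| `^ r))) = 0.
  move=> l0; have u0 : 0 < 2 * A / l by rewrite divr_gt0.
  have := Z _ u0; rewrite /lmom.
  have -> : rint leb (fun x => Phi x * kap b 0 (2 * A / l) (2 * A * `|x| `^ r)) =
      (2 * A / l) `^ (- b) * rint leb (fun x => Phi x * expR (- (l * `|x| `^ r))).
    rewrite -rintZ; last exact: LPhi.
    apply: rint_ext => x; rewrite kap0E mulrCA; congr (_ * (_ * expR _)).
    by field; rewrite !gt_eqF.
  by move/eqP; rewrite mulf_eq0 gt_eqF ?powR_gt0 //= => /eqP.
(* [Phi] is only integrable up to a polynomial weight; damping it by one exponential makes it
   integrable and brings the rate [l = 0] into the range. *)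
pose G x := Phi x * expR (- `|x| `^ r).
have LG : L1 leb G by apply: L1_ext (LPhi 1 ltr01) => x; rewrite mul1r.
have GE l : 0 <= l -> rint leb (fun x => G x * expR (- (l * `|x| `^ r))) = 0.
  move=> l0; rewrite -(Z' (1 + l)) ?ltr_pwDl //; apply: rint_ext => x.
  by rewrite /G -mulrA -expRD; congr (_ * expR _); ring.
have sl := laplace_eq0_superlevel LG (fun x => powR_ge0 `|x| r) (measurable_absp r) GE.
have G00 : rint leb G = 0.
  by rewrite -[RHS](GE 0) //; apply: rint_ext => x; rewrite mul0r oppr0 expR0 mulr1.
have : {ae leb, forall x, G x + G (- x) = 0}.
  apply: even_part_ae_eq0 => // c c0; rewrite -[RHS](sl (c `^ r)) ?powR_gt0 //.
  apply: rint_ext => x; congr (_ * (nat_of_bool _)%:R).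
  apply/idP/idP => h; first by rewrite gt0_ltr_powR // nnegrE ltW.
  rewrite ltNge; apply/negP => h'; move: h; rewrite ltNge => /negP; apply.
  by apply: ge0_ler_powR; rewrite ?nnegrE // ltW.
apply: (@filterS _ _ (ae_filter_ringOfSetsType leb)) => x.
rewrite /G /Phi normrN -!mulrA -!mulrDl => /eqP.
rewrite mulf_eq0 => /orP[/eqP //|].
by rewrite gt_eqF // mulr_gt0 ?expR_gt0.
Qed.

End HankelUncertainty.

(** * Integration against a measure with density *)

Section Density.
Import HBNNSimple.
Context d (T : measurableType d) {R : realType}.
Variables (mu nu : {measure set T -> \bar R}) (w : T -> R).
Hypotheses (w0 : forall x, 0 <= w x) (mw : measurable_fun [set: T] w).
Hypothesis nuE : forall A, measurable A -> nu A = (\int[mu]_(x in A) (w x)%:E)%E.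

Lemma ge0_integral_density (f : T -> \bar R) : measurable_fun [set: T] f ->
  (forall x, (0 <= f x)%E) -> (\int[nu]_x f x = \int[mu]_x (f x * (w x)%:E))%E.
Proof.
move=> mf f0; pose h := nnsfun_approx measurableT mf.
have mwE : measurable_fun [set: T] (EFin \o w) by exact/measurable_EFinP.
have nd (x : T) : {homo (fun n => (h n x)%:E) : m n / (m <= n)%N >-> (m <= n)%E}.
  by move=> m n mn; rewrite lee_fin; exact/lefP/nd_nnsfun_approx.
have -> : (\int[nu]_x f x = limn (fun n => \int[nu]_x (h n x)%:E))%E.
  rewrite -monotone_convergence //.
  - apply: eq_integral => x _; apply/esym/cvg_lim => //.
    exact: cvg_nnsfun_approx.
  - by move=> n; exact/measurable_EFinP.
  - by move=> n x _; rewrite lee_fin.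
have -> : (\int[mu]_x (f x * (w x)%:E) = limn (fun n => \int[mu]_x ((h n x)%:E * (w x)%:E)))%E.
  rewrite -monotone_convergence //.
  - apply: eq_integral => x _; apply/esym/cvg_lim => //.
    by apply: cvgeZr => //; exact: cvg_nnsfun_approx.
  - by move=> n; apply: emeasurable_funM => //; exact/measurable_EFinP.
  - by move=> n x _; rewrite mule_ge0 ?lee_fin.
  - by move=> x _ m n mn; rewrite lee_wpmul2r ?lee_fin //; exact: nd.
congr (limn _); apply/funext => n.
have mhr r : measurable (h n @^-1` [set r]) by exact: measurable_funPTI.
have r0 r : r \in range (h n) -> 0 <= r by rewrite inE => -[x _ <-].
have mr r : measurable_fun [set: T] (fun x => (r * \1_(h n @^-1` [set r]) x)%:E).
  by apply/measurable_EFinP; exact: measurable_funM.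
transitivity (\int[nu]_x (\sum_(r \in range (h n)) (r * \1_(h n @^-1` [set r]) x)%:E))%E.
  by apply: eq_integral => x _; rewrite /= fimfunE -fsumEFin.
rewrite ge0_integral_fsum //; last by move=> m x _; exact: nnfun_muleindic_ge0.
transitivity (\int[mu]_x (\sum_(r \in range (h n)) ((r * \1_(h n @^-1` [set r]) x)%:E * (w x)%:E)))%E; last first.
  apply: eq_integral => x _; rewrite -ge0_mule_fsuml; last by move=> r; exact: nnfun_muleindic_ge0.
  by rewrite fsumEFin // -(fimfunE _ x).
rewrite ge0_integral_fsum //; first last.
- by move=> m x _; rewrite mule_ge0 ?lee_fin // -lee_fin nnfun_muleindic_ge0.
- by move=> r; exact: emeasurable_funM.
apply: eq_fsbigr => r rh.
under eq_integral do rewrite EFinM.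
rewrite integralZl_indic_nnsfun // integral_indic // setIT nuE //.
under [RHS]eq_integral do rewrite EFinM -muleA.
rewrite ge0_integralZl ?lee_fin ?r0 //.
- rewrite integral_mkcond; congr (_ * _)%E; apply: eq_integral => x _.
  by rewrite epatch_indic muleC.
- by apply: emeasurable_funM => //; apply/measurable_EFinP.
- by move=> x _; rewrite mule_ge0 ?lee_fin.
Qed.

Lemma Rintegral_density (f : T -> R) : measurable_fun [set: T] f ->
  Rintegral nu [set: T] f = rint mu (fun x => f x * w x).
Proof.
move=> mf; rewrite /rint /Rintegral; congr fine.
have mfE : measurable_fun [set: T] (EFin \o f) by exact/measurable_EFinP.
rewrite integralE [RHS]integralE; congr (_ - _)%E.
- rewrite ge0_integral_density //; last exact: measurable_funepos.
  apply: eq_integral => x _; rewrite !funeposE /= EFinM.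
  by rewrite maxe_pMl ?lee_fin // mul0e.
- rewrite ge0_integral_density //; last exact: measurable_funeneg.
  apply: eq_integral => x _; rewrite !funenegE maxe_pMl ?lee_fin // mul0e.
  by congr maxe; rewrite /= -EFinM mulNr.
Qed.

End Density.

(** * Integrals for [mu_kn] as weighted Lebesgue integrals *)

Section MuKn.
Context {R : realType}.
Local Notation leb := (@lebesgue_measure R).

(** Lebesgue measure lives on the structure [measurableTypeR R], while [mu_kn] is a measure on [R]
    with its own measurable structure; the push-forward along the identity passes from one to the
    other. *)
Let idm : measurableTypeR R -> R := fun x => x.

Let midm : measurable_fun [set: measurableTypeR R] idm.
Proof. by move=> _ A mA; rewrite setTI. Qed.

Let leb' : {measure set R -> \bar R} :=
  measure_function_pushforward__canonical__measure_function_Measure leb midm.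

Let leb'_integral (f : R -> \bar R) : measurable_fun [set: R] f -> (forall x, (0 <= f x)%E) ->
  (\int[leb']_x f x = \int[leb]_x f x)%E.
Proof.
move=> mf f0; have f0' : {in [set: R], forall x, (0 <= f x)%E} by move=> x _.
by rewrite (ge0_integral_pushforward midm leb measurableT mf f0') preimage_setT.
Qed.

Variables (n : nat) (k : R).

Let w0 x : 0 <= w_kn n k x.
Proof. exact/w_kn_ge0/Gamma_ge0. Qed.

Let mw := measurable_w_kn n k.

Let mu_knE A : measurable A -> mu_kn n k A = (\int[leb']_(x in A) (w_kn n k x)%:E)%E.
Proof.
move=> mA; have w0' : {in A, forall x, (0 <= (w_kn n k x)%:E)%E}.
  by move=> x _; rewrite lee_fin w0.
rewrite (ge0_integral_pushforward midm leb mA _ w0') //.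
by apply/measurable_EFinP; exact: measurable_funTS.
Qed.

Lemma ge0_integral_mu_kn (f : R -> \bar R) : measurable_fun [set: R] f ->
  (forall x, (0 <= f x)%E) ->
  (\int[mu_kn n k]_x f x = \int[leb]_x (f x * (w_kn n k x)%:E))%E.
Proof.
move=> mf f0; rewrite (ge0_integral_density w0 mw mu_knE) // leb'_integral //.
  by apply: emeasurable_funM => //; exact/measurable_EFinP.
by move=> x; rewrite mule_ge0 ?lee_fin.
Qed.

Lemma Rintegral_mu_kn (f : R -> R) : measurable_fun [set: R] f ->
  Rintegral (mu_kn n k) [set: R] f = rint leb (fun x => f x * w_kn n k x).
Proof.
move=> mf; rewrite (Rintegral_density w0 mw mu_knE) // /rint /Rintegral; congr fine.
have mfE : measurable_fun [set: R] (fun x => (f x * w_kn n k x)%:E).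
  by apply/measurable_EFinP; exact: measurable_funM.
rewrite integralE [RHS]integralE; congr (_ - _)%E; rewrite leb'_integral //.
  exact: measurable_funepos.
exact: measurable_funeneg.
Qed.

End MuKn.

(** * Weighted norms and the growth conditions *)

Section Norms.
Context {R : realType}.
Local Notation leb := (@lebesgue_measure R).
Variables (n : nat) (k : R).
Hypotheses (n1 : (1 <= n)%N) (hk : (n%:R - 1) / (2 * n%:R) <= k).

(** Normalized so that the density is proportional to [|x|^(s-1)]; with [r = 2/n], the Hankel
    indices are then [s / r = alpha + 1] and [(s + 2) / r = alpha + n + 1]. *)
Definition exponent_kn : R := 2 * k + 2 / n%:R - 1.

Definition const_kn : R := (2 * Gamma (alpha_kn n k + 1))^-1 * (n%:R / 2) `^ (alpha_kn n k).

Local Notation s := exponent_kn.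
Local Notation W := const_kn.

Let n0 : 0 < n%:R :> R. Proof. by rewrite ltr0n. Qed.

Lemma radius_gt0 : 0 < 2 / n%:R :> R. Proof. by rewrite divr_gt0. Qed.

Lemma alpha_kn_ge : - (2^-1 : R) <= alpha_kn n k.
Proof.
move: hk; rewrite /alpha_kn ler_pdivrMr; last by rewrite mulr_gt0.
have -> : k * (2 * n%:R) = 2 * (k * n%:R) by ring.
by move=> h; lra.
Qed.

Lemma exponent_knE : s / (2 / n%:R) = alpha_kn n k + 1.
Proof. by rewrite /s /alpha_kn; field; rewrite gt_eqF. Qed.

Lemma exponent_knE2 : (s + 2) / (2 / n%:R) = alpha_kn n k + n%:R + 1.
Proof. by rewrite /s /alpha_kn; field; rewrite gt_eqF. Qed.

Lemma exponent_kn_gt0 : 0 < s.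
Proof.
have : 0 < s / (2 / n%:R) by rewrite exponent_knE; have := alpha_kn_ge; lra.
by rewrite pmulr_lgt0 // invr_gt0 radius_gt0.
Qed.

Lemma const_kn_gt0 : 0 < W.
Proof.
have h := alpha_kn_ge; rewrite mulr_gt0 ?powR_gt0 ?divr_gt0 //.
by rewrite invr_gt0 mulr_gt0 // Gamma_gt0 //; lra.
Qed.

Lemma w_knE x : w_kn n k x = W * `|x| `^ (s - 1).
Proof. by rewrite /w_kn; congr (_ * _ `^ _); rewrite /s; ring. Qed.

Lemma mu_kn_lty_L1 (h : R -> R) : measurable_fun [set: R] h -> (forall x, 0 <= h x) ->
  (\int[mu_kn n k]_x (h x)%:E < +oo)%E -> L1 leb (fun x : R => `|x| `^ (s - 1) * h x).
Proof.
move=> mh h0; rewrite ge0_integral_mu_kn //; last exact/measurable_EFinP.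
move=> hoo; have W0 := const_kn_gt0.
have L : L1 leb (fun x => h x * w_kn n k x).
  apply/integrableP; split.
    by apply/measurable_EFinP; apply: measurable_funM => //; exact: measurable_w_kn.
  apply: le_lt_trans hoo; rewrite le_eqVlt; apply/orP; left; apply/eqP.
  apply: eq_integral => x _; rewrite /= -EFinM ger0_norm // mulr_ge0 // w_knE.
  by rewrite mulr_ge0 ?powR_ge0 // ltW.
apply: L1_ext (L1Z W^-1 L) => x; rewrite w_knE.
by field; rewrite gt_eqF.
Qed.

Lemma L1_mu_kn_lty (h : R -> R) : measurable_fun [set: R] h -> (forall x, 0 <= h x) ->
  L1 leb (fun x : R => `|x| `^ (s - 1) * h x) -> (\int[mu_kn n k]_x (h x)%:E < +oo)%E.
Proof.
move=> mh h0 L; rewrite ge0_integral_mu_kn //; last exact/measurable_EFinP.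
under eq_integral do rewrite -EFinM.
rewrite integral_rint ?ltry //; apply: L1_ext (L1Z W L) => x.
by rewrite w_knE; ring.
Qed.

(** For exponent infinity the norm is the essential supremum only when the measure has positive
    mass. *)
Lemma mu_kn_setT_gt0 : (0 < mu_kn n k [set: R])%E.
Proof.
have W0 := const_kn_gt0; have s0 := exponent_kn_gt0; have r0 := radius_gt0.
have := mulr_gt0 W0 (gweight_gt0 r0 s0 ltr01); rewrite -lte_fin => /lt_le_trans; apply.
rewrite -rintZ; last exact: L1_gfun.
rewrite -integral_rint; last by apply: L1Z; exact: L1_gfun.
rewrite /mu_kn; apply: ge0_le_integral => //.
- by move=> x _; rewrite lee_fin mulr_ge0 ?(ltW W0) // mulr_ge0 ?powR_ge0 ?expR_ge0.
- by apply/measurable_EFinP; apply: measurable_funM => //; exact: L1_measurable (L1_gfun r0 s0 ltr01).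
- by apply/measurable_EFinP; exact: measurable_w_kn.
- move=> x _; rewrite lee_fin w_knE ler_wpM2l ?(ltW W0) // /gfun.
  by rewrite -[leRHS]mulr1 ler_wpM2l ?powR_ge0 // -[leRHS]expR0 ler_expR oppr_le0 mul1r powR_ge0.
Qed.

Section Lnorm.
Variables (p : \bar R) (G : R -> R).
Hypotheses (p1 : (1 <= p)%E) (mG : measurable_fun [set: R] G) (G0 : forall x, 0 <= G x).
Hypothesis fin : (Lnorm (mu_kn n k) p (fun x => (G x)%:E) < +oo)%E.

Let mGp t : measurable_fun [set: R] (fun x => G x `^ t).
Proof. by apply: (@measurableT_comp _ _ _ _ _ _ (@powR R ^~ t)). Qed.

(** Where [G > e] one has [(G / e)^(t-1) >= 1], so [G <= e^(1-t) G^t], an integrable function. *)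
Lemma Lnorm_small : (p < +oo)%E -> small s G.
Proof.
move: p1 fin; case: p => [t|//|//]; rewrite lee_fin => t1 foo _ e e0.
have t0 : 0 < t by apply: lt_le_trans t1.
have L : L1 leb (fun x : R => `|x| `^ (s - 1) * G x `^ t).
  apply: mu_kn_lty_L1 => // [x|]; first exact: powR_ge0.
  have := powR_Lnorm (mu_kn n k) (fun x => (G x)%:E) (lt0r_neq0 t0).
  under eq_integral do rewrite /= ger0_norm //.
  by move=> <-; rewrite poweR_lty.
exists (fun x => e `^ (1 - t) * G x `^ t); split.
- by move=> x; rewrite mulr_ge0 ?powR_ge0.
- by apply: L1_ext (L1Z (e `^ (1 - t)) L) => x; ring.
- move=> x; have [xe|xe] := leP (G x) e; first by rewrite ler_wpDr ?mulr_ge0 ?powR_ge0.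
  have x0 := lt_trans e0 xe.
  apply: (@le_trans _ _ (e `^ (1 - t) * G x `^ t)); last by rewrite lerDr ltW.
  have -> : e `^ (1 - t) * G x `^ t = G x * (G x / e) `^ (t - 1).
    rewrite powRM ?invr_ge0 ?(ltW e0) ?(ltW x0) // -powR_inv1 ?(ltW e0) // -powRrM.
    rewrite mulrA -[X in X * _ `^ (t - 1)]powRr1 ?(ltW x0) // -powRD; last by rewrite (gt_eqF x0) implybT.
    by rewrite mulrC; congr (_ `^ _ * _ `^ _); ring.
  rewrite -[leLHS]mulr1 ler_wpM2l ?(ltW x0) //.
  by rewrite -[leLHS](powRr0 (G x / e)) ler_powR ?subr_ge0 // ler_pdivlMr // mul1r ltW.
Qed.

(** For exponent infinity the integrable part is [G] restricted to the set where it exceeds its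
    essential bound, a null function: the domination has to hold at every point. *)
Lemma Lnorm_tame : tame s G.
Proof.
have [poo|] := ltP p +oo%E; first exact/small_tame/Lnorm_small.
rewrite leye_eq => /eqP pE; move: fin; rewrite pE unlock mu_kn_setT_gt0 => foo.
have [M [M0 hM]] : exists M : R, 0 <= M /\ (ess_sup (mu_kn n k) (abse \o (fun x => (G x)%:E)) <= M%:E)%E.
  move: foo; case: (ess_sup _ _) => [m|//|] _; last by exists 0; rewrite leNye.
  by exists `|m|; rewrite lee_fin ler_norm.
have {hM} hM : \forall x \ae mu_kn n k, ((G x)%:E <= M%:E)%E.
  by move/ess_supP: hM; apply: filterS => x /=; rewrite ger0_norm.
exists M; split=> //; exists (fun x => G x * (M < G x)%R%:R); split.
- by move=> x; rewrite mulr_ge0.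
- have mH : measurable_fun [set: R] (fun x => G x * (M < G x)%R%:R).
    apply: measurable_funM => //.
    have mS : measurable [set x | M < G x].
      by rewrite -[X in measurable X]setTI; exact: (measurable_fun_ltr (measurable_cst M) mG).
    have := measurable_mem (R := R) mS; congr (measurable_fun _).
    by apply/funext => x; rewrite mem_setE.
  apply: mu_kn_lty_L1 => // [x|]; first by rewrite mulr_ge0.
  rewrite (_ : integral _ _ _ = 0%E) ?ltry //.
  rewrite -[RHS](integral0 (mu_kn n k) [set: R]); apply: ge0_ae_eq_integral => //.
  - exact/measurable_EFinP.
  - by move=> x _; rewrite lee_fin mulr_ge0.
  - apply: filterS hM => x; rewrite lee_fin => h _.
    by rewrite ltNge h mulr0.
- move=> x; have [h|h] := leP (G x) M; first by rewrite mulr0 addr0.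
  by rewrite mulr1 lerDr.
Qed.

End Lnorm.

Lemma gauss_Lnorm_lty (p : \bar R) (G : R -> R) (C d : R) : (1 <= p)%E -> 0 < d ->
  measurable_fun [set: R] G -> (forall x : R, `|G x| <= C * expR (- (d * `|x| `^ (2 / n%:R)))) ->
  (Lnorm (mu_kn n k) p (fun x => (G x)%:E) < +oo)%E.
Proof.
move=> p1 d0 mG hG; have r0 := radius_gt0; have s0 := exponent_kn_gt0.
have C0 : 0 <= C.
  by have := le_trans (normr_ge0 _) (hG 0); rewrite pmulr_lge0 // expR_gt0.
rewrite unlock; case: p p1 => [t|_|//]; last first.
  rewrite mu_kn_setT_gt0; apply: (@le_lt_trans _ _ C%:E); last exact: ltry.
  apply/ess_supP; apply: aeW => x /=; rewrite lee_fin; apply: le_trans (hG x) _.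
  rewrite -[leRHS]mulr1 ler_wpM2l // -[leRHS]expR0 ler_expR oppr_le0.
  by rewrite mulr_ge0 ?powR_ge0 // ltW.
rewrite lee_fin => t1; have t0 : 0 < t by apply: lt_le_trans t1.
have mp : measurable_fun [set: R] (fun x => `|G x| `^ t).
  by apply: (@measurableT_comp _ _ _ _ _ _ (@powR R ^~ t)) => //; exact: measurableT_comp.
apply: poweR_lty; rewrite [ltLHS](_ : _ = \int[mu_kn n k]_x (`|G x| `^ t)%:E)%E; last exact: eq_integral.
apply: L1_mu_kn_lty => //.
apply: L1_le _ _ (L1Z (C `^ t) (L1_gfun r0 s0 (mulr_gt0 t0 d0))) => [|x].
  by apply: measurable_funM => //; exact: measurable_absp.
rewrite ger0_norm ?mulr_ge0 ?powR_ge0 // /gfun mulrCA ler_wpM2l ?powR_ge0 //.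
have h := hG x; apply: (@le_trans _ _ ((C * expR (- (d * `|x| `^ (2 / n%:R)))) `^ t)).
  by apply: ge0_ler_powR; rewrite ?nnegrE ?mulr_ge0 ?expR_ge0 // ltW.
by rewrite powRM ?expR_ge0 // -expRM ler_wpM2l ?powR_ge0 // ler_expR; lra.
Qed.

End Norms.

(** * Real and imaginary parts *)

Section ComplexParts.
Context {R : realType}.
Implicit Type z : R[i].

Lemma Re_le_cabs z : `|complex.Re z| <= cabs z.
Proof. by case: z => x y; rewrite /cabs /= -sqrtr_sqr ler_wsqrtr // lerDl sqr_ge0. Qed.

Lemma Im_le_cabs z : `|complex.Im z| <= cabs z.
Proof. by case: z => x y; rewrite /cabs /= -sqrtr_sqr ler_wsqrtr // lerDr sqr_ge0. Qed.

Lemma cabs_i : cabs ('i : R[i])%C = 1.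
Proof. by rewrite /cabs /= expr0n expr1n add0r sqrtr1. Qed.

Lemma cabs_double z : cabs z <= cabs (z + z).
Proof.
rewrite -mulr2n -mulr_natr cabsM cabs_nat -[leLHS]mulr1 ler_wpM2l ?cabs_ge0 //.
by rewrite ler1n.
Qed.

End ComplexParts.

(** * The generalized Fourier transform through Hankel transforms *)

Section Transform.
Context {R : realType}.
Local Notation leb := (@lebesgue_measure R).
Variables (n : nat) (k : R).
Hypotheses (n1 : (1 <= n)%N) (hk : (n%:R - 1) / (2 * n%:R) <= k).

Local Notation r := (2 / n%:R : R).
Local Notation s := (exponent_kn n k).
Local Notation W := (const_kn n k).
Local Notation q := ((n%:R / 2) ^+ 2 : R).
Local Notation al := (alpha_kn n k).

Let n0 : 0 < n%:R :> R. Proof. by rewrite ltr0n. Qed.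

Definition even_transform (h : R -> R) : R -> R :=
  hankel (al + 1) r q (fun x => h x * `|x| `^ (s - 1)).

Definition odd_transform (h : R -> R) : R -> R :=
  hankel (al + n%:R + 1) r q (fun x => h x * x * `|x| `^ (s - 1)).

Definition odd_const : R := (n%:R / 2) ^+ n * (Gamma (al + 1) / Gamma (al + n%:R + 1)).

Lemma odd_const_gt0 : 0 < odd_const.
Proof.
have h := alpha_kn_ge n1 hk.
by rewrite mulr_gt0 ?exprn_gt0 ?divr_gt0 // Gamma_gt0 //; [lra|have := n0; lra].
Qed.

Let K b (x lam : R) : R := bessel b (q * `|x| `^ r * `|lam| `^ r).

Let K_al : 2^-1 <= al + 1. Proof. by have := alpha_kn_ge n1 hk; lra. Qed.

Let K_aln : 2^-1 <= al + n%:R + 1.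
Proof. by have := alpha_kn_ge n1 hk; have := n0; lra. Qed.

Let K1 b x lam : 2^-1 <= b -> `|K b x lam| <= 1.
Proof. by move=> hb; apply: bessel_le1 => //; rewrite !mulr_ge0 ?powR_ge0 ?sqr_ge0. Qed.

Let mK b lam : 2^-1 <= b -> measurable_fun [set: measurableTypeR R] (K b ^~ lam).
Proof.
move=> hb; apply: (@measurableT_comp _ _ _ _ _ _ (bessel b)).
  by apply: continuous_measurable_fun; exact: continuous_bessel.
by apply: measurable_funM => //; apply: measurable_funM => //; exact: measurable_absp.
Qed.

Lemma jbessel_kn nu x lam : - (2^-1 : R) <= nu ->
  jbessel nu (n%:R * `|lam * x| `^ n%:R^-1) = K (nu + 1) x lam.
Proof.
move=> hnu; rewrite jbesselE // /K; congr bessel.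
have E (y : R) : (`|y| `^ n%:R^-1) ^+ 2 = `|y| `^ r.
  by rewrite -powR_mulrn ?powR_ge0 // -powRrM mulrC.
have -> : n%:R * `|lam * x| `^ n%:R^-1 / 2 = n%:R / 2 * `|lam * x| `^ n%:R^-1 by ring.
by rewrite exprMn E normrM powRM //; ring.
Qed.

Lemma B_knE x lam : B_kn n k x lam =
  ((K (al + 1) x lam)%:C + (- 'i) ^+ n * (odd_const * lam * x * K (al + n%:R + 1) x lam)%:C)%C.
Proof.
have h := alpha_kn_ge n1 hk.
by rewrite /B_kn !jbessel_kn //; have := n0; lra.
Qed.

Section Components.
Variables h1 h2 : R -> R.
Hypotheses (mh1 : measurable_fun [set: R] h1) (mh2 : measurable_fun [set: R] h2).
Hypotheses (L1e : L1 leb (fun x => h1 x * `|x| `^ (s - 1))).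
Hypotheses (L1o : L1 leb (fun x => h1 x * x * `|x| `^ (s - 1))).
Hypotheses (L2o : L1 leb (fun x => h2 x * x * `|x| `^ (s - 1))).

(** Multiplication by [(- 'i) ^+ n] mixes the odd contributions of the real and imaginary parts;
    [a1] and [a2] are its components up to sign, so both parts of the transform are instances. *)
Lemma Rintegral_component (a1 a2 lam : R) :
  Rintegral (mu_kn n k) [set: R] (fun x => h1 x * K (al + 1) x lam +
     a1 * (h1 x * (odd_const * lam * x * K (al + n%:R + 1) x lam)) +
     a2 * (h2 x * (odd_const * lam * x * K (al + n%:R + 1) x lam))) =
  W * even_transform h1 lam + a1 * (W * odd_const * lam * odd_transform h1 lam) +
    a2 * (W * odd_const * lam * odd_transform h2 lam).
Proof.
have Le := L1M_bounded L1e (mK lam K_al) (fun x => K1 x lam K_al).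
have Lo1 := L1M_bounded L1o (mK lam K_aln) (fun x => K1 x lam K_aln).
have Lo2 := L1M_bounded L2o (mK lam K_aln) (fun x => K1 x lam K_aln).
rewrite Rintegral_mu_kn; last first.
  have mK1 := mK lam K_al; have mK2 := mK lam K_aln.
  apply: measurable_funD; [apply: measurable_funD|]; do ?[apply: measurable_funM => //].
pose e x := h1 x * `|x| `^ (s - 1) * K (al + 1) x lam.
pose o1 x := h1 x * x * `|x| `^ (s - 1) * K (al + n%:R + 1) x lam.
pose o2 x := h2 x * x * `|x| `^ (s - 1) * K (al + n%:R + 1) x lam.
transitivity (rint leb (fun x => W * e x + a1 * (W * odd_const * lam) * o1 x +
    a2 * (W * odd_const * lam) * o2 x)).
  by apply: rint_ext => x; rewrite w_knE /e /o1 /o2; ring.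
have Ze := L1Z W Le; have Zo1 := L1Z (a1 * (W * odd_const * lam)) Lo1.
have Zo2 := L1Z (a2 * (W * odd_const * lam)) Lo2.
rewrite rintD //; last exact: L1D.
rewrite rintD // !rintZ // /even_transform /odd_transform /hankel /e /o1 /o2 /K.
by ring.
Qed.

End Components.

Section Formula.
Variable f : R -> R[i].
Let u x := complex.Re (f x).
Let v x := complex.Im (f x).
Hypothesis mf : cmeasurable f.
Hypotheses (Lu : L1 leb (fun x => u x * `|x| `^ (s - 1))).
Hypotheses (Lv : L1 leb (fun x => v x * `|x| `^ (s - 1))).
Hypotheses (Luo : L1 leb (fun x => u x * x * `|x| `^ (s - 1))).
Hypotheses (Lvo : L1 leb (fun x => v x * x * `|x| `^ (s - 1))).

(** The power of [- 'i] is kept as an unspecified complex number, which avoids a discussion of [n]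
    modulo [4]. *)
Lemma F_knE lam : F_kn n k f lam =
  ((W * even_transform u lam +i* (W * even_transform v lam)) +
  (- 'i) ^+ n * (W * odd_const * lam * odd_transform u lam +i*
     (W * odd_const * lam * odd_transform v lam)))%C.
Proof.
have [mu mv] := mf; rewrite /F_kn /cintegral.
case Ec : ((- 'i) ^+ n : R[i])%C => [cr ci].
have fB x : f x * B_kn n k x lam =
  ((u x * K (al + 1) x lam + cr * (u x * (odd_const * lam * x * K (al + n%:R + 1) x lam)) +
    (- ci) * (v x * (odd_const * lam * x * K (al + n%:R + 1) x lam))) +i*
   (v x * K (al + 1) x lam + cr * (v x * (odd_const * lam * x * K (al + n%:R + 1) x lam)) +
    ci * (u x * (odd_const * lam * x * K (al + n%:R + 1) x lam))))%C.
  rewrite B_knE Ec /u /v; case: (f x) => a b /=; simpc.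
  by congr (_ +i* _)%C; ring.
have -> : (fun x => complex.Re (f x * B_kn n k x lam)) = (fun x => u x * K (al + 1) x lam +
    cr * (u x * (odd_const * lam * x * K (al + n%:R + 1) x lam)) +
    (- ci) * (v x * (odd_const * lam * x * K (al + n%:R + 1) x lam))).
  by apply/funext => x; rewrite fB.
have -> : (fun x => complex.Im (f x * B_kn n k x lam)) = (fun x => v x * K (al + 1) x lam +
    cr * (v x * (odd_const * lam * x * K (al + n%:R + 1) x lam)) +
    ci * (u x * (odd_const * lam * x * K (al + n%:R + 1) x lam))).
  by apply/funext => x; rewrite fB.
rewrite !Rintegral_component //; simpc.
by congr (_ +i* _)%C; ring.
Qed.

Lemma even_transformN (h : R -> R) lam : even_transform h (- lam) = even_transform h lam.
Proof. by rewrite /even_transform /hankel normrN. Qed.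

Lemma odd_transformN (h : R -> R) lam : odd_transform h (- lam) = odd_transform h lam.
Proof. by rewrite /odd_transform /hankel normrN. Qed.

Let sym lam := cabs (F_kn n k f lam) + cabs (F_kn n k f (- lam)).

Let Ev lam := (W * even_transform u lam +i* (W * even_transform v lam))%C.

Let Od lam := (W * odd_const * lam * odd_transform u lam +i*
  (W * odd_const * lam * odd_transform v lam))%C.

Let F_knN lam : F_kn n k f (- lam) = Ev lam - ((- 'i) ^+ n)%C * Od lam.
Proof.
rewrite F_knE !even_transformN !odd_transformN /Ev /Od -mulrN; congr (_ + _ * _).
by simpc; congr (_ +i* _)%C; ring.
Qed.

Let F_knP lam : F_kn n k f lam = Ev lam + ((- 'i) ^+ n)%C * Od lam.
Proof. exact: F_knE. Qed.

(** The sum of the transform at [lam] and at [- lam] is twice its even part. *)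
Lemma even_transform_bound lam :
  `|W * even_transform u lam| <= sym lam /\ `|W * even_transform v lam| <= sym lam.
Proof.
have h : cabs (Ev lam) <= sym lam.
  apply: le_trans (cabs_double _) _; apply: le_trans (cabsD _ _).
  by rewrite F_knN F_knP addrCA addrK addrC.
by split; apply: le_trans h; [exact: (Re_le_cabs (Ev lam))|exact: (Im_le_cabs (Ev lam))].
Qed.

(** The difference of the two values is twice the odd part, and the factor [(- 'i) ^+ n] has modulus
    [1]. *)
Lemma odd_transform_bound lam :
  `|W * odd_const * lam * odd_transform u lam| <= sym lam /\
  `|W * odd_const * lam * odd_transform v lam| <= sym lam.
Proof.
have h : cabs (Od lam) <= sym lam.
  have -> : cabs (Od lam) = cabs (((- 'i) ^+ n)%C * Od lam).
    by rewrite cabsM cabsX cabsN cabs_i expr1n mul1r.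
  have -> : sym lam = cabs (F_kn n k f lam) + cabs (- F_kn n k f (- lam)).
    by rewrite [cabs (- _)]cabsN.
  apply: le_trans (cabs_double _) _; apply: le_trans (cabsD _ _).
  rewrite F_knN F_knP; move: (((- 'i) ^+ n)%C * Od lam) (Ev lam) => X Y.
  by rewrite opprB [Y + X + _]addrC addrA subrK.
by split; apply: le_trans h; [exact: (Re_le_cabs (Od lam))|exact: (Im_le_cabs (Od lam))].
Qed.

End Formula.

End Transform.

(** * The uncertainty principle for the generalized Fourier transform *)

Section Uncertainty.
Context {R : realType}.
Local Notation leb := (@lebesgue_measure R).

Lemma dominated_sym s (G : R -> R) M :
  dominated s G M -> dominated s (fun x => G x + G (- x)) (M + M).
Proof.
move=> [H [H0 LH GH]]; exists (fun x => H x + H (- x)); split.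
- by move=> x; rewrite addr_ge0.
- apply: L1_ext (L1D LH (L1_opp LH)) => x; by rewrite normrN mulrDr.
- by move=> x; apply: le_trans (lerD (GH x) (GH (- x))) _; rewrite addrACA.
Qed.

Lemma tame_sym s (G : R -> R) : tame s G -> tame s (fun x => G x + G (- x)).
Proof. by move=> [M [M0 h]]; exists (M + M); split; [exact: addr_ge0|exact: dominated_sym]. Qed.

Lemma small_sym s (G : R -> R) : small s G -> small s (fun x => G x + G (- x)).
Proof.
move=> h e e0; rewrite [e]splitr; apply: dominated_sym; apply: h.
by rewrite divr_gt0.
Qed.

Lemma measurable_cabs (f : R -> R[i]) : cmeasurable f ->
  measurable_fun [set: R] (fun x => cabs (f x)).
Proof.
move=> [mu mv].
have -> : (fun x => cabs (f x)) =
    fun x => Num.sqrt (complex.Re (f x) ^+ 2 + complex.Im (f x) ^+ 2).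
  by apply/funext => x; case: (f x).
apply: (@measurableT_comp _ _ _ _ _ _ (@Num.sqrt R)).
  by apply: continuous_measurable_fun; exact: sqrt_continuous.
by apply: measurable_funD; exact: measurable_funX.
Qed.

Variables (n : nat) (k : R).
Hypotheses (n1 : (1 <= n)%N) (hk : (n%:R - 1) / (2 * n%:R) <= k).

Local Notation r := (2 / n%:R : R).
Local Notation s := (exponent_kn n k).
Local Notation W := (const_kn n k).
Local Notation q := ((n%:R / 2) ^+ 2 : R).

Let n0 : 0 < n%:R :> R. Proof. by rewrite ltr0n. Qed.
Let r0 : 0 < r. Proof. exact: radius_gt0. Qed.
Let s0 : 0 < s. Proof. exact: exponent_kn_gt0. Qed.
Let W0 : 0 < W. Proof. exact: const_kn_gt0. Qed.

Definition weighted c (f : R -> R[i]) (x : R) : R := expR (n%:R * c * `|x| `^ r) * cabs (f x).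

Lemma weighted_ge0 c f x : 0 <= weighted c f x.
Proof. by rewrite mulr_ge0 ?expR_ge0 ?cabs_ge0. Qed.

Lemma measurable_weighted c f : cmeasurable f -> measurable_fun [set: R] (weighted c f).
Proof.
move=> mf; apply: measurable_funM; last exact: measurable_cabs.
apply: (@measurableT_comp _ _ _ _ _ _ (@expR R)) => //.
by apply: measurable_funM => //; exact: measurable_absp.
Qed.

(** The multiplier [m] is the constant [1] for the even transform and the variable for the odd one,
    with [rho] equal to [0] and [1]. *)
Lemma weighted_L1 c f (h m : R -> R) (rho : R) : 0 < c -> 0 <= rho -> tame s (weighted c f) ->
  measurable_fun [set: R] h -> measurable_fun [set: R] m ->
  (forall x, `|h x| <= cabs (f x)) -> (forall x : R, `|m x| <= `|x| `^ rho) ->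
  L1 leb (fun x => h x * m x * `|x| `^ (s - 1)).
Proof.
move=> c0 rho0 tf mh mm hf hm; have nc : 0 < n%:R * c by rewrite mulr_gt0.
pose Phi x := h x * m x * `|x| `^ (s - 1) * expR (n%:R * c * `|x| `^ r).
have mPhi : measurable_fun [set: measurableTypeR R] Phi.
  apply: measurable_funM; last first.
    apply: (@measurableT_comp _ _ _ _ _ _ (@expR R)) => //.
    by apply: measurable_funM => //; exact: measurable_absp.
  by apply: measurable_funM; [exact: measurable_funM|exact: measurable_absp].
have hPhi x : `|Phi x| <= 1 * (`|x| `^ rho * (`|x| `^ (s - 1) * weighted c f x)).
  rewrite /Phi !normrM (ger0_norm (expR_ge0 _)) (ger0_norm (powR_ge0 _ _)) /weighted mul1r.
  rewrite [leLHS](_ : _ = `|m x| * (`|x| `^ (s - 1) * (expR (n%:R * c * `|x| `^ r) * `|h x|))); last by ring.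
  by apply: ler_pM => //; rewrite ?mulr_ge0 ?powR_ge0 ?expR_ge0 // !ler_wpM2l ?powR_ge0 ?expR_ge0.
apply: L1_ext (tame_L1_expR r0 s0 rho0 ler01 mPhi hPhi nc tf) => x.
by rewrite /Phi -mulrA -expRD addrN expR0 mulr1.
Qed.

Section Zero.
Variables (a b : R) (p t : \bar R) (f : R -> R[i]).
Hypotheses (a0 : 0 < a) (b0 : 0 < b) (p1 : (1 <= p)%E) (t1 : (1 <= t)%E).
Hypotheses (pt : (p < +oo)%E \/ (t < +oo)%E) (mf : cmeasurable f).
Hypothesis fp : (weighted_norm n k a p f < +oo)%E.
Hypothesis ft : (weighted_norm n k b t (F_kn n k f) < +oo)%E.
Hypothesis ab : 4^-1 <= a * b.

Let u x := complex.Re (f x).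
Let v x := complex.Im (f x).
Let mu : measurable_fun [set: R] u. Proof. by case: mf. Qed.
Let mv : measurable_fun [set: R] v. Proof. by case: mf. Qed.
Let hu x : `|u x| <= cabs (f x). Proof. exact: Re_le_cabs. Qed.
Let hv x : `|v x| <= cabs (f x). Proof. exact: Im_le_cabs. Qed.

Let tame1 : tame s (weighted a f).
Proof. exact: Lnorm_tame n1 hk _ _ p1 (measurable_weighted a mf) (weighted_ge0 a f) fp. Qed.

Let L1e (h : R -> R) : measurable_fun [set: R] h -> (forall x, `|h x| <= cabs (f x)) ->
  L1 leb (fun x => h x * `|x| `^ (s - 1)).
Proof.
move=> mh hf; have := @weighted_L1 a f h (cst 1) 0 a0 (lexx _) tame1 mh (measurable_cst _) hf.
move=> L; apply: L1_ext (L _) => x /=; first by rewrite mulr1.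
by rewrite normr1 powRr0.
Qed.

Let L1o (h : R -> R) : measurable_fun [set: R] h -> (forall x, `|h x| <= cabs (f x)) ->
  L1 leb (fun x => h x * x * `|x| `^ (s - 1)).
Proof.
move=> mh hf; apply: (@weighted_L1 a f h id 1 a0 ler01 tame1 mh _ hf) => // x.
by rewrite powRr1.
Qed.

Let mE (h : R -> R) : L1 leb (fun x => h x * `|x| `^ (s - 1)) -> measurable_fun [set: R] (even_transform n k h).
Proof.
move=> L; rewrite /even_transform -(exponent_knE k n1); apply: (measurable_hankel r0 _ _ L).
  by rewrite exponent_knE //; have := alpha_kn_ge n1 hk; lra.
exact: sqr_ge0.
Qed.

Let mO (h : R -> R) : L1 leb (fun x => h x * x * `|x| `^ (s - 1)) -> measurable_fun [set: R] (odd_transform n k h).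
Proof.
move=> L; rewrite /odd_transform -(exponent_knE2 k n1); apply: (measurable_hankel r0 _ _ L).
  by rewrite exponent_knE2 //; have := alpha_kn_ge n1 hk; have := n0; lra.
exact: sqr_ge0.
Qed.

Let measurable_comb (w c1 c2 d : R) (e o1 o2 : R -> R) : measurable_fun [set: R] e ->
  measurable_fun [set: R] o1 -> measurable_fun [set: R] o2 ->
  measurable_fun [set: R] (fun x => w * e x + (c1 * (d * x * o1 x) + c2 * (d * x * o2 x))).
Proof.
move=> me m1 m2.
apply: measurable_funD; first exact: measurable_funM.
by apply: measurable_funD; do ![apply: measurable_funM => //].
Qed.

Let mF : cmeasurable (F_kn n k f).
Proof.
have FE := F_knE n1 hk mf (L1e mu hu) (L1e mv hv) (L1o mu hu) (L1o mv hv).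
have meu := mE (L1e mu hu); have mev := mE (L1e mv hv).
have mou := mO (L1o mu hu); have mov := mO (L1o mv hv).
rewrite /cmeasurable; move: FE; case: ((- 'i) ^+ n : R[i])%C => cr ci FE; split.
  have -> : (fun x => complex.Re (F_kn n k f x)) = fun x => W * even_transform n k u x +
     (cr * (W * odd_const n k * x * odd_transform n k u x) +
      - ci * (W * odd_const n k * x * odd_transform n k v x)).
    by apply/funext => x; rewrite FE; simpc => /=; ring.
  exact: measurable_comb meu mou mov.
have -> : (fun x => complex.Im (F_kn n k f x)) = fun x => W * even_transform n k v x +
     (cr * (W * odd_const n k * x * odd_transform n k v x) +
      ci * (W * odd_const n k * x * odd_transform n k u x)).
  by apply/funext => x; rewrite FE; simpc.
exact: measurable_comb mev mov mou.
Qed.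

Let G2 x := weighted b (F_kn n k f) x + weighted b (F_kn n k f) (- x).

Let tame2 : tame s G2.
Proof.
by apply: tame_sym; exact: Lnorm_tame n1 hk _ _ t1 (measurable_weighted b mF) (weighted_ge0 b _) ft.
Qed.

Let small12 : small s (weighted a f) \/ small s G2.
Proof.
case: pt => h; [left|right].
  exact: Lnorm_small n1 hk _ _ p1 (measurable_weighted a mf) (weighted_ge0 a f) fp h.
by apply: small_sym; exact: Lnorm_small n1 hk _ _ t1 (measurable_weighted b mF) (weighted_ge0 b _) ft h.
Qed.

Let sym x := cabs (F_kn n k f x) + cabs (F_kn n k f (- x)).

Let G2E x : G2 x = expR (n%:R * b * `|x| `^ r) * sym x.
Proof. by rewrite /G2 /weighted normrN mulrDr. Qed.

(* Shrinking [a] to [(4 b)^-1] makes the exponents critical. *)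
Let a' := (4 * b)^-1.
Let a'0 : 0 < n%:R * a'. Proof. by rewrite mulr_gt0 // invr_gt0 mulr_gt0. Qed.
Let nb0 : 0 < n%:R * b. Proof. by rewrite mulr_gt0. Qed.
Let a'q : n%:R * a' * (n%:R * b) = q.
Proof. by rewrite /a'; field; rewrite gt_eqF. Qed.

Let expa' (h : R -> R) x : `|h x| <= cabs (f x) -> `|h x| * expR (n%:R * a' * `|x| `^ r) <= weighted a f x.
Proof.
move=> hf; rewrite /weighted mulrC; apply: ler_pM => //.
rewrite ler_expR ler_wpM2r ?powR_ge0 // ler_wpM2l ?(ltW n0) //.
by rewrite /a' invfM -ler_pdivlMr ?invr_gt0 // invrK.
Qed.

(** The Hankel principle applied to [h] and to [x h(x)], both with the density, says that the even
    and the odd part of [h] vanish almost everywhere. *)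
Lemma component_ae_eq0 (h : R -> R) : measurable_fun [set: R] h -> (forall x, `|h x| <= cabs (f x)) ->
  (forall x, `|W * even_transform n k h x| <= sym x) ->
  (forall x, `|W * odd_const n k * x * odd_transform n k h x| <= sym x) ->
  {ae leb, forall x, h x = 0}.
Proof.
move=> mh hf hE hO; have c0 := odd_const_gt0 n1 hk.
have mW : measurable_fun [set: measurableTypeR R] (fun x : R => `|x| `^ (s - 1)) by exact: measurable_absp.
have ev : {ae leb, forall x, h x * `|x| `^ (s - 1) + h (- x) * `|- x| `^ (s - 1) = 0}.
  have hb : 2^-1 <= (s + 2 * 0) / r.
    by rewrite mulr0 addr0 exponent_knE //; have := alpha_kn_ge n1 hk; lra.
  have Wi : 0 <= W^-1 by rewrite invr_ge0 ltW.
  apply: (@hankel_uncertainty R r s 0 (n%:R * a') (n%:R * b) q 1 W^-1 _ (weighted a f) G2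
    r0 s0 (lexx _) a'0 nb0 a'q hb ler01 Wi) => // [|x|x].
  - exact: measurable_funM.
  - rewrite powRr0 !mul1r normrM (ger0_norm (powR_ge0 _ _)) mulrAC mulrC.
    by rewrite ler_wpM2l ?powR_ge0 // expa'.
  - rewrite powRr0 mul1r mulr0 addr0 exponent_knE // -/(even_transform n k h) G2E.
    rewrite [leLHS](_ : _ = W^-1 * (`|x| `^ (s - 1) * (expR (n%:R * b * `|x| `^ r) *
      `|W * even_transform n k h x|))).
      by rewrite !ler_wpM2l ?powR_ge0 ?expR_ge0.
    by rewrite normrM (gtr0_norm W0); field; rewrite gt_eqF.
have od : {ae leb, forall x, h x * x * `|x| `^ (s - 1) + h (- x) * - x * `|- x| `^ (s - 1) = 0}.
  have hb : 2^-1 <= (s + 2 * 1) / r.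
    by rewrite mulr1 exponent_knE2 //; have := alpha_kn_ge n1 hk; have := n0; lra.
  have Wi : 0 <= (W * odd_const n k)^-1 by rewrite invr_ge0 mulr_ge0 // ltW.
  apply: (@hankel_uncertainty R r s 1 (n%:R * a') (n%:R * b) q 1 (W * odd_const n k)^-1
    (fun x => h x * x * `|x| `^ (s - 1)) (weighted a f) G2
    r0 s0 ler01 a'0 nb0 a'q hb ler01 Wi) => // [|x|x].
  - by apply: measurable_funM => //; exact: measurable_funM.
  - rewrite powRr1 // mul1r !normrM (ger0_norm (powR_ge0 _ _)).
    rewrite [leLHS](_ : _ = `|x| * (`|x| `^ (s - 1) * (`|h x| * expR (n%:R * a' * `|x| `^ r)))); last by ring.
    by rewrite !ler_wpM2l ?powR_ge0 // expa'.
  - rewrite powRr1 // mulr1 exponent_knE2 // -/(odd_transform n k h) G2E.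
    (* At the origin the power [|x|^(s+1)] vanishes; elsewhere it supplies the factor [x] that the
       bound on the odd transform needs. *)
    have [->|x0] := eqVneq x 0.
      by rewrite normr0 powR0 ?mulr0 ?mul0r ?mulr0 //; have := s0; lra.
    have -> : `|x| `^ (s + 2 - 1) = `|x| * `|x| * `|x| `^ (s - 1).
      have ax : `|x| != 0 by rewrite normr_eq0.
      rewrite -[X in X * X * _]powRr1 // -!powRD ?(negbTE ax) ?implybT //.
      by congr (_ `^ _); ring.
    rewrite [leLHS](_ : _ = (W * odd_const n k)^-1 * (`|x| * (`|x| `^ (s - 1) *
      (expR (n%:R * b * `|x| `^ r) * `|W * odd_const n k * x * odd_transform n k h x|)))).
      by rewrite !ler_wpM2l ?powR_ge0 ?expR_ge0.
    rewrite (normrM (W * odd_const n k * x)) (normrM (W * odd_const n k)).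
    rewrite (gtr0_norm (mulr_gt0 W0 c0)); field.
    by rewrite (gt_eqF W0) (gt_eqF c0).
have nz : {ae leb, forall x : R, x != 0}.
  exists [set 0]; split; [exact: measurable_set1|exact: lebesgue_measure_set1|].
  by move=> x /= /negP; rewrite negbK => /eqP.
have fl := ae_filter_ringOfSetsType leb.
apply: (@filterS2 _ _ fl _ _ _ _ (@filterI _ _ fl _ _ ev od) nz) => x [].
rewrite normrN => e1 e2 x0.
have w0 : 0 < `|x| `^ (s - 1) by rewrite powR_gt0 // normr_gt0.
have : (2 * x * `|x| `^ (s - 1)) * h x = 0.
  rewrite [LHS](_ : _ = x * (h x * `|x| `^ (s - 1) + h (- x) * `|x| `^ (s - 1)) +
    (h x * x * `|x| `^ (s - 1) + h (- x) * - x * `|x| `^ (s - 1))); last by ring.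
  by rewrite e1 e2 mulr0 addr0.
by move/eqP; rewrite !mulf_eq0 pnatr_eq0 (negbTE x0) (gt_eqF w0) => /eqP.
Qed.

Theorem F_kn_uncertainty : {ae leb, forall x, f x = 0}.
Proof.
have bE x := even_transform_bound n1 hk mf (L1e mu hu) (L1e mv hv) (L1o mu hu) (L1o mv hv) x.
have bO x := odd_transform_bound n1 hk mf (L1e mu hu) (L1e mv hv) (L1o mu hu) (L1o mv hv) x.
have zu := component_ae_eq0 mu hu (fun x => (bE x).1) (fun x => (bO x).1).
have zv := component_ae_eq0 mv hv (fun x => (bE x).2) (fun x => (bO x).2).
apply: (@filterS2 _ _ (ae_filter_ringOfSetsType leb) _ _ _ _ zu zv) => x.
by rewrite /u /v; case: (f x) => y z /= -> ->.
Qed.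

End Zero.

End Uncertainty.

(** * Gaussians below the critical product *)

Section Sharpness.
Context {R : realType}.
Local Notation leb := (@lebesgue_measure R).
Variables (n : nat) (k : R).
Hypotheses (n1 : (1 <= n)%N) (hk : (n%:R - 1) / (2 * n%:R) <= k).

Local Notation r := (2 / n%:R : R).
Local Notation s := (exponent_kn n k).
Local Notation W := (const_kn n k).
Local Notation q := ((n%:R / 2) ^+ 2 : R).

Let n0 : 0 < n%:R :> R. Proof. by rewrite ltr0n. Qed.
Let r0 : 0 < r. Proof. exact: radius_gt0. Qed.
Let s0 : 0 < s. Proof. exact: exponent_kn_gt0. Qed.
Let W0 : 0 < W. Proof. exact: const_kn_gt0. Qed.

Definition gauss (z x : R) : R := expR (- (z * `|x| `^ r)).

Definition cgauss (z x : R) : R[i] := (gauss z x)%:C%C.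

Lemma cmeasurable_cgauss z : cmeasurable (cgauss z).
Proof. by split; [exact: measurable_gauss|exact: measurable_cst]. Qed.

(** The odd transform vanishes by parity and the even one is given by [gauss_bessel]. *)
Lemma F_kn_gauss (z lam : R) : 0 < z ->
  F_kn n k (cgauss z) lam = (W * gweight r s z * gauss (q / z) lam)%:C%C.
Proof.
move=> z0; have z2 : 0 < z / 2 by rewrite divr_gt0.
have L : L1 leb (fun x => gauss z x * `|x| `^ (s - 1)).
  by apply: L1_ext (L1_gfun r0 s0 z0) => x; exact: mulrC.
have [C [C0 hC]] := powR_expR_bounded (divr_ge0 ler01 (ltW r0)) z2.
have Lo : L1 leb (fun x => gauss z x * x * `|x| `^ (s - 1)).
  apply: L1_le _ _ (L1Z C (L1_gfun r0 s0 z2)) => [|x].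
    apply: measurable_funM; last exact: measurable_absp.
    by apply: measurable_funM => //; exact: measurable_gauss.
  rewrite !normrM (ger0_norm (expR_ge0 _)) (ger0_norm (powR_ge0 _ _)) /gfun /gauss.
  have := hC _ (powR_ge0 `|x| r); rewrite -powRrM mulrCA divff ?gt_eqF // mulr1 powRr1 // => h.
  have -> : expR (- (z * `|x| `^ r)) = expR (- (z / 2 * `|x| `^ r)) * expR (- (z / 2 * `|x| `^ r)).
    by rewrite -expRD; congr expR; field.
  rewrite [leLHS](_ : _ = `|x| * expR (- (z / 2 * `|x| `^ r)) *
    (`|x| `^ (s - 1) * expR (- (z / 2 * `|x| `^ r)))); last by ring.
  by rewrite ler_wpM2r // mulr_ge0 ?powR_ge0 ?expR_ge0.
have Z1 : L1 leb (fun x => 0 * `|x| `^ (s - 1)) by apply: L1_ext (L1_0 leb) => x; rewrite mul0r.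
have Z2 : L1 leb (fun x => 0 * x * `|x| `^ (s - 1)).
  by apply: L1_ext (L1_0 leb) => x; rewrite !mul0r.
rewrite (F_knE n1 hk (cmeasurable_cgauss z) L Z1 Lo Z2) /=.
have e0 : even_transform n k (fun=> 0) lam = 0.
  by rewrite /even_transform /hankel -[RHS](rint0 leb); apply: rint_ext => x; rewrite !mul0r.
have o0 : odd_transform n k (fun=> 0) lam = 0.
  by rewrite /odd_transform /hankel -[RHS](rint0 leb); apply: rint_ext => x; rewrite !mul0r.
have o1 : odd_transform n k (gauss z) lam = 0.
  rewrite /odd_transform /hankel; set F := (fun x => _).
  have hb : 2^-1 <= alpha_kn n k + n%:R + 1.
    by have := alpha_kn_ge n1 hk; have := n0; lra.
  have LF : L1 leb F.
    apply: (@L1M_bounded _ _ _ _ _ _ 1 Lo) => [|x].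
      apply: (@measurableT_comp _ _ _ _ _ _ (bessel (alpha_kn n k + n%:R + 1))).
        by apply: continuous_measurable_fun; exact: continuous_bessel.
      by apply: measurable_funM => //; apply: measurable_funM => //; exact: measurable_absp.
    by apply: bessel_le1 => //; rewrite !mulr_ge0 ?powR_ge0 ?sqr_ge0.
  have : rint leb F = - rint leb F.
    rewrite -mulN1r -rintZ // -[LHS]rint_opp; last exact: LF.
    by apply: rint_ext => x; rewrite /F /gauss normrN; ring.
  lra.
have e1 : even_transform n k (gauss z) lam = gweight r s z * gauss (q / z) lam.
  rewrite /even_transform /hankel.
  have y0 : 0 <= q * `|lam| `^ r by rewrite mulr_ge0 ?powR_ge0 ?sqr_ge0.
  have hb : 2^-1 <= s / r by rewrite exponent_knE //; have := alpha_kn_ge n1 hk; lra.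
  have -> : gauss (q / z) lam = expR (- (q * `|lam| `^ r / z)) by rewrite /gauss mulrAC.
  rewrite -(gauss_bessel r0 s0 hb z0 y0) exponent_knE //; apply: rint_ext => x.
  by rewrite mulrC (mulrAC q) [X in _ * X]mulrC.
rewrite -[even_transform n k _ lam]/(even_transform n k (gauss z) lam).
rewrite -[odd_transform n k (fun x => gauss z x) lam]/(odd_transform n k (gauss z) lam).
rewrite e1 e0 o0 o1; simpc; by rewrite mulrA.
Qed.

Lemma weighted_norm_gauss_lty c z (p : \bar R) (C : R) : (1 <= p)%E -> n%:R * c < z ->
  (weighted_norm n k c p (fun x => (C * gauss z x)%:C%C) < +oo)%E.
Proof.
move=> p1 cz; have d0 : 0 < z - n%:R * c by rewrite subr_gt0.
apply: (gauss_Lnorm_lty n1 hk (C := `|C|) p1 d0) => [|x].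
  apply: measurable_funM.
    apply: (@measurableT_comp _ _ _ _ _ _ (@expR R)) => //.
    by apply: measurable_funM => //; exact: measurable_absp.
  apply: measurable_cabs; split; last exact: measurable_cst.
  by apply: measurable_funM => //; exact: measurable_gauss.
rewrite cabs_real !normrM normr_id !(ger0_norm (expR_ge0 _)) mulrCA -expRD.
by rewrite ler_wpM2l // ler_expR /gauss; lra.
Qed.

Lemma ae_exists_gt (P : R -> Prop) (M : R) : {ae leb, forall x, P x} -> exists2 x, M < x & P x.
Proof.
move=> [N [mN N0 hN]]; apply: contrapT => h.
have sub : (`]M, M + 1]%classic : set (measurableTypeR R)) `<=` N.
  move=> x /=; rewrite in_itv /= => /andP[Mx _]; apply: hN => Px; apply: h.
  by exists x.
have : (leb (`]M, (M + 1)%R]%classic : set (measurableTypeR R)) <= 0)%E.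
  rewrite -[leRHS]N0.
  exact: (@le_measure _ _ _ leb _ _ (mem_set (@measurable_itv R `]M, M + 1])) (mem_set mN) sub).
rewrite lebesgue_measure_itv /= lte_fin ltrDl ltr01 -EFinB lee_fin addrAC subrr add0r.
by rewrite ler10.
Qed.

(* The term with the slowest decay dominates all the others at infinity. *)
Lemma cgauss_free (z : nat -> R) : (forall i j, (i < j)%N -> z j < z i) ->
  forall (N : nat) (c : nat -> R[i]),
  {ae leb, forall x, \sum_(j < N) c j * cgauss (z j) x = 0} -> forall j, (j < N)%N -> c j = 0.
Proof.
move=> dz; elim=> [//|N IH] c hc.
suff cN : c N = 0.
  move=> j; rewrite ltnS leq_eqVlt => /orP[/eqP -> //|]; apply: IH.
  apply: (@filterS _ _ (ae_filter_ringOfSetsType leb)) hc => x.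
  by rewrite big_ord_recr /= cN mul0r addr0.
case: N IH hc => [|N] IH hc.
  have [x _] := ae_exists_gt 0 hc; rewrite big_ord1 /= => /eqP.
  rewrite mulf_eq0 => /orP[/eqP //|/eqP h]; exfalso.
  have := congr1 (@complex.Re R) h => /= /eqP.
  by rewrite gt_eqF // expR_gt0.
pose C := \sum_(j < N.+1) cabs (c j).
have C0 : 0 <= C by apply: sumr_ge0 => j _; exact: cabs_ge0.
pose d := z N - z N.+1; have d0 : 0 < d by rewrite subr_gt0 dz.
have le_z j : (j <= N)%N -> z N <= z j.
  by rewrite leq_eqVlt => /orP[/eqP -> //|jN]; rewrite ltW // dz.
apply: contrapT => /eqP cN0.
have e0 : 0 < cabs (c N.+1).
  by rewrite lt_neqAle cabs_ge0 andbT eq_sym; apply/eqP => /cabs0_eq0 /eqP; rewrite (negbTE cN0).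
(* Chosen so that [cabs (c N.+1) * (d * X0) = C]: beyond it the lower bound [1 + d X] for [exp(d X)]
   already contradicts the relation. *)
pose X0 := C / d / cabs (c N.+1).
have X00 : 0 <= X0 by rewrite !divr_ge0 // ltW.
have [x hx sx] := ae_exists_gt (X0 `^ r^-1) hc.
have x0 : 0 < x by apply: le_lt_trans hx; exact: powR_ge0.
have hX : X0 < `|x| `^ r.
  have E : X0 = (X0 `^ r^-1) `^ r by rewrite -powRrM mulVf ?powRr1 // gt_eqF.
  rewrite gtr0_norm // [ltLHS]E.
  by apply: gt0_ltr_powR => //; rewrite nnegrE ?powR_ge0 // ltW.
have g0 y : 0 < gauss y x by exact: expR_gt0.
have : cabs (c N.+1) * gauss (z N.+1) x <= C * gauss (z N) x.
  have -> : cabs (c N.+1) * gauss (z N.+1) x = cabs (\sum_(j < N.+1) c j * cgauss (z j) x).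
    move: sx; rewrite big_ord_recr /= => /eqP; rewrite addr_eq0 => /eqP ->.
    by rewrite cabsN cabsM cabs_real gtr0_norm.
  apply: le_trans (cabs_sum _ _ _) _; rewrite mulr_suml; apply: ler_sum => j _.
  rewrite cabsM cabs_real gtr0_norm // ler_wpM2l ?cabs_ge0 //.
  by rewrite ler_expR lerN2 ler_wpM2r ?powR_ge0 // le_z // -ltnS.
have -> : gauss (z N.+1) x = gauss (z N) x * expR (d * `|x| `^ r).
  by rewrite /gauss -expRD; congr expR; rewrite /d; ring.
rewrite mulrCA [leRHS]mulrC ler_pM2l // => h.
have h2 : cabs (c N.+1) * (1 + d * `|x| `^ r) <= C.
  by apply: le_trans h; rewrite ler_wpM2l ?(ltW e0) // expR_ge1Dx.
have : C < cabs (c N.+1) * (1 + d * `|x| `^ r).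
  have -> : C = cabs (c N.+1) * (d * X0) by rewrite /X0; field; rewrite !gt_eqF.
  rewrite ltr_pM2l //; apply: ltr_pwDl => //.
  by rewrite ler_wpM2l // ltW.
by rewrite ltNge h2.
Qed.

Theorem F_kn_sharpness (a b : R) (p t : \bar R) : 0 < a -> 0 < b -> (1 <= p)%E -> (1 <= t)%E ->
  a * b < 4^-1 ->
  exists g : nat -> R -> R[i],
    (forall j, [/\ cmeasurable (g j),
                  (weighted_norm n k a p (g j) < +oo)%E &
                  (weighted_norm n k b t (F_kn n k (g j)) < +oo)%E]) /\
    (forall (N : nat) (c : nat -> R[i]),
       {ae leb, forall x, \sum_(j < N) c j * g j x = 0} ->
       forall j, (j < N)%N -> c j = 0).
Proof.
move=> a0 b0 p1 t1 ab; pose d := n%:R / (4 * b) - n%:R * a.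
have d0 : 0 < d.
  rewrite subr_gt0 ltr_pdivlMr ?mulr_gt0 //.
  have -> : n%:R * a * (4 * b) = n%:R * (4 * (a * b)) by ring.
  by rewrite -[ltRHS]mulr1 ltr_pM2l //; lra.
(* A strictly decreasing sequence, as [cgauss_free] requires. Dividing by [j.+2] keeps [z 0]
   strictly below [n / (4 b)], and then [q / z j > n b] because [q = n b * n / (4 b)]. *)
pose z j := n%:R * a + d / j.+2%:R.
have az j : n%:R * a < z j by rewrite ltrDl divr_gt0.
have z0 j : 0 < z j by apply: lt_trans (az j); rewrite mulr_gt0.
have zb j : n%:R * b < q / z j.
  rewrite ltr_pdivlMr //; have h : z j < n%:R / (4 * b).
    have -> : n%:R / (4 * b) = n%:R * a + d by rewrite /d addrC subrK.
    by rewrite ltrD2l ltr_pdivrMr // -[ltLHS]mulr1 ltr_pM2l // ltr1n.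
  have nb : 0 < n%:R * b by rewrite mulr_gt0.
  have := ltr_pM2l nb (z j) (n%:R / (4 * b)); rewrite h => h2.
  have -> : q = n%:R * b * (n%:R / (4 * b)) by field; rewrite gt_eqF.
  by rewrite h2.
exists (fun j => cgauss (z j)); split=> [j|]; last first.
  apply: cgauss_free => i j ij; rewrite ltrD2l ltr_pM2l // ltf_pV2 ?posrE //.
  by rewrite ltr_nat.
split; first exact: cmeasurable_cgauss.
  have := weighted_norm_gauss_lty 1 p1 (az j).
  by rewrite (_ : (fun x => (1 * gauss (z j) x)%:C%C) = cgauss (z j)) //;
    apply/funext => x; rewrite mul1r.
have -> : F_kn n k (cgauss (z j)) = fun x => (W * gweight r s (z j) * gauss (q / z j) x)%:C%C.
  by apply/funext => x; exact: F_kn_gauss.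
exact: weighted_norm_gauss_lty.
Qed.

End Sharpness.

Theorem theorem5p4 (R : realType) (n : nat) (k a b : R) (p q : \bar R) :
  (1 <= n)%N ->
  (n%:R - 1) / (2 * n%:R) <= k ->
  0 < a -> 0 < b ->
  (1 <= p)%E -> (1 <= q)%E ->
  (p < +oo)%E \/ (q < +oo)%E ->
  (* 1. uncertainty: a b >= 1/4 forces f = 0 a.e. *)
  (forall f : R -> R[i],
     cmeasurable f ->
     (weighted_norm n k a p f < +oo)%E ->
     (weighted_norm n k b q (F_kn n k f) < +oo)%E ->
     4^-1 <= a * b ->
     {ae @lebesgue_measure R, forall x, f x = 0}) /\
  (* 2. sharpness: for a b < 1/4 infinitely many linearly independent such f *)
  (a * b < 4^-1 ->
   exists g : nat -> R -> R[i],
     (forall j, [/\ cmeasurable (g j),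
                   (weighted_norm n k a p (g j) < +oo)%E &
                   (weighted_norm n k b q (F_kn n k (g j)) < +oo)%E]) /\
     (forall (N : nat) (c : nat -> R[i]),
        {ae @lebesgue_measure R, forall x, \sum_(j < N) c j * g j x = 0} ->
        forall j, (j < N)%N -> c j = 0)).
Proof.
move=> n1 hk a0 b0 p1 q1 pq; split.
  by move=> f mf fp fq ab; exact: (F_kn_uncertainty n1 hk a0 b0 p1 q1 pq mf fp fq ab).
exact: F_kn_sharpness.
Qed.
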